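(* Let $B=\{I_j\}_{j=1}^N$ be a barcode where $I_1=[b_1,\infty)$ and where for $j\ge 2$ we have a strict containment $I_j=[b_j,d_j)\subset I_1$ with $d_j>d_{j+1}$. Let $\mu_B(I_j):=|\{I_k\in B\mid I_k\supsetneq I_j\}|$. The number of chiral merge trees realizing $B$ is $$|\Xi_{\mathcal X}^{-1}(B)|=2^{N-1}\prod_{j=2}^N\mu_B(I_j),$$ where $\Xi_{\mathcal X}:\mathcal X\to\mathcal B$ is the Chiral Elder map.
   Context: **Barcodes.** A barcode is a multiset of intervals of $\mathbb{R}$, each with finite multiplicity; $\mathcal{B}$ is the set of all barcodes. **Merge trees.** A merge tree is a connected, locally finite, contractible one-dimensional cell complex $T$ with a distinguished edge $e_\infty$ without compact closure, such that $T\setminus e_\infty$ is a compact tree rooted at $v_\infty$, the one vertex incident to $e_\infty$, together with a continuous map $\pi:T\to\mathbb{R}$ such that $\pi(e_\infty)=(\pi(v_\infty),\infty)$ and, for every injective path $\gamma:[0,1]\to T$ starting at a vertex and ending at $v_\infty$, $\pi\circ\gamma$ is monotonically increasing. A child of a vertex $v$ is a vertex $w$ joined to $v$ by an edge with $\pi(w)<\pi(v)$. Merge trees are isomorphic if there is a homeomorphism between them commuting with the maps to $\mathbb{R}$ (vertices that merely subdivide an edge may be removed). **Chiral merge trees.** A chiral merge tree is a merge tree in which every non-leaf vertex has two children, together with, for each such vertex, a labelling of the two edges to its children, one by $L$ (left) and the other by $R$ (right). Isomorphisms are isomorphisms of merge trees preserving the labels. $\mathcal X$ is the set of (isomorphism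 classes of) chiral merge trees. **Morse sets.** A Morse set is a functor $S:(\mathbb{R},\le)\to$ finite sets, with shift maps $\varphi_{tr}:S(r)\to S(t)$ for $r\le t$, together with a finite minimal set of times $\tau_1<\dots<\tau_n$ such that: (1) $S(t)=\varnothing$ for $t<\tau_1$; (2) $S|_{[\tau_i,\tau_{i+1})}$ is naturally isomorphic to the constant functor with value $S(\tau_i)$ for $1\le i\le n-1$; (3) $S(t)$ is a one-point set for $t\ge\tau_n$; (4) for every $x\in S(\tau_{i+1})$, the fiber $\varphi_{\tau_{i+1}\tau_i}^{-1}(x)$ has cardinality $0$, $1$ or $2$; (5) each $y\in S(t)$ is contained in a unique oldest maximal chain of the poset $P_S$. Here $P_S=\bigcup_t S(t)\times\{t\}$ with $(x,r)\preceq(y,t)$ iff $r\le t$ and $\varphi_{tr}(x)=y$, and $\pi:P_S\to\mathbb{R}$ is the projection; a chain $C_1$ is older than a chain $C_2$ if some $t_1\in\pi(C_1)$ satisfies $t_1<t_2$ for all $t_2\in\pi(C_2)$. **Elder Rule.** Let $P_1=P_S$ and let $C_1$ be the oldest maximal chain containing the element of $P_1$ over $\tau_n$. Inductively set $P_{i+1}=P_i\setminus C_i$; if it is nonempty, let $\tau_k$ be the largest of the times $\tau_1,\dots,\tau_n$ over which $P_{i+1}$ has an element, take an element of $P_{i+1}$ over $\tau_k$, and let $C_{i+1}$ be the oldest maximal chain of $P_{i+1}$ containing it. The resulting multiset of intervals $E(S)=\{\pi(C_i)\}$ is the barcode associated to $S$ by the Elder Rule. **Elder maps.** The merge tree associated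 to a Morse set $S$ is $\left(\bigsqcup_{i=1}^{n-1}S(\tau_i)\times[\tau_i,\tau_{i+1}]\sqcup S(\tau_n)\times[\tau_n,\infty)\right)/\!\sim$, where $(x,\tau_{i+1})$ with $x\in S(\tau_i)$ is identified with $(\varphi_{\tau_{i+1}\tau_i}(x),\tau_{i+1})$, projected to the second factor. A Morse tree is a merge tree associated to a Morse set; $\mathcal T$ is the set of isomorphism classes of Morse trees. The Elder map $\Xi:\mathcal T\to\mathcal B$ sends $\pi:T\to\mathbb{R}$ to $E(S)$, where $S(t)=\pi_0(\pi^{-1}(-\infty,t])$. The Chiral Elder map $\Xi_{\mathcal X}$ is the composition $\mathcal X\to\mathcal T\to\mathcal B$ that forgets the labels and then applies $\Xi$ (it is applied to chiral merge trees whose underlying merge tree is a Morse tree).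
   Formalization: Strict containment, in the hypothesis and in μ_B, is read as proper inclusion with strictly earlier birth; with proper inclusion alone the formula fails when births tie, e.g. {[0,∞),[0,1)} gives 2 but no Morse tree realizes it. For distinct births the two readings agree. *)

(* Defs.v *)
From HB Require Import structures.
From mathcomp Require Import all_boot all_order all_algebra.
From mathcomp Require Import all_classical all_reals all_analysis.
From mathcomp Require Import lra.
From Stdlib Require Import Relation_Operators.

Set Implicit Arguments.
Unset Strict Implicit.
Unset Printing Implicit Defensive.

Import Order.TTheory GRing.Theory Num.Theory.
Import numFieldNormedType.Exports.

Local Open Scope classical_set_scope.
Local Open Scope card_scope.
Local Open Scope ring_scope.

Section Barcodes.
Context {R : realType}.

(* A multiset of intervals is given by its multiplicity function. *)
Record barcode := Barcode {
  mult :> set R -> nat;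
  mult_interval : forall I, mult I <> 0%N -> is_interval I /\ I !=set0 }.

(* Containment of bars is strict at the birth end: bars born at the same time do
   not count as nested. If a bar J merged into a bar K with the same birth, the
   elements above the merge would lie in no unique oldest chain, so the tree
   would not be a Morse tree. Mere inequality of the two sets would also be no
   condition at all for half-open bars [b, d) inside [b1, +oo). *)
Definition strictly_contained (J K : set R) : Prop :=
  J `<` K /\ inf K < inf J.

Lemma strictly_contained_proper (J K : set R) : has_lbound K -> J !=set0 ->
  inf J <> inf K -> strictly_contained J K <-> J `<` K.
Proof.
move=> lbK J0 neq; split=> [[]//|JK]; split=> //.
have JleK : inf K <= inf J.
  apply: lb_le_inf => // x Jx; apply: ge_inf => //.
  by case: JK => JK _; apply: JK.
by rewrite lt_neqAle JleK andbT; apply/eqP => /esym.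
Qed.

Definition mu (B : barcode) (J : set R) : nat :=
  \big[addn/0%N]_(K \in [set K | strictly_contained J K]) mult B K.

End Barcodes.
Arguments barcode : clear implicits.

Section MorseSets.
Context {R : realType}.

Record persistent_set := PersistentSet {
  obj :> R -> Type;
  shift : forall r t : R, r <= t -> obj r -> obj t;
  shift_id : forall r (h : r <= r) x, shift h x = x;
  shift_comp : forall r s t (rs : r <= s) (st : s <= t) (rt : r <= t) x,
    shift st (shift rs x) = shift rt x }.

Section Elements.
Variable S : persistent_set.

Definition element := {t : R & S t}.

Definition element_le (p q : element) : Prop :=
  exists h : projT1 p <= projT1 q, shift h (projT2 p) = projT2 q.

Definition chain (C : set element) : Prop :=
  forall p q, C p -> C q -> element_le p q \/ element_le q p.

Definition maximal_chain (P C : set element) : Prop :=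
  [/\ C `<=` P, chain C &
      forall C', C' `<=` P -> chain C' -> C `<=` C' -> C' = C].

Definition times (C : set element) : set R := [set projT1 p | p in C].

Definition older (C1 C2 : set element) : Prop :=
  exists2 t1, times C1 t1 & forall t2, times C2 t2 -> t1 < t2.

Definition oldest_chain (P : set element) (p : element) (C : set element) :=
  [/\ maximal_chain P C, C p &
      forall C', maximal_chain P C' -> C' p -> C' <> C -> older C C'].

(* S is naturally isomorphic on [a, b) to the constant functor S(a). *)
Definition constant_on (a b : R) : Prop :=
  exists eta : forall t, a <= t < b -> S a -> S t,
    (forall t ht, bijective (eta t ht)) /\
    (forall r t hr ht (h : r <= t) x, shift h (eta r hr x) = eta t ht x).

Record change_times (tau : seq R) : Prop := {
  times_sorted : sorted <%R tau;
  times_nonempty : (0 < size tau)%N;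
  times_before : forall t, t < tau`_0 -> S t -> False;
  times_between : forall i, (i.+1 < size tau)%N ->
    constant_on tau`_i tau`_i.+1;
  times_after : forall t, tau`_(size tau).-1 <= t -> [set: S t] #= `I_1 }.

Record morse_set (tau : seq R) : Prop := {
  morse_finite : forall t, finite_set [set: S t];
  morse_times : change_times tau;
  morse_minimal : forall tau', change_times tau' -> {subset tau' <= tau} ->
    tau' = tau;
  morse_fibers : forall i, (i.+1 < size tau)%N ->
    forall (h : tau`_i <= tau`_i.+1) (x : S tau`_i.+1),
    exists2 k, (k <= 2)%N & [set y | shift h y = x] #= `I_k;
  morse_oldest : forall y : element, exists! C, oldest_chain setT y C }.

(* [elder tau P Is]: Is lists the intervals produced by some run of the Elder
   Rule starting from the subset P of elements. *)
Inductive elder (tau : seq R) : set element -> seq (set R) -> Prop :=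
| elder_stop : elder tau set0 [::]
| elder_step (P C : set element) (t : R) (x : S t) (Is : seq (set R)) :
    t \in tau -> P (existT _ t x) ->
    (forall s (y : S s), s \in tau -> P (existT _ s y) -> s <= t) ->
    oldest_chain P (existT _ t x) C ->
    elder tau (P `\` C) Is ->
    elder tau P (times C :: Is).

Definition elder_barcode (tau : seq R) (B : barcode R) : Prop :=
  exists2 Is, elder tau setT Is & forall J, mult B J = count_mem J Is.

Section AssociatedTree.
Variable tau : seq R.

Definition strip (i : nat) : set R :=
  if (i.+1 < size tau)%N then `[tau`_i, tau`_i.+1]%classic
  else `[tau`_i, +oo[%classic.

Record strip_point := StripPoint {
  strip_idx : 'I_(size tau);
  strip_elt : S tau`_strip_idx;
  strip_height : R;
  strip_heightP : strip strip_idx strip_height }.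

Inductive glue : strip_point -> strip_point -> Prop :=
| Glue (i j : 'I_(size tau)) (ij : j = i.+1 :> nat)
    (h : tau`_i <= tau`_j) (x : S tau`_i)
    (hi : strip i tau`_j) (hj : strip j tau`_j) :
    glue (StripPoint x hi) (StripPoint (shift h x) hj).

(* (T, f) is, up to a homeomorphism over R, the quotient space of the disjoint
   union of the strips by the equivalence generated by glue, with the
   projection to the second factor: q is the quotient map. *)
Definition associated_tree (T : topologicalType) (f : T -> R) : Prop :=
  exists q : strip_point -> T,
    [/\ forall y, exists a, q a = y,
        forall a b, q a = q b <-> clos_refl_sym_trans _ glue a b,
        forall U : set T, open U <->
          forall (i : 'I_(size tau)) (x : S tau`_i),
            open ([set t | exists h : strip i t, U (q (StripPoint x h))]
                  : set (subspace (strip i))) &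
        forall a, f (q a) = strip_height a].

End AssociatedTree.
End Elements.
End MorseSets.
Arguments persistent_set : clear implicits.

Section Topology.
Context {R : realType}.
Implicit Types T : topologicalType.

Definition path_joined T (A : set T) (x y : T) : Prop :=
  exists g : R -> T,
    [/\ {within `[0, 1], continuous g}, g 0 = x, g 1 = y &
        forall s, 0 <= s <= 1 -> A (g s)].

Definition path_component T (A : set T) (x : T) : set T :=
  [set y | path_joined A x y].

Definition contractible T : Prop :=
  exists (x0 : T) (H : T * R -> T),
    [/\ {within [set: T] `*` `[0, 1], continuous H},
        forall x, H (x, 0) = x & forall x, H (x, 1) = x0].

Lemma path_joined_refl T (A : set T) x : A x -> path_joined A x x.
Proof.
by move=> Ax; exists (cst x); split=> //; apply/continuous_subspaceT/cst_continuous.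
Qed.

Lemma path_joined_sub T (A B : set T) x y : A `<=` B ->
  path_joined A x y -> path_joined B x y.
Proof. by move=> AB [g [cg g0 g1 gA]]; exists g; split=> // s /gA /AB. Qed.

Lemma within_reparam T (B C : set R) (h : R -> R) (g : R -> T) :
  continuous h -> (forall s, B s -> C (h s)) -> {within C, continuous g} ->
  {within B, continuous (g \o h)}.
Proof.
move=> ch hBC /subspace_continuousP cg; apply/subspace_continuousP => s Bs.
apply: cvg_comp (cg _ (hBC _ Bs)) => U /= CU.
have := ch s _ CU; rewrite !nbhs_simpl /within /=; apply: filterS => z /= hz Bz; exact: (hz (hBC _ Bz)).
Qed.

Lemma path_joined_sym T (A : set T) x y : path_joined A x y -> path_joined A y x.
Proof.
move=> [g [cg g0 g1 gA]]; exists (g \o (fun s => 1 - s)); split.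
- apply: within_reparam cg => [s|s /=]; first by apply: continuousB; [exact: cst_continuous|exact: cvg_id].
  by rewrite !in_itv /=; lra.
- by rewrite /= subr0.
- by rewrite /= subrr.
- by move=> s s01; apply: gA; lra.
Qed.

Lemma path_joined_trans T (A : set T) x y z :
  path_joined A x y -> path_joined A y z -> path_joined A x z.
Proof.
move=> [g [cg g0 g1 gA]] [k [ck k0 k1 kA]].
pose a := g \o (fun s => 2 * s); pose b := k \o (fun s => 2 * s - 1).
pose f s := if s <= 2^-1 then a s else b s.
exists f; split; last 1 first.
- move=> s s01; rewrite /f; case: ifPn => h; [apply: gA|apply: kA]; lra.
- have -> : `[0, 1]%classic = `[0, 2^-1] `|` `[2^-1, 1] :> set R.
    apply/seteqP; split=> s /=; rewrite !in_itv /=.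
      by move=> ?; case: (leP s 2^-1) => h; [left|right]; lra.
    by case; lra.
  apply: withinU_continuous; [exact: itv_closed|exact: itv_closed| |].
    apply: (@subspace_eq_continuous _ _ _ a).
      by move=> s; rewrite inE /= in_itv /= /from_subspace /f => /andP[_ ->].
    apply: within_reparam cg => [s|s /=].
      by exact: mulrl_continuous.
    by rewrite !in_itv /=; lra.
  apply: (@subspace_eq_continuous _ _ _ b).
    move=> s; rewrite inE /= in_itv /= /from_subspace /f => h.
    case: ifPn => // h'; have -> : s = 2^-1 by lra.
    by rewrite /a /b /= divff// subrr g1 k0.
  apply: within_reparam ck => [s|s /=].
    apply: continuousB; last exact: cst_continuous.
    by exact: mulrl_continuous.
  by rewrite !in_itv /=; lra.
- by rewrite /f invr_ge0 ler0n /a /= mulr0.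
- have /negPf h : ~~ (1 <= 2^-1 :> R) by lra.
  rewrite /f h.
  by rewrite /b /=; have -> : 2 * 1 - 1 = 1 :> R by lra.
Qed.

Lemma path_component_eq T (A : set T) x y : path_joined A x y ->
  path_component A x = path_component A y.
Proof.
move=> xy; apply/seteqP; split=> z /= h; last exact: path_joined_trans xy h.
exact: path_joined_trans (path_joined_sym xy) h.
Qed.

End Topology.

Section ComponentsOfSublevelSets.
Context {R : realType} (T : topologicalType) (f : T -> R).

Definition sublevel (t : R) : set T := [set x | f x <= t].

Lemma sublevel_le r t : r <= t -> sublevel r `<=` sublevel t.
Proof. by move=> rt x /le_trans; exact. Qed.

Definition pi0_obj (t : R) : Type :=
  {C : set T | exists2 x, sublevel t x & C = path_component (R := R) (sublevel t) x}.

Definition pi0_map (t : R) (C : set T) : set T :=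
  [set y | exists2 x, C x & path_joined (R := R) (sublevel t) x y].

Lemma pi0_mapE r t x : r <= t -> sublevel r x ->
  pi0_map t (path_component (R := R) (sublevel r) x) =
  path_component (R := R) (sublevel t) x.
Proof.
move=> rt rx; apply/seteqP; split=> [y [z /= xz zy]|y /= xy].
  by apply: path_joined_trans zy; exact: path_joined_sub (sublevel_le rt) xz.
by exists x => //; exact: path_joined_refl.
Qed.

Lemma pi0_map_subproof r t (rt : r <= t) (C : pi0_obj r) :
  exists2 x, sublevel t x &
    pi0_map t (sval C) = path_component (R := R) (sublevel t) x.
Proof.
case: C => C /= [x rx ->]; exists x; first exact: (sublevel_le rt).
exact: pi0_mapE.
Qed.

Definition pi0_shift r t (rt : r <= t) (C : pi0_obj r) : pi0_obj t :=
  exist _ (pi0_map t (sval C)) (pi0_map_subproof rt C).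

Lemma pi0_shift_id r (h : r <= r) C : pi0_shift h C = C.
Proof.
case: C => C CP; apply: eq_exist => /=.
by case: CP => x rx ->; exact: pi0_mapE.
Qed.

Lemma pi0_shift_comp r s t (rs : r <= s) (st : s <= t) (rt : r <= t) C :
  pi0_shift st (pi0_shift rs C) = pi0_shift rt C.
Proof.
case: C => C CP; apply: eq_exist => /=; case: CP => x rx ->.
by rewrite !pi0_mapE//; exact: (sublevel_le rs).
Qed.

Definition pi0 : persistent_set R := PersistentSet pi0_shift_id pi0_shift_comp.

End ComponentsOfSublevelSets.

Section MergeTrees.
Context {R : realType}.

(* Every edge comes with a characteristic map, restricted to [0, +oo) for the
   distinguished edge and to [0, 1] for the others. *)
Record tree_data := TreeData {
  space :> topologicalType;
  vertex : set space;
  edge : choiceType;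
  e_infty : edge;
  char : edge -> R -> space;
  height : space -> R }.

Section TreeData.
Variable X : tree_data.
Implicit Types (v w : X) (e : edge X).

Definition edge_dom e : set R :=
  if e == e_infty X then `[0, +oo[%classic else `[0, 1]%classic.

Definition edge_interior e : set R :=
  if e == e_infty X then `]0, +oo[%classic else `]0, 1[%classic.

Definition cell e : set X := char e @` edge_interior e.

Definition v_infty : X := char (e_infty X) 0.

(* A one-dimensional cell complex: X is partitioned into vertices and open
   edges, and carries the weak topology. *)
Record cell_complex : Prop := {
  char0_vertex : forall e, vertex (char e 0);
  char1_vertex : forall e, e != e_infty X -> vertex (char e 1);
  char_inj : forall e, {in edge_interior e &, injective (char e)};
  cell_disjoint : forall e e', cell e `&` cell e' !=set0 -> e = e';
  vertex_cell_disjoint : forall e, @vertex X `&` cell e = set0;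
  cell_cover : @vertex X `|` \bigcup_e cell e = setT;
  weak_topology : forall U : set X, open U <->
    forall e, open (char e @^-1` U : set (subspace (edge_dom e))) }.

Definition locally_finite : Prop := forall x : X,
  exists2 U, nbhs x U & finite_set [set e | U `&` cell e !=set0].

Definition joins e v w : Prop :=
  e != e_infty X /\
  ((char e 0 = v /\ char e 1 = w) \/ (char e 0 = w /\ char e 1 = v)).

Fixpoint trail v (p : seq (edge X)) w : Prop :=
  if p is e :: p' then exists2 u, joins e v u & trail u p' w else v = w.

Definition acyclic : Prop :=
  forall v (p : seq (edge X)), trail v p v -> uniq p -> p = [::].

Record merge_tree : Prop := {
  mt_complex : cell_complex;
  mt_connected : connected [set: X];
  mt_locally_finite : locally_finite;
  mt_contractible : contractible (R := R) X;
  mt_compact : compact (~` cell (e_infty X));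
  mt_tree_connected : connected (~` cell (e_infty X));
  mt_tree_acyclic : acyclic;
  mt_continuous : continuous (@height X);
  mt_infty : @height X @` cell (e_infty X) = `]height v_infty, +oo[%classic;
  mt_increasing : forall g : R -> X, {within `[0, 1], continuous g} ->
    (forall s t, 0 <= s <= 1 -> 0 <= t <= 1 -> g s = g t -> s = t) ->
    vertex (g 0) -> g 1 = v_infty ->
    forall s t, 0 <= s -> s < t -> t <= 1 -> height (g s) < height (g t) }.

Definition child_edge v e : Prop :=
  exists2 w, joins e v w & height w < height v.

Definition child v w : Prop :=
  height w < height v /\ exists e, joins e v w.

End TreeData.

Definition morse_tree (X : tree_data) : Prop :=
  exists (S : persistent_set R) (tau : seq R),
    morse_set S tau /\ associated_tree S tau (@height X).

Variant side := LeftSide | RightSide.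

(* Every edge other than e_infty joins exactly one vertex to a child of it, so
   that the labels are carried by the edges; the label of e_infty is unused. *)
Record chiral_merge_tree := ChiralMergeTree {
  underlying :> tree_data;
  underlying_merge_tree : merge_tree underlying;
  label : edge underlying -> side;
  two_children : forall v : underlying, vertex v -> (exists w, child v w) ->
    [set w | child v w] #= `I_2;
  labelled_children : forall v : underlying, vertex v -> (exists w, child v w) ->
    exists eL eR, [/\ label eL = LeftSide, label eR = RightSide &
      [set e | child_edge v e] = [set eL; eR]] }.

Definition isomorphism (X Y : tree_data) (f : X -> Y) : Prop :=
  [/\ continuous f,
      exists g : Y -> X, [/\ continuous g, cancel f g & cancel g f] &
      forall x, height (f x) = height x].

Definition chiral_iso (X Y : chiral_merge_tree) : Prop :=
  exists2 f : X -> Y, isomorphism f &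
    forall e, e != e_infty X -> exists e', [/\ e' != e_infty Y,
      f @` cell e = cell e' & label e = label e'].

(* Graph of the Elder map T |-> E(pi_0 of the sublevel sets), which is defined
   on Morse trees. *)
Definition elder_map (X : tree_data) (B : barcode R) : Prop :=
  morse_tree X /\
  exists2 tau, morse_set (pi0 (@height X)) tau &
    elder_barcode (pi0 (@height X)) tau B.

(* P consists of exactly n isomorphism classes of chiral merge trees. The
   classes are counted through representatives because the type of chiral merge
   trees is too large a universe for [set]. *)
Definition iso_class_count (P : chiral_merge_tree -> Prop) (n : nat) : Prop :=
  exists rep : 'I_n -> chiral_merge_tree,
    [/\ forall i, P (rep i),
        forall i j, chiral_iso (rep i) (rep j) -> i = j &
        forall X, P X -> exists i, chiral_iso X (rep i)].

(* Forgets the labels, then applies the Elder map. *)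
Definition chiral_elder_map (X : chiral_merge_tree) (B : barcode R) : Prop :=
  elder_map (underlying X) B.

End MergeTrees.

(* Main.v *)
Require Import Defs.
From HB Require Import structures.
From mathcomp Require Import all_boot all_order all_algebra.
From mathcomp Require Import all_classical all_reals all_analysis.
From mathcomp Require Import lra zify.
From Stdlib Require Import Relation_Operators.

Set Implicit Arguments.
Unset Strict Implicit.
Unset Printing Implicit Defensive.

Import Order.TTheory GRing.Theory Num.Theory.
Import numFieldNormedType.Exports.

Local Open Scope classical_set_scope.
Local Open Scope card_scope.
Local Open Scope ring_scope.

(* A chiral merge tree is determined by its leaves, the heights m i j at which
   the branches of two leaves i and j merge, and the labels. The function m is
   an ultrametric, except that m i i is the height of the leaf i, and the tree
   is a union of rays u i, one for each leaf, where u i and u j coincide from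
   the height m i j on; its vertices and edges can be recovered from the
   topology.

   In these terms the Elder Rule assigns to the leaf j the interval from m j j
   to the height at which its branch first meets the branch of an older leaf
   (m has to be binary with distinct births among merging leaves). If the
   result is B, then at height d j the branch of the leaf j >= 2 meets that of
   the elder leaf par j of the component it joins, and the bar of par j strictly
   contains I j. Conversely, every map par such that the bar of par j strictly
   contains I j arises from a unique m, obtained by performing the mergers at
   the heights d j one after the other.
   Isomorphisms preserve the numbering of the leaves, because the intervals of
   B are distinct. At each of the N - 1 mergers the branch of the leaf j can be
   the left or the right one. *)

(** The definitions speak of spaces, paths and cells, while the count needs only [m]. The bridge is
    the predicate [presented], which involves the space and the height alone: a Morse tree satisfies
    it for the [m] of the Morse set that it is built from, and then the components of its sublevel
    sets are described by the same [m]. The harder obstacle is that a tree comes with an arbitrary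
    cell structure, and a chiral isomorphism has to carry cells to cells. Open cells are intervals,
    so they contain neither a leaf, around which the height has a strict minimum, nor a merge point,
    where three arms meet; and a vertex at any other point would have a single edge below it,
    whereas the labels demand two. Hence the vertices are exactly the leaves and the merge points.
    Labels are compared through the cell just below a merge point, which can be named in every cell
    structure. *)

Section RealTopology.
Context {R : realType}.

Lemma continuous_maxl (a : R) : continuous (fun s : R => Num.max s a).
Proof.
by apply: (max_fun_continuous (f := id)); [move=> s; exact: cvg_id|exact: cst_continuous].
Qed.

Lemma continuous_clamp (a b : R) :
  continuous (fun s : R => Num.min (Num.max s a) b).
Proof.
apply: (min_fun_continuous (f := fun s => Num.max s a)); last exact: cst_continuous.
exact: continuous_maxl.
Qed.

Lemma clamp_in (a b s : R) : a <= b -> a <= Num.min (Num.max s a) b <= b.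
Proof. by move=> ab; rewrite le_min le_max lexx orbT ab /= ge_min lexx orbT. Qed.

Lemma clamp_id (a b s : R) : a <= s <= b -> Num.min (Num.max s a) b = s.
Proof. by move=> /andP[as_ sb]; rewrite max_l// min_l. Qed.

(** Clamping the parameter extends a path to all of [R], where connectedness can be used without
    subspace topologies. *)
Lemma within_clamp (T : topologicalType) (g : R -> T) (a b : R) : a <= b ->
  {within `[a, b], continuous g} ->
  continuous (fun s => g (Num.min (Num.max s a) b)).
Proof.
move=> ab cg; apply/continuous_subspace_setT.
apply: (within_reparam (h := fun s => Num.min (Num.max s a) b)) cg.
  exact: continuous_clamp.
by move=> s _; rewrite /= in_itv /=; exact: clamp_in.
Qed.

Lemma connected_real_clopen (A : set R) :
  open A -> closed A -> A !=set0 -> A = setT.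
Proof.
move=> oA cA A0; have cT : connected [set: R] by apply/connected_intervalP.
by apply: cT => //; exists A; rewrite ?setTI.
Qed.

End RealTopology.

(** * Merge trees presented by their leaves *)

Section LeafPresentations.
Context {R : realType} {n : nat}.

(* [m i j] is the height at which the branches starting at the leaves i and j
   merge, and [m i i] the height of the leaf i. *)
Record ultrametric (m : 'I_n -> 'I_n -> R) : Prop := {
  ultra_sym : forall i j, m i j = m j i;
  ultra_le : forall i j k, m i k <= Num.max (m i j) (m j k);
  ultra_lt : forall i j, i != j -> m i i < m i j }.

(* [u i t] is the point at height t above the leaf i; it stays at the leaf for
   t below the height of the leaf, so that u i is defined on all of R. *)
Record presented (X : topologicalType) (h : X -> R) (m : 'I_n -> 'I_n -> R)
    (u : 'I_n -> R -> X) : Prop := {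
  pr_height : forall i t, h (u i t) = Num.max t (m i i);
  pr_below : forall i t, t <= m i i -> u i t = u i (m i i);
  pr_cover : forall x, exists i, u i (h x) = x;
  pr_eq : forall i j t, m i i <= t -> m j j <= t ->
    (u i t = u j t <-> m i j <= t);
  pr_open : forall U : set X, open U <-> forall i, open (u i @^-1` U) }.

Section Ultrametric.
Variables (m : 'I_n -> 'I_n -> R).
Hypothesis um : ultrametric m.

Lemma ultra_birth i j : m i i <= m i j.
Proof. by have [->//|/(ultra_lt um)/ltW] := eqVneq i j. Qed.

Lemma ultra_birthr i j : m j j <= m i j.
Proof. by rewrite (ultra_sym um) ultra_birth. Qed.

Lemma ultra_trans i j k t : m i j <= t -> m j k <= t -> m i k <= t.
Proof.
by move=> ij jk; apply: le_trans (ultra_le um i j k) _; rewrite ge_max ij.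
Qed.

(** Ultrametric triangles are isosceles, with the two longer sides equal. *)
Lemma ultra_eq i j k : m i j < m j k -> m i k = m j k.
Proof.
move=> lt; apply/le_anti; apply/andP; split.
  by apply: (@ultra_trans i j k) => //; exact: ltW.
rewrite leNgt; apply/negP => ik.
have := @ultra_le _ um j i k; rewrite leNgt gt_max ik.
by rewrite (ultra_sym um) lt.
Qed.

End Ultrametric.

Section Presented.
Variables (X : topologicalType) (h : X -> R) (m : 'I_n -> 'I_n -> R)
  (u : 'I_n -> R -> X).
Hypotheses (um : ultrametric m) (pr : presented h m u).

Lemma pr_heightE i t : m i i <= t -> h (u i t) = t.
Proof. by move=> it; rewrite (pr_height pr) max_l. Qed.

Lemma pr_eqP i j s t : m i i <= s -> m j j <= t ->
  u i s = u j t -> s = t /\ m i j <= t.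
Proof.
move=> is_ jt e; have st : s = t by rewrite -(pr_heightE is_) e pr_heightE.
by subst t; split=> //; apply/(pr_eq pr).
Qed.

Lemma pr_eqT i j t : m i j <= t -> u i t = u j t.
Proof.
move=> ij; apply/(pr_eq pr) => //; apply: le_trans ij.
  exact: (ultra_birth um).
exact: (ultra_birthr um).
Qed.

Lemma pr_leaf x : exists i, m i i <= h x /\ u i (h x) = x.
Proof.
have [i ix] := pr_cover pr x; exists i; split=> //.
by rewrite -{1}ix (pr_height pr) le_max lexx orbT.
Qed.

Lemma pr_continuous i : continuous (u i).
Proof. by apply/continuousP => U /(pr_open pr). Qed.

Lemma pr_closed (F : set X) : closed F <-> forall i, closed (u i @^-1` F).
Proof.
split=> [cF i|cF].
  by move/continuous_closedP: (@pr_continuous i); apply.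
rewrite -openC; apply/(pr_open pr) => i.
by rewrite preimage_setC openC; exact: cF.
Qed.

Lemma pr_height_continuous : continuous h.
Proof.
apply/continuousP => U oU; apply/(pr_open pr) => i.
rewrite -comp_preimage.
have -> : h \o u i = fun t => Num.max t (m i i).
  by apply/funext => t /=; rewrite (pr_height pr).
by apply: open_comp => // t _; exact: continuous_maxl.
Qed.

Lemma pr_clamp i t : u i (Num.max t (m i i)) = u i t.
Proof. by case: (leP t (m i i)) => [/(pr_below pr)->|]. Qed.

Lemma pr_clamp_eq i k s t : m i i <= s -> u k t = u i s ->
  s = Num.max t (m k k) /\ m i k <= s.
Proof.
move=> is_; rewrite -(pr_clamp k t) => e.
have kt : m k k <= Num.max t (m k k) by rewrite le_max lexx orbT.
by have [-> ki] := pr_eqP kt is_ e; rewrite (ultra_sym um).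
Qed.

Lemma pr_preimage_segment i k p q : m i i <= p -> m i k <= p ->
  u k @^-1` [set u i t | t in `]p, q[] = `]p, q[%classic.
Proof.
move=> ip ikp; have kp : m k k <= p by apply: le_trans ikp; exact: ultra_birthr.
apply/seteqP; split=> t /=; rewrite in_itv /=.
  move=> [s]; rewrite in_itv /= => /andP[ps sq] /esym/pr_clamp_eq[].
    by rewrite (le_trans ip)// ltW.
  case: (leP t (m k k)) => [_ e|_ <- _]; last by rewrite ps.
  by move: ps; rewrite e ltNge kp.
move=> /andP[pt tq]; exists t; first by rewrite in_itv /= pt.
by apply: pr_eqT; rewrite (le_trans ikp)// ltW.
Qed.

(** The gap condition says that no branch joins that of [i] strictly between [p] and [q], so each
    ray either runs through the whole segment or misses it. *)
Lemma pr_open_segment i p q : m i i <= p ->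
  (forall k, m i k <= p \/ q <= m i k) ->
  open [set u i t | t in `]p, q[].
Proof.
move=> ip gap; apply/(pr_open pr) => k.
have [kp|qk] := gap k; first by rewrite pr_preimage_segment//; exact: interval_open.
rewrite (_ : _ @^-1` _ = set0); first exact: open0.
apply/seteqP; split=> // t /= [s]; rewrite in_itv /= => /andP[ps sq].
move=> /esym/pr_clamp_eq[]; first by rewrite (le_trans ip)// ltW.
by move=> _; rewrite leNgt (lt_le_trans sq qk).
Qed.

Lemma pr_clamp_eq2 i k s t : u k t = u i s ->
  Num.max s (m i i) = Num.max t (m k k) /\ m i k <= Num.max s (m i i).
Proof.
by rewrite -(pr_clamp i s); apply: pr_clamp_eq; rewrite le_max lexx orbT.
Qed.

(** The interval starts at [-oo] because [u i] is constant below its leaf; this makes the preimage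
    open at the leaf itself. *)
Lemma pr_open_leaf i q : m i i < q -> (forall k, k != i -> q <= m i k) ->
  open [set u i t | t in `]-oo, q[].
Proof.
move=> iq gap; apply/(pr_open pr) => k.
have [->{k}|ki] := eqVneq k i.
  rewrite (_ : _ @^-1` _ = `]-oo, q[%classic); first exact: interval_open.
  apply/seteqP; split=> t /=; rewrite in_itv /=; last by exists t; rewrite // in_itv.
  move=> [s]; rewrite in_itv /= => sq /(congr1 h); rewrite !(pr_height pr) => e.
  by apply: (@le_lt_trans _ _ (Num.max t (m i i))); rewrite ?le_max ?lexx// -e gt_max sq.
rewrite (_ : _ @^-1` _ = set0); first exact: open0.
apply/seteqP; split=> // t /= [s]; rewrite in_itv /= => sq.
move=> /esym/pr_clamp_eq2[_].
by rewrite leNgt (lt_le_trans _ (gap _ ki))// gt_max sq.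
Qed.

Definition pr_below_at (i : 'I_n) (t : R) : set X :=
  [set x | exists j s, [/\ m i j <= t, s <= t & u j s = x]].

Lemma pr_below_atE i j t s :
  pr_below_at i t (u j s) <-> s <= t /\ m i j <= t.
Proof.
split=> [[k [r [ik rt /esym/pr_clamp_eq2[e kj]]]]|[st ij]]; last by exists j, s.
have kt : m k k <= t by apply: le_trans ik; exact: ultra_birthr.
have rkt : Num.max r (m k k) <= t by rewrite ge_max rt.
split; first by apply: le_trans rkt; rewrite e le_max lexx.
by apply: (ultra_trans um ik); exact: le_trans rkt.
Qed.

Lemma pr_below_at_closed i t : closed (pr_below_at i t).
Proof.
apply/pr_closed => j; have [ij|ji] := boolP (m i j <= t).
  rewrite (_ : _ @^-1` _ = `]-oo, t]%classic); first exact: interval_closed.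
  apply/seteqP; split=> s /=; rewrite in_itv /=.
    by move=> /pr_below_atE[].
  by move=> st; apply/pr_below_atE.
rewrite (_ : _ @^-1` _ = set0); first exact: closed0.
by apply/seteqP; split=> // s /= /pr_below_atE[_ ij]; rewrite ij in ji.
Qed.

(** Closedness of the rest of the sublevel set is what relative openness of [pr_below_at i t]
    amounts to. *)
Lemma pr_not_below_at_closed i t :
  closed [set x | h x <= t /\ ~ pr_below_at i t x].
Proof.
apply/pr_closed => j; have [ij|ji] := boolP ((m i j <= t) || (t < m j j)).
  rewrite (_ : _ @^-1` _ = set0); first exact: closed0.
  apply/seteqP; split=> // s /=; rewrite (pr_height pr) ge_max => -[/andP[st jt]].
  by apply; apply/pr_below_atE; split=> //; case/orP: ij => // /lt_geF; rewrite jt.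
rewrite (_ : _ @^-1` _ = `]-oo, t]%classic); first exact: interval_closed.
move: ji; rewrite negb_or -leNgt => /andP[ij jt].
apply/seteqP; split=> s /=; rewrite in_itv /= (pr_height pr) ge_max jt andbT.
  by case.
by move=> st; split=> // /pr_below_atE[_]; exact/negP.
Qed.

(* The points below height t whose branch reaches height t at u i t form a
   subset of the sublevel set that is both closed and relatively open. *)
Lemma path_joined_below i x y t : m i i <= t -> pr_below_at i t x ->
  path_joined (R := R) (sublevel h t) x y -> pr_below_at i t y.
Proof.
move=> it xi [g [cg g0 g1 gt]].
have cg' := within_clamp ler01 cg.
set g' := fun s : R => _ in cg'.
have g't s : h (g' s) <= t by apply: gt; exact: clamp_in.
have AE : g' @^-1` pr_below_at i t = setT.
  apply: connected_real_clopen.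
  - rewrite -closedC.
    have -> : ~` (g' @^-1` pr_below_at i t) =
        g' @^-1` [set x | h x <= t /\ ~ pr_below_at i t x].
      by apply/seteqP; split=> s /=; [split=> //|case].
    by move/continuous_closedP : cg'; apply; exact: pr_not_below_at_closed.
  - by move/continuous_closedP : cg'; apply; exact: pr_below_at_closed.
  - by exists 0; rewrite /= /g' clamp_id ?lexx ?ler01// g0.
have : (g' @^-1` pr_below_at i t) 1 by rewrite AE.
by rewrite /= /g' clamp_id ?lexx ?ler01// g1.
Qed.

Lemma path_joined_up i s t : m i i <= s -> s <= t ->
  path_joined (R := R) (sublevel h t) (u i s) (u i t).
Proof.
move=> is_ st; exists (fun r => u i (s + r * (t - s))); split.
- apply: continuous_subspaceT => r; apply: continuous_comp; last exact: pr_continuous.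
  apply: continuousD; first exact: cst_continuous.
  by apply: continuousM; [exact: cvg_id|exact: cst_continuous].
- by rewrite mul0r addr0.
- by rewrite mul1r addrC subrK.
- move=> r /andP[r0 r1]; rewrite /sublevel /= (pr_height pr) ge_max (le_trans is_ st) andbT.
  by rewrite -lerBrDl ler_piMl// subr_ge0.
Qed.

(** Both points can rise along their rays to the height [t], so the components of the sublevel set
    are the ultrametric balls of radius [t]. *)
Lemma path_joinedP i j s s' t : m i i <= s -> m j j <= s' -> s <= t -> s' <= t ->
  path_joined (R := R) (sublevel h t) (u i s) (u j s') <-> m i j <= t.
Proof.
move=> is_ js' st s't; split=> [pj|ij].
  have it := le_trans is_ st.
  suff /pr_below_atE[] : pr_below_at i t (u j s') by [].
  by apply: path_joined_below pj => //; apply/pr_below_atE.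
apply: path_joined_trans (path_joined_up is_ st) _.
by rewrite (pr_eqT ij); apply/path_joined_sym/path_joined_up.
Qed.

End Presented.

(** The counterpart of [presented] for functors. [S t] may be empty below the leaves, so [c] cannot
    be extended by a constant there and takes a proof instead. *)
Record presentedS (S : persistent_set R) (m : 'I_n -> 'I_n -> R)
    (c : forall i t, m i i <= t -> S t) : Prop := {
  prS_cover : forall t (x : S t), exists i (it : m i i <= t), x = c i t it;
  prS_eq : forall i j t (it : m i i <= t) (jt : m j j <= t),
    c i t it = c j t jt <-> m i j <= t;
  prS_shift : forall i r t (ir : m i i <= r) (rt : r <= t) (it : m i i <= t),
    Defs.shift rt (c i r ir) = c i t it }.

Lemma presented_pi0 (X : topologicalType) (h : X -> R) m u :
  ultrametric m -> presented h m u ->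
  exists c, presentedS (S := pi0 h) (m := m) c.
Proof.
move=> um pr.
have cP i t (it : m i i <= t) : exists2 x, sublevel h t x &
    path_component (R := R) (sublevel h t) (u i t) =
    path_component (R := R) (sublevel h t) x.
  by exists (u i t) => //; rewrite /sublevel /= (pr_heightE pr).
exists (fun i t it => exist (fun C => exists2 x, sublevel h t x &
  C = path_component (R := R) (sublevel h t) x) _ (cP i t it)); split.
- move=> t [C CP]; move: (CP) => [x xt Cx].
  have [i [ix ui]] := pr_leaf pr x; exists i.
  have it : m i i <= t by exact: le_trans xt.
  exists it; apply: eq_exist => /=; rewrite Cx.
  apply: path_component_eq; rewrite -{1}ui.
  by apply: (path_joined_up pr).
- move=> i j t it jt; split.
    move=> /(congr1 sval) /= e.
    apply/(path_joinedP um pr it jt (lexx _) (lexx _)).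
    have : path_component (R := R) (sublevel h t) (u j t) (u j t).
      by apply: path_joined_refl; rewrite /sublevel /= (pr_heightE pr).
    by rewrite -e.
  by move=> ij; apply: eq_exist => /=; rewrite (pr_eqT um pr ij).
- move=> i r t ir rt it; apply: eq_exist => /=.
  rewrite pi0_mapE//; last by rewrite /sublevel /= (pr_heightE pr).
  by apply: path_component_eq; exact: (path_joined_up pr).
Qed.

End LeafPresentations.

Lemma last_index {T : Type} (x0 : T) (s : seq T) (P : pred T) :
  (0 < size s)%N -> P (nth x0 s 0) ->
  exists k, [/\ (k < size s)%N, P (nth x0 s k) &
    (k.+1 < size s)%N -> ~~ P (nth x0 s k.+1)].
Proof.
move=> s0 P0.
have ex : exists k, (k < size s)%N && P (nth x0 s k) by exists 0%N; rewrite s0.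
have ub k : (k < size s)%N && P (nth x0 s k) -> (k <= size s)%N.
  by move=> /andP[/ltnW].
case: (ex_maxnP ex ub) => k /andP[ks Pk] kmax; exists k; split=> // k1s.
by apply/negP => Pk1; have := kmax k.+1; rewrite k1s Pk1 ltnn => /(_ isT).
Qed.

Lemma seq_max {R : realType} (s : seq R) (Q : R -> Prop) :
  (exists2 t, t \in s & Q t) ->
  exists t, [/\ t \in s, Q t & forall r, r \in s -> Q r -> r <= t].
Proof.
elim: s => [[t]//|a s IH] [t ts Qt].
have [[t' t's Qt']|no] := pselect (exists2 t, t \in s & Q t).
  have [r [rs Qr rmax]] := IH (ex_intro2 _ _ t' t's Qt').
  have [Qa|nQa] := pselect (Q a); last first.
    exists r; split=> //; first by rewrite inE rs orbT.
    by move=> r'; rewrite inE => /orP[/eqP->//|]; exact: rmax.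
  exists (Num.max a r); split.
  - by rewrite inE; case: leP; rewrite ?eqxx // rs orbT.
  - by case: leP.
  - move=> r'; rewrite inE le_max => /orP[/eqP->|r's Qr']; first by rewrite lexx.
    by rewrite (rmax r') ?orbT.
move: ts; rewrite inE => /orP[/eqP ta|ts]; last by exfalso; apply: no; exists t.
exists a; split; rewrite ?mem_head -?ta// => r; rewrite inE => /orP[/eqP->|rs Qr].
  by rewrite ta.
by exfalso; apply: no; exists r.
Qed.

Lemma sorted_nth_lt {R : realType} (s : seq R) i j : sorted <%R s ->
  (i < j)%N -> (j < size s)%N -> s`_i < s`_j.
Proof.
move=> ss ij js; apply: (sorted_ltn_nth lt_trans) => //.
by rewrite inE; exact: ltn_trans js.
Qed.

Lemma card_eq_set2 {T : Type} (x y : T) : x <> y -> [set x; y] #= `I_2.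
Proof.
move=> xy; apply/card_set_bijP.
exists (fun z => if `[< z = x >] then 0%N else 1%N); split=> /=.
- by move=> z _ /=; case: asboolP.
- move=> a b; rewrite !inE => ha hb.
  by do 2![case: asboolP]; case: ha => -> //; case: hb => -> //.
- move=> [|[|]]//= _.
    by exists x; [left|case: asboolP].
  by exists y; [right|case: asboolP => // /esym].
Qed.

(** * Persistent sets between change times *)

Section ChangeTimes.
Context {R : realType} (S : persistent_set R) (tau : seq R).
Hypothesis ct : change_times S tau.

(** Between two change times both ends are identified with [S] at the earlier one; from the last
    change time on, both are points. The conditional bound on [t] covers the two cases at once. *)
Lemma shift_bij k r t (rt : r <= t) : (k < size tau)%N -> tau`_k <= r ->
  ((k.+1 < size tau)%N -> t < tau`_k.+1) ->
  injective (Defs.shift (p := S) rt) /\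
  (forall y, exists x, Defs.shift (p := S) rt x = y).
Proof.
move=> ks kr tk.
have [k1|k1] := boolP (k.+1 < size tau)%N.
  have [eta [eb en]] := times_between ct k1.
  have hr : tau`_k <= r < tau`_k.+1 by rewrite kr (le_lt_trans rt (tk k1)).
  have ht : tau`_k <= t < tau`_k.+1 by rewrite (le_trans kr rt) tk.
  have [gr gr1 gr2] := eb r hr; have [gt gt1 gt2] := eb t ht.
  split=> [x y|y].
    by rewrite -(gr2 x) -(gr2 y) !(en _ _ _ ht) => /(can_inj gt1) ->.
  by exists (eta r hr (gt y)); rewrite (en _ _ _ ht).
have kl : k = (size tau).-1 by lia.
have one s : tau`_k <= s -> forall x y : S s, x = y.
  rewrite kl => /(times_after ct)/card_set_bijP[f [fI fi _]] x y.
  apply: fi; rewrite ?inE//.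
  by have := fI x I; have := fI y I => /=; case: (f x); case: (f y).
have kt := le_trans kr rt.
split=> [x y _|y]; first exact: one.
have : [set: S r] #= `I_1 by apply: (times_after ct); rewrite -kl.
move=> /card_set_bijP[f [_ _ /(_ 0%N isT)[x _ _]]].
by exists x; apply: one.
Qed.

Lemma times_locate t : tau`_0 <= t -> exists k, [/\ (k < size tau)%N,
  tau`_k <= t & (k.+1 < size tau)%N -> t < tau`_k.+1].
Proof.
move=> t0; have [k [ks kt kn]] := last_index (P := fun s => s <= t) (times_nonempty ct) t0.
by exists k; split=> // /kn; rewrite ltNge.
Qed.

Lemma times_locate_left t : tau`_0 < t -> exists k, [/\ (k < size tau)%N,
  tau`_k < t & (k.+1 < size tau)%N -> t <= tau`_k.+1].
Proof.
move=> t0; have [k [ks kt kn]] := last_index (P := fun s => s < t) (times_nonempty ct) t0.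
by exists k; split=> // /kn; rewrite leNgt.
Qed.

Lemma times_first t (x : S t) : tau`_0 <= t.
Proof. by rewrite leNgt; apply/negP => /(times_before ct) /(_ x). Qed.

Lemma shift_bij_left t (x : S t) : t \notin tau ->
  exists2 a, a < t & forall r (rt : r <= t), a <= r ->
    injective (Defs.shift (p := S) rt) /\
    (forall y, exists x, Defs.shift (p := S) rt x = y).
Proof.
move=> tn; have [k [ks kt kn]] := times_locate (times_first x).
exists tau`_k; last by move=> r rt kr; exact: (@shift_bij k).
by rewrite lt_neqAle kt andbT; apply: contraNneq tn => <-; exact: mem_nth.
Qed.

End ChangeTimes.

Section PresentedPersistentSets.
Context {R : realType} {n : nat} (S : persistent_set R).
Context (m : 'I_n -> 'I_n -> R) (c : forall i t, m i i <= t -> S t).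
Hypotheses (um : ultrametric m) (ps : presentedS c).

Local Notation el i t it := (existT [eta S] t (@c i t it)).

Lemma prS_eqT i j t (it : m i i <= t) (jt : m j j <= t) :
  m i j <= t -> c it = c jt.
Proof. by move/(prS_eq ps it jt). Qed.

Lemma prS_element (p : element S) :
  exists i t (it : m i i <= t), p = el i t it.
Proof. by case: p => t x; have [i [it ->]] := prS_cover ps x; exists i, t, it. Qed.

Lemma element_leP i j s t (is_ : m i i <= s) (jt : m j j <= t) :
  element_le (el i s is_) (el j t jt) <-> s <= t /\ m i j <= t.
Proof.
split=> [[/= st]|[st ij]].
  have it := le_trans is_ st.
  by rewrite (prS_shift ps _ _ it) => /(prS_eq ps it jt).
exists st => /=; have it := le_trans is_ st.
by rewrite (prS_shift ps _ _ it); exact: prS_eqT.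
Qed.

Lemma leaf_unique i k : m k i <= m i i -> k = i.
Proof.
move=> ki; apply/eqP; apply: contraLR ki => /negP/negP.
by rewrite eq_sym => /(ultra_lt um); rewrite (ultra_sym um) -ltNge.
Qed.

(** At a time outside [tau] the shift from slightly before is bijective. At the birth of a leaf it
    would miss the leaf, and at a merger it would identify two elements. *)
Lemma merge_in_times tau i j : change_times S tau -> m i j \in tau.
Proof.
move=> ct; apply/negPn/negP => nt.
have [a at_ aP] := shift_bij_left ct (c (ultra_birth um i j)) nt.
have [ij|ij] := eqVneq i j; subst.
  have [_ /(_ (c (lexx _)))[y]] := aP a (ltW at_) (lexx _).
  have [k [ka ->]] := prS_cover ps y.
  rewrite (prS_shift ps _ _ (le_trans ka (ltW at_))) => /(prS_eq ps) /leaf_unique kj.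
  by subst k; move: (le_lt_trans ka at_); rewrite ltxx.
(* A time before the merger at which both leaves are born and the shift is already injective. *)
pose r := Num.max a (Num.max (m i i) (m j j)).
have ir : m i i <= r by rewrite !le_max lexx orbT.
have jr : m j j <= r by rewrite !le_max lexx !orbT.
have rt : r < m i j.
  by rewrite !gt_max at_ ultra_lt//= (ultra_sym um) ultra_lt// eq_sym.
have [inj _] := aP r (ltW rt) (ltac:(by rewrite le_max lexx)).
have : c ir = c jr.
  apply: inj; rewrite (prS_shift ps _ _ (ultra_birth um i j)).
  by rewrite (prS_shift ps _ _ (ultra_birthr um i j)); exact: prS_eqT.
by move=> /(prS_eq ps); rewrite leNgt rt.
Qed.

Definition merge_times : seq R := sort <=%R (undup [seq m p.1 p.2 | p : 'I_n * 'I_n]).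

Lemma mem_merge_times t : reflect (exists i j, t = m i j) (t \in merge_times).
Proof.
rewrite mem_sort mem_undup; apply: (iffP mapP) => [[[i j] _ ->]|[i [j ->]]].
  by exists i, j.
by exists (i, j); rewrite ?mem_enum.
Qed.

Lemma merge_times_sorted : sorted <%R merge_times.
Proof. by rewrite sort_lt_sorted undup_uniq. Qed.

Hypothesis n_gt0 : (0 < n)%N.
Let i0 : 'I_n := Ordinal n_gt0.

Lemma merge_times_nonempty : (0 < size merge_times)%N.
Proof.
have : m i0 i0 \in merge_times by apply/mem_merge_times; exists i0, i0.
by case: merge_times.
Qed.

Lemma merge_times_le k t i j : (k < size merge_times)%N ->
  merge_times`_k <= t -> ((k.+1 < size merge_times)%N -> t < merge_times`_k.+1) ->
  m i j <= t -> m i j <= merge_times`_k.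
Proof.
move=> ks kt tk ijt; have : m i j \in merge_times by apply/mem_merge_times; exists i, j.
move=> /(nthP 0)[l ls lE]; rewrite -lE in ijt *.
have mono := fun a b => sorted_nth_lt (i := a) (j := b) merge_times_sorted.
case: (ltngtP l k) => [lk|kl|->//]; first exact/ltW/mono.
have k1 : (k.+1 < size merge_times)%N by exact: leq_ltn_trans ls.
suff : merge_times`_k.+1 <= t by rewrite leNgt tk.
move: kl; rewrite leq_eqVlt => /orP[/eqP->//|/mono/(_ ls)/ltW h].
exact: le_trans ijt.
Qed.

Lemma presentedS_change_times : change_times S merge_times.
Proof.
split.
- exact: merge_times_sorted.
- exact: merge_times_nonempty.
- move=> t t0 x; have [i [it _]] := prS_cover ps x.
  have : m i i \in merge_times by apply/mem_merge_times; exists i, i.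
  move=> /(nthP 0)[[|l] ls lE]; first by move: t0; rewrite lE ltNge it.
  have : merge_times`_0 < merge_times`_l.+1.
    exact: (sorted_nth_lt merge_times_sorted (ltn0Sn _) ls).
  by rewrite lE => /(lt_le_trans)/(_ it); rewrite ltNge (ltW t0).
- move=> k k1; have ks := ltnW k1.
  exists (fun t ht => Defs.shift (p := S) (proj1 (andP ht))); split; last first.
    by move=> r t hr ht rt x; exact: shift_comp.
  move=> t ht; have /andP[kt tk] := ht; rewrite -setTT_bijective; split=> //.
    move=> x y _ _; have [i [ik ->]] := prS_cover ps x.
    have [j [jk ->]] := prS_cover ps y.
    rewrite !(prS_shift ps _ _ (le_trans ik kt), prS_shift ps _ _ (le_trans jk kt)).
    by move=> /(prS_eq ps) ij; apply: prS_eqT; exact: merge_times_le ij.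
  move=> y _; have [i [it ->]] := prS_cover ps y.
  have ik : m i i <= merge_times`_k by exact: merge_times_le it.
  by exists (c ik) => //; rewrite (prS_shift ps _ _ it).
- move=> t tl.
  have all i j : m i j <= t.
    have : m i j \in merge_times by apply/mem_merge_times; exists i, j.
    move=> /(nthP 0)[l ls <-]; apply: le_trans tl.
    have [->//|ll] := eqVneq l (size merge_times).-1.
    apply/ltW/(sorted_nth_lt merge_times_sorted).
      by rewrite ltn_neqAle ll -ltnS prednK// (leq_ltn_trans _ ls).
    by rewrite prednK// (leq_ltn_trans _ ls).
  suff -> : [set: S t] = [set c (all i0 i0)] by exact: card_set1.
  apply/seteqP; split=> // x _ /=; have [i [it ->]] := prS_cover ps x.
  exact: prS_eqT.
Qed.

End PresentedPersistentSets.

(** * The Elder Rule in terms of leaves *)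

Section ElderRule.
Context {R : realType} {n : nat} (m : 'I_n -> 'I_n -> R).

Definition binary : Prop := forall i j k, i != j -> j != k -> i != k ->
  ~ (m i j = m j k /\ m j k = m i k).

Definition elder_at (j : 'I_n) (t : R) : Prop :=
  forall k, m j k <= t -> k != j -> m j j < m k k.

(** This is condition (5) of Morse sets in terms of leaves; the strict inequality in [elder_at]
    excludes ties between births. *)
Definition has_elders : Prop := forall i t, m i i <= t ->
  exists2 j, m i j <= t & elder_at j t.

Definition bar (j : 'I_n) : set R := [set t | m j j <= t /\ elder_at j t].

Lemma elder_at_le j s t : s <= t -> elder_at j t -> elder_at j s.
Proof. by move=> st je k jk; apply: je; exact: le_trans st. Qed.

Lemma elder_at_unique j k t : ultrametric m -> m j k <= t ->
  elder_at j t -> elder_at k t -> j = k.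
Proof.
move=> um jk je ke; apply/eqP/negPn/negP => njk.
have kj : m k j <= t by rewrite (ultra_sym um).
have := ke _ kj njk; have := je _ jk; rewrite eq_sym => /(_ njk).
by move=> /lt_trans/[apply]; rewrite ltxx.
Qed.

Lemma elder_at_birth j : ultrametric m -> elder_at j (m j j).
Proof.
by move=> um k; rewrite (ultra_sym um) => /(leaf_unique um) -> /eqP.
Qed.

Context (S : persistent_set R) (c : forall i t, m i i <= t -> S t).
Hypotheses (um : ultrametric m) (ps : presentedS c).
Local Notation el i t it := (existT [eta S] t (@c i t it)).

Lemma prS_el_eq i j t (it : m i i <= t) (jt : m j j <= t) :
  m i j <= t -> el i t it = el j t jt.
Proof. by move=> ij; rewrite (prS_eqT ps it jt). Qed.

Lemma prS_el_irr i s t (is_ : m i i <= s) (it : m i i <= t) : s = t ->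
  el i s is_ = el i t it.
Proof. by move=> st; subst t; apply: prS_el_eq. Qed.

Lemma element_leW i s t (is_ : m i i <= s) (it : m i i <= t) : s <= t ->
  element_le (el i s is_) (el i t it).
Proof. by move=> st; apply/(element_leP ps); rewrite it. Qed.

Definition branch (i : 'I_n) : set (element S) :=
  [set p | exists it : m i i <= projT1 p, projT2 p = c it].

Lemma branch_el i j t (jt : m j j <= t) : branch i (el j t jt) <-> m i j <= t.
Proof.
split=> [[/= it /(prS_eq ps)]|ij]; first by rewrite (ultra_sym um).
have it : m i i <= t by apply: le_trans ij; exact: ultra_birth.
by exists it; apply/(prS_eq ps); rewrite (ultra_sym um).
Qed.

Lemma branchP i p : branch i p -> exists t (it : m i i <= t), p = el i t it.
Proof. by case: p => t x [/= it ->]; exists t, it. Qed.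

Lemma branch_self i t (it : m i i <= t) : branch i (el i t it).
Proof. exact/branch_el. Qed.

Lemma branch_chain i : chain (branch i).
Proof.
move=> _ _ /branchP[s [is_ ->]] /branchP[t [it ->]].
by case: (leP s t) => [|/ltW] st; [left|right]; exact: element_leW.
Qed.

(* In a chain, the leaves below an element increase with the element; those
   below a member with the fewest leaves lie below all members. *)
Lemma chain_branch (C : set (element S)) : C !=set0 -> chain C ->
  exists i, C `<=` branch i.
Proof.
move=> [p0 Cp0] cC.
pose L (p : element S) : {set 'I_n} := finset (fun i => `[< branch i p >]).
have Lle p q : element_le p q -> L p \subset L q.
  move=> pq; apply/fintype.subsetP => i; rewrite !inE => bp; have [t [it pE]] := branchP bp; subst p.
  case: q pq => s y [/= ts <-]; exists (le_trans it ts).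
  by rewrite (prS_shift ps _ _ (le_trans it ts)).
have [N [[p Cp pN] Nmin]] : exists N, (exists2 p, C p & #|L p| = N) /\
    forall q, C q -> (N <= #|L q|)%N.
  have ex : exists N, `[< exists2 p, C p & #|L p| = N >].
    by exists #|L p0|; apply/asboolP; exists p0.
  case: (ex_minnP ex) => N /asboolP NP Nmin; exists N; split=> // q Cq.
  by apply: Nmin; apply/asboolP; exists q.
have [i [t [it pE]]] := prS_element ps p; exists i => q Cq.
have ip : i \in L p by rewrite !inE pE; exact: branch_self.
suff : i \in L q by rewrite !inE.
have [pq|qp] := cC p q Cp Cq; first by apply: (fintype.subsetP (Lle _ _ pq)).
suff -> : L q = L p by [].
by apply/eqP; rewrite eqEcard Lle// pN Nmin.
Qed.

(** A chain that contains the branch contains its leaf, and everything comparable to a leaf lies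
    above it. *)
Lemma branch_maximal i : maximal_chain setT (branch i).
Proof.
split=> //; first exact: branch_chain.
move=> C _ cC iC; apply/seteqP; split=> // p Cp.
have Cl : C (el i (m i i) (lexx _)) by apply: iC; exact: branch_self.
have [k [t [kt pE]]] := prS_element ps p.
have := cC _ _ Cp Cl; rewrite {}pE => -[/(element_leP ps)[ti /(leaf_unique um) ki]|].
  by subst k; exact: branch_self.
by move=> /(element_leP ps)[it ik]; apply/branch_el.
Qed.

Lemma maximal_branch C : C !=set0 -> maximal_chain setT C -> exists i, C = branch i.
Proof.
move=> C0 [_ cC mC]; have [i Ci] := chain_branch C0 cC; exists i.
by apply/esym/mC => //; exact: branch_chain.
Qed.

Lemma times_branch i t : times (branch i) t <-> m i i <= t.
Proof.
split=> [[_ /branchP[s [is_ ->]] <-]//|it].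
by exists (el i t it) => //; exact: branch_self.
Qed.

Lemma branch_inj : injective branch.
Proof.
move=> i j ij; apply: (leaf_unique um).
suff /branch_el : branch i (el j (m j j) (lexx _)) by [].
by rewrite ij; apply/branch_el.
Qed.

Lemma older_asym (C D : set (element S)) : older C D -> older D C -> False.
Proof.
move=> [s Cs sD] [t Dt tC].
by have := lt_trans (sD _ Dt) (tC _ Cs); rewrite ltxx.
Qed.

(** The maximal chains through an element are the branches of the leaves below it, and a branch
    starts at the birth of its leaf, so comparing ages of chains means comparing births. *)
Lemma elder_oldest j i t (it : m i i <= t) : m i j <= t ->
  oldest_chain setT (el i t it) (branch j) <-> elder_at j t.
Proof.
move=> ij; have ji : m j i <= t by rewrite (ultra_sym um).
split=> [[_ _ old] k jk kj|je].
  have [||s /times_branch js /(_ (m k k))] := old (branch k) (branch_maximal k).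
  - by apply/branch_el; rewrite (ultra_sym um); exact: ultra_trans jk.
  - by move/branch_inj/eqP; apply/negP.
  move=> lt; apply: le_lt_trans js _; apply: lt.
  exact/times_branch.
split; [exact: branch_maximal|exact/branch_el|].
move=> C mC Ci Cj; have [|k Ck] := maximal_branch _ mC; first by exists (el i t it).
subst C; exists (m j j); first exact/times_branch.
move=> s /times_branch; apply: lt_le_trans; apply: je.
  by apply: (ultra_trans um ji); rewrite (ultra_sym um); exact/branch_el.
by apply/eqP => kj; apply: Cj; rewrite kj.
Qed.

Lemma oldest_elders : (forall y : element S, exists! C, oldest_chain setT y C) <->
  has_elders.
Proof.
split=> [old i t it|he y].
  have [C [oC _]] := old (el i t it).
  have [mC Ci _] := oC; have [|j Cj] := maximal_branch _ mC; first by exists (el i t it).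
  subst C; have ij : m i j <= t by rewrite (ultra_sym um); exact/branch_el.
  by exists j => //; apply/(elder_oldest it).
have [i [t [it ->]]] := prS_element ps y.
have [j ij je] := he _ _ it; have [_ _ old] := proj2 (elder_oldest it ij) je.
exists (branch j); split; first exact/elder_oldest.
(* Uniqueness: two different oldest chains would each be older than the other. *)
move=> C [mC Ci oldC]; apply: contrapT => Cj.
apply: (older_asym (old C mC Ci (nesym Cj))).
apply: oldC => //; first exact: branch_maximal.
by apply/branch_el; rewrite (ultra_sym um).
Qed.

Lemma presentedS_finite t : finite_set [set: S t].
Proof.
have [[x0 _]|no] := pselect (exists x : S t, True); last first.
  suff -> : [set: S t] = set0 by exact: finite_set0.
  by apply/seteqP; split=> // x _; apply: no; exists x.
pose g (i : 'I_n) := if pselect (m i i <= t) is left it then c it else x0.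
have fg : finite_set (g @` setT) by apply: finite_image; exact: finite_finset.
apply: sub_finite_set fg.
move=> x _; have [i [it ->]] := prS_cover ps x; exists i => //; rewrite /g.
by case: pselect => // it'; congr c; exact: bool_irrelevance.
Qed.

(** Three elements of one fiber would come from leaves that merge pairwise at the same time, which
    [binary] excludes. *)
Lemma presentedS_fibers : binary -> forall k, (k.+1 < size (merge_times m))%N ->
  forall (le : (merge_times m)`_k <= (merge_times m)`_k.+1)
    (x : S (merge_times m)`_k.+1),
  exists2 l, (l <= 2)%N & [set y | Defs.shift le y = x] #= `I_l.
Proof.
move=> bin k ks le x; set A := [set y | _].
have [[y1 A1]|no] := pselect (exists y, A y); last first.
  exists 0%N => //; suff -> : A = set0 by rewrite II0 card_eq00.
  by apply/seteqP; split=> // y Ay; apply: no; exists y.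
have [[y2 [A2 y12]]|no] := pselect (exists y, A y /\ y1 <> y); last first.
  exists 1%N => //; suff -> : A = [set y1] by exact: card_set1.
  apply/seteqP; split=> [y Ay|y ->//] /=; apply: contrapT => ny.
  by apply: no; exists y; split=> // /esym.
exists 2%N => //; suff -> : A = [set y1; y2] by exact: card_eq_set2.
apply/seteqP; split=> [y3 A3|y [->|->]//] /=; apply: contrapT => /not_orP[y31 y32].
(* No merge time lies strictly between consecutive ones, so leaves that are separate at the earlier
   time and joined at the later one merge exactly at the later one. *)
have merge (i j : 'I_n) (ik : m i i <= (merge_times m)`_k)
    (jk : m j j <= (merge_times m)`_k) : A (c ik) -> A (c jk) -> c ik <> c jk ->
    m i j = (merge_times m)`_k.+1 /\ i != j.
  rewrite /A /= => <- /esym.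
  rewrite (prS_shift ps _ _ (le_trans ik le)) (prS_shift ps _ _ (le_trans jk le)).
  move=> /(prS_eq ps) ijle nij; split; last first.
    by apply/eqP => ij; apply: nij; subst j; apply: (prS_eqT ps).
  apply/eqP; rewrite eq_le ijle /= leNgt; apply/negP => ijlt; apply: nij.
  apply/(prS_eq ps); case: (leP (m i j) (merge_times m)`_k) => // lt.
  by exfalso; move: (lt); rewrite ltNge (merge_times_le (ltnW ks) (ltW lt) (fun=> ijlt)).
have [i [ik e1]] := prS_cover ps y1; have [j [jk e2]] := prS_cover ps y2.
have [l [lk e3]] := prS_cover ps y3; subst y1 y2 y3.
have [ij nij] := merge _ _ _ _ A1 A2 y12.
have [jl njl] := merge _ _ _ _ A2 A3 (nesym y32).
have [il nil] := merge _ _ _ _ A1 A3 (nesym y31).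
by apply: (bin i j l nij njl nil); rewrite ij jl il.
Qed.

Lemma presentedS_morse_set : (0 < n)%N -> binary -> has_elders ->
  morse_set S (merge_times m).
Proof.
move=> n0 bin he; split.
- exact: presentedS_finite.
- exact: (presentedS_change_times ps).
(* Minimality: every list of change times contains all [m i j], by [merge_in_times]. *)
- move=> tau ct sub; apply: (lt_sorted_eq (times_sorted ct)); first exact: merge_times_sorted.
  move=> t; apply/idP/idP; first exact: sub.
  by move=> /mem_merge_times[i [j ->]]; exact: (merge_in_times um ps).
- exact: presentedS_fibers.
- exact/oldest_elders.
Qed.

End ElderRule.

(** * Runs of the Elder Rule *)

Section ElderRuns.
Context {R : realType} {n : nat} (m : 'I_n -> 'I_n -> R).
Context (S : persistent_set R) (c : forall i t, m i i <= t -> S t).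
Hypotheses (um : ultrametric m) (ps : presentedS c) (he : has_elders m).
Context (tau : seq R) (tauP : forall i j, m i j \in tau).
Local Notation el i t it := (existT [eta S] t (@c i t it)).

(** Each element is assigned to the elder among the leaves below it. The chains removed by the Elder
    Rule are the classes of this assignment, so every intermediate set of a run has the form
    [elders_in A]. *)
Definition elders_in (A : {set 'I_n}) : set (element S) :=
  [set p | exists2 j, j \in A & branch c j p /\ elder_at m j (projT1 p)].

Arguments elders_in A%_SET.

Lemma elders_in_el A i t (it : m i i <= t) : elders_in A (el i t it) <->
  exists j, [/\ j \in A, m i j <= t & elder_at m j t].
Proof.
split=> [[j jA [/(branch_el um ps) ji je]]|[j [jA ij je]]].
  by exists j; rewrite (ultra_sym um).
by exists j => //; split=> //; apply/(branch_el um ps); rewrite (ultra_sym um).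
Qed.

Lemma elders_in1_el i t (it : m i i <= t) : elder_at m i t ->
  elders_in [set i] (el i t it).
Proof. by move=> ie; apply/elders_in_el; exists i; rewrite inE. Qed.

Lemma elders_in1P i p : elders_in [set i] p ->
  exists t (it : m i i <= t), p = el i t it /\ elder_at m i t.
Proof.
move=> [j]; rewrite inE => /eqP-> [/branchP[t [it ->]] ie].
by exists t, it.
Qed.

Lemma elders_inS (A : {set 'I_n}) i : i \in A ->
  elders_in [set i] `<=` elders_in A.
Proof. by move=> iA p [j]; rewrite inE => /eqP-> jp; exists i. Qed.

Lemma elders_in0 : elders_in finset.set0 = set0.
Proof. by apply/seteqP; split=> // p [j]; rewrite inE. Qed.

Lemma elders_inT : elders_in [set: 'I_n] = setT.
Proof.
apply/seteqP; split=> // p _; have [i [t [it ->]]] := prS_element ps p.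
by have [j ij je] := he it; apply/elders_in_el; exists j; rewrite inE.
Qed.

Lemma elders_inD1 (A : {set 'I_n}) i :
  elders_in A `\` elders_in [set i] = elders_in (A :\ i).
Proof.
apply/seteqP; split=> p.
  move=> [[j jA [jp je]] ni]; exists j => //; rewrite !inE jA andbT.
  by apply/eqP => ji; apply: ni; exists i; rewrite ?inE// -ji.
move=> [j]; rewrite !inE => /andP[ji jA] [jp je]; split; first by exists j.
move=> /elders_in1P[t [it [pE ie]]]; move/eqP: ji; apply.
subst p; apply: (elder_at_unique um) je ie.
by apply/(branch_el um ps).
Qed.

Lemma times_elders_in1 i : times (elders_in [set i]) = bar m i.
Proof.
apply/seteqP; split=> t.
  by move=> [p /elders_in1P[s [is_ [-> ie]]] <-].
by move=> [it ie]; exists (el i t it) => //; exact: elders_in1_el.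
Qed.

Section Step.
Variables (A : {set 'I_n}) (i : 'I_n) (t : R) (it : m i i <= t).
Hypotheses (iA : i \in A) (ie : elder_at m i t).
Hypothesis tmax : forall s (y : S s), s \in tau -> elders_in A (existT _ s y) ->
  s <= t.

(* Were p no longer led by i, the merger of i with the elder j of p would lie
   over a time later than t, and above elements of j that are still there. *)
Lemma comparable_leaf p : elders_in A p ->
  element_le p (el i (m i i) (lexx _)) \/ element_le (el i (m i i) (lexx _)) p ->
  elders_in [set i] p.
Proof.
have [k [s [ks ->]]] := prS_element ps p => pA [].
  move=> /(element_leP ps)[si /(leaf_unique um) ki]; subst k.
  apply: elders_in1_el; apply: elder_at_le si _; exact: elder_at_birth.
move=> /(element_leP ps)[is_ ik].
have [j [jA kj je]] := (elders_in_el A ks).1 pA.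
have ij : m i j <= s by exact: (ultra_trans um ik).
have [ji|ji] := eqVneq j i.
  by subst j; apply/elders_in_el; exists i; rewrite inE.
exfalso; have jt : m i j <= t.
  apply: (tmax (y := c (ultra_birth um i j))) => //; apply/elders_in_el.
  by exists j; split=> //; exact: elder_at_le je.
have := ie jt ji; rewrite lt_neqAle => /andP[_].
by rewrite leNgt je// 1?(ultra_sym um)// eq_sym.
Qed.

Lemma elders_in1_maximal : maximal_chain (elders_in A) (elders_in [set i]).
Proof.
split; first exact: elders_inS.
  move=> p q /elders_in1P[s [is_ [-> _]]] /elders_in1P[r [ir [-> _]]].
  by case: (leP s r) => [|/ltW] sr; [left|right]; exact: (element_leW ps).
move=> C CA cC iC; apply/seteqP; split=> // p Cp.
apply: comparable_leaf; first exact: CA.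
apply: cC => //; apply: iC; apply: elders_in1_el; exact: elder_at_birth.
Qed.

(** A competing chain misses the leaf [i], since [comparable_leaf] would otherwise confine it to the
    bar of [i]. Its members up to time [t] then lie above younger leaves or strictly above the leaf
    [i], and its later members are later than the birth of [i] as well. *)
Lemma elders_in1_older C : maximal_chain (elders_in A) C -> C (el i t it) ->
  C <> elders_in [set i] -> older (elders_in [set i]) C.
Proof.
move=> [CA cC mC] Ci nC.
have notleaf : ~ C (el i (m i i) (lexx _)).
  move=> Cl; apply: nC; apply/esym/mC; first exact: elders_inS.
    by have [] := elders_in1_maximal.
  by move=> p Cp; apply: comparable_leaf; [exact: CA|exact: cC].
exists (m i i).
  by rewrite times_elders_in1; split=> //; exact: elder_at_birth.
move=> _ [p Cp <-]; have [k [s [ks pE]]] := prS_element ps p; subst p => /=.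
rewrite lt_neqAle; apply/andP; split.
  apply/eqP => si; apply: notleaf.
  have [/(element_leP ps)[st ki]|/(element_leP ps)[ts _]] := cC _ _ Cp Ci.
    have [ki'|ki'] := eqVneq k i.
      by subst k; rewrite (prS_el_irr ps _ ks si).
    have ik : m i k <= t by rewrite (ultra_sym um).
    by exfalso; have := ie ik ki'; rewrite ltNge si ks.
  have ti : t = m i i by apply/le_anti; rewrite it si ts.
  by rewrite -(prS_el_irr ps it _ ti).
have [/(element_leP ps)[st ki]|/(element_leP ps)[ts _]] := cC _ _ Cp Ci.
  have [ki'|ki'] := eqVneq k i; first by subst k.
  apply: (le_trans _ ks); apply/ltW/ie => //.
  by rewrite (ultra_sym um).
exact: le_trans ts.
Qed.

Lemma oldest_elders_in C :
  oldest_chain (elders_in A) (el i t it) C <-> C = elders_in [set i].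
Proof.
split=> [[mC Ci old]|->]; last first.
  split; [exact: elders_in1_maximal|exact: elders_in1_el|exact: elders_in1_older].
apply: contrapT => nC; apply: (older_asym (elders_in1_older mC Ci nC)).
by apply: old => [||/esym//]; [exact: elders_in1_maximal|exact: elders_in1_el].
Qed.

End Step.

(** The Elder Rule leaves a choice among the elements over the latest time, so different runs may
    list the bars in different orders; hence the permutation. *)
Lemma elder_bars P Is : elder tau P Is -> forall A, P = elders_in A ->
  perm_eq Is [seq bar m j | j <- enum A].
Proof.
elim=> {P Is} [A PA|P C t x Is ttau Px tmax oC _ IH A PA].
  suff -> : A = finset.set0 by rewrite enum_set0.
  apply/setP => j; rewrite inE; apply/negP => jA.
  suff : elders_in A (el j (m j j) (lexx _)) by rewrite -PA.
  by apply/elders_in_el; exists j; split=> //; exact: elder_at_birth.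
subst P; have [k [kt xE]] := prS_cover ps x; subst x.
have [i [iA ki ie]] := (elders_in_el A kt).1 Px.
have it : m i i <= t by apply: le_trans ki; exact: ultra_birthr.
have kiE : el k t kt = el i t it by apply: (prS_el_eq ps).
rewrite {}kiE in oC Px; have /(oldest_elders_in it iA ie tmax) CE := oC.
subst C; have := IH (A :\ i)%SET (elders_inD1 A i).
rewrite times_elders_in1 => pI.
have : perm_eq (enum A) (i :: enum (A :\ i)%SET).
  apply: uniq_perm; rewrite ?enum_uniq//=.
    by rewrite enum_uniq mem_enum !inE eqxx.
  by move=> j; rewrite inE !mem_enum !inE; case: eqP => [->|].
by move=> /(perm_map (bar m)) /permPr ->; rewrite /= perm_cons.
Qed.

(** A run never gets stuck: as long as a leaf is left in [A], its birth is a time of [tau] with an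
    element over it, so a latest such time exists, and one step removes one leaf. *)
Lemma elder_exists A : exists Is, elder tau (elders_in A) Is.
Proof.
have [N] := ubnP #|A|; elim: N A => // N IH A; rewrite ltnS => AN.
have [->|/set0Pn[j jA]] := eqVneq A finset.set0.
  by exists [::]; rewrite elders_in0; exact: elder_stop.
have [|t [ttau [x Px] tmax]] := @seq_max _ tau
  (fun s => exists y : S s, elders_in A (existT _ s y)).
  exists (m j j) => //; exists (c (lexx _)); apply/elders_in_el; exists j.
  by split=> //; exact: elder_at_birth.
have [k [kt xE]] := prS_cover ps x; subst x.
have [i [iA ki ie]] := (elders_in_el A kt).1 Px.
have it : m i i <= t by apply: le_trans ki; exact: ultra_birthr.
have kiE : el k t kt = el i t it by apply: (prS_el_eq ps).
rewrite kiE in Px.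
have tmax' s (y : S s) : s \in tau -> elders_in A (existT _ s y) -> s <= t.
  by move=> st sy; apply: tmax => //; exists y.
have [|Is el'] := IH (A :\ i)%SET.
  by rewrite (leq_trans _ AN)// [X in (_ < X)%N](cardsD1 i) iA.
exists (times (elders_in [set i]) :: Is); apply: (elder_step ttau Px tmax').
  exact/(oldest_elders_in it iA ie tmax').
by rewrite elders_inD1.
Qed.

End ElderRuns.

Lemma sorted_nth_le {R : realType} (s : seq R) k t : sorted <%R s -> t \in s ->
  (k < size s)%N -> ((k.+1 < size s)%N -> t < s`_k.+1) -> t <= s`_k.
Proof.
move=> ss /(nthP 0)[l ls <-] ks lt; have mono := fun a b => sorted_nth_lt (i := a) (j := b) ss.
case: (ltngtP l k) => [lk|kl|->//]; first exact/ltW/mono.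
have k1 : (k.+1 < size s)%N by exact: leq_ltn_trans ls.
have := lt k1; rewrite ltNge => /negP; case.
by move: kl; rewrite leq_eqVlt => /orP[/eqP->//|/mono/(_ ls)/ltW].
Qed.

(** Strips and edges are closed pieces that meet at end points, so openness is tested separately to
    the right and to the left of each point. Up to [b] the set is all or nothing, as are preimages
    under a ray below its leaf. *)
Lemma open_pieces {R : realType} (A : set R) (b : R) :
  (forall t, t <= b -> A t <-> A b) ->
  (forall t, b <= t -> exists J : set R, [/\ open (A : set (subspace J)),
     J t & \forall s \near t, t <= s -> J s]) ->
  (forall t, b < t -> exists J : set R, [/\ open (A : set (subspace J)),
     J t & \forall s \near t, s <= t -> J s]) ->
  open A.
Proof.
move=> Ab Ar Al; rewrite openE => t At; rewrite /interior.
have half (J : set R) (D : R -> Prop) : open (A : set (subspace J)) -> J t ->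
    (\forall s \near t, D s -> J s) -> \forall s \near t, D s -> A s.
  move=> /open_subspaceP[V oV VJ] Jt JD.
  have Vt : V t by have : (A `&` J) t by []; rewrite -VJ => -[].
  near=> s => Ds; have : (V `&` J) s; last by rewrite VJ => -[].
  by split; [near: s; exact: open_nbhs_nbhs|apply: (near JD s)].
have [tb|bt] := ltP t b.
  have : \forall s \near t, s < b by exact: lt_nbhsl.
  apply: filterS => s sb; apply/(Ab _ (ltW sb)); exact/(Ab _ (ltW tb)).
have [J [oJ Jt nJ]] := Ar t bt; have right_ := half J (fun s => t <= s) oJ Jt nJ.
have left_ : \forall s \near t, s <= t -> A s.
  move: bt; rewrite le_eqVlt => /orP[/eqP bt|/Al[J' [oJ' J't nJ']]]; last exact: half oJ' _ _.
  by near=> s; rewrite -bt => /Ab; rewrite bt => -[_]; apply.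
near=> s; case: (leP t s) => [|/ltW]; first by apply: (near right_ s).
by apply: (near left_ s).
Unshelve. all: by end_near. Qed.

(** * The merge tree of a Morse set *)

Section Strips.
Context {R : realType} (S : persistent_set R) (tau : seq R).
Hypothesis ct : change_times S tau.

Lemma strip_ge k t : strip tau k t -> tau`_k <= t.
Proof. by rewrite /strip; case: ifP => _ /=; rewrite in_itv /= ?andbT// => /andP[]. Qed.

Lemma strip_le k t : strip tau k t -> (k.+1 < size tau)%N -> t <= tau`_k.+1.
Proof. by rewrite /strip => + k1; rewrite k1 /= in_itv /= => /andP[]. Qed.

Lemma stripP k t : tau`_k <= t -> ((k.+1 < size tau)%N -> t <= tau`_k.+1) ->
  strip tau k t.
Proof.
move=> kt tk; rewrite /strip; case: ifPn => k1 /=; rewrite in_itv /= kt//.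
exact: tk.
Qed.

Lemma strip_near_right k t : (k < size tau)%N -> tau`_k <= t ->
  ((k.+1 < size tau)%N -> t < tau`_k.+1) ->
  \forall s \near t, t <= s -> strip tau k s.
Proof.
move=> ks kt tk; have [k1|k1] := boolP (k.+1 < size tau)%N; last first.
  near=> s => ts; apply: stripP; first exact: le_trans ts.
  by move=> k1'; rewrite k1' in k1.
have : \forall s \near t, s < tau`_k.+1 by apply: lt_nbhsl; exact: tk.
apply: filterS => s sk ts; apply: stripP => [|_]; [exact: le_trans ts|exact: ltW].
Unshelve. all: by end_near. Qed.

Lemma strip_near_left k t : (k < size tau)%N -> tau`_k < t ->
  ((k.+1 < size tau)%N -> t <= tau`_k.+1) ->
  \forall s \near t, s <= t -> strip tau k s.
Proof.
move=> ks kt tk; have : \forall s \near t, tau`_k < s by exact: lt_nbhsr.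
apply: filterS => s ks' st; apply: stripP => [|/tk]; first exact: ltW.
exact: le_trans.
Qed.

(** As [b] is itself a change time, no strip straddles it, and the strips starting at [b] or later
    suffice for the points from [b] on. *)
Lemma strips_open (A : set R) b : b \in tau -> (forall t, t <= b -> A t <-> A b) ->
  (forall k, (k < size tau)%N -> b <= tau`_k ->
     open (A : set (subspace (strip tau k)))) -> open A.
Proof.
move=> btau Ab Ak; have b0 : tau`_0 <= b.
  have /(nthP 0)[[|l] ls <-//] := btau.
  exact/ltW/(sorted_nth_lt (times_sorted ct) (ltn0Sn l) ls).
apply: open_pieces Ab _ _ => t bt.
  have [k [ks kt tk]] := times_locate ct (le_trans b0 bt).
  exists (strip tau k); split; last exact: strip_near_right.
    apply: Ak => //; apply: sorted_nth_le btau ks _; first exact: times_sorted ct.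
    by move=> /tk; exact: le_lt_trans.
  by apply: stripP => // /tk/ltW.
have [k [ks kt tk]] := times_locate_left ct (le_lt_trans b0 bt).
exists (strip tau k); split; last exact: strip_near_left.
  apply: Ak => //; apply: sorted_nth_le btau ks _; first exact: times_sorted ct.
  by move=> /tk; exact: lt_le_trans.
by apply: stripP => //; exact: ltW.
Qed.

Local Notation point := (strip_point S tau).

(** As a set, the associated tree is the poset of elements; this is the quotient map onto it. *)
Definition strip_value (a : point) : element S :=
  existT [eta S] (strip_height a)
    (Defs.shift (strip_ge (strip_heightP a)) (strip_elt a)).

Lemma glue_value a b : clos_refl_sym_trans _ (@Defs.glue R S tau) a b ->
  strip_value a = strip_value b.
Proof.
elim=> {a b} [a b [i j ij le x hi hj]|//|a b _ ->//|a b c _ -> _ ->//].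
rewrite /strip_value /=; congr existT; apply/esym; exact: shift_comp.
Qed.

(** Only the upper end of a bounded strip needs to be moved, by one gluing step to the lower end of
    the next strip. In half-open strips representatives are unique, which yields the converse
    direction of [glueP]. *)
Lemma strip_normalize (a : point) : exists b : point,
  clos_refl_sym_trans _ (@Defs.glue R S tau) a b /\
  (((strip_idx b).+1 < size tau)%N -> strip_height b < tau`_(strip_idx b).+1).
Proof.
case: a => k x t ht; have [k1|k1] := boolP (k.+1 < size tau)%N; last first.
  exists (StripPoint x ht); split; first exact: rst_refl.
  by move=> /= k1'; rewrite k1' in k1.
have := strip_le ht k1; rewrite le_eqVlt => /orP[/eqP tE|tlt]; last first.
  by exists (StripPoint x ht); split; first exact: rst_refl.
pose j := Ordinal k1; have tE' : t = tau`_j by [].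
have kj : tau`_k <= tau`_j by rewrite -tE'; exact: strip_ge ht.
move: ht; rewrite tE' => ht.
have jlt : (j.+1 < size tau)%N -> tau`_j < tau`_j.+1.
  by move=> j1; apply: (sorted_nth_lt (times_sorted ct)).
have hj : strip tau j tau`_j by apply: stripP => // /jlt/ltW.
exists (StripPoint (Defs.shift kj x) hj); split=> //.
by apply: rst_step; exact: Glue.
Qed.

Lemma glueP a b : clos_refl_sym_trans _ (@Defs.glue R S tau) a b <->
  strip_value a = strip_value b.
Proof.
split; first exact: glue_value.
have [a' [aa' na]] := strip_normalize a; have [b' [bb' nb]] := strip_normalize b.
rewrite (glue_value aa') (glue_value bb') => ab.
apply: rst_trans aa' _; apply: rst_trans (rst_sym _ _ _ _ bb') => {a b bb'}.
case: a' b' na nb ab => [k x t ht] [l y s hs] /= na nb ab.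
have ts := existT_inj1 ab; rewrite /= in ts; subst s.
have kl : k = l.
  have le (i j : 'I_(size tau)) : strip tau i t ->
      ((j.+1 < size tau)%N -> t < tau`_j.+1) -> (i <= j)%N.
    move=> hi hj; rewrite leqNgt; apply/negP => ji.
    have j1 : (j.+1 < size tau)%N by exact: leq_ltn_trans (ltn_ord i).
    have := lt_le_trans (le_lt_trans (strip_ge hi) (hj j1)).
    move=> /(_ tau`_i); rewrite ltxx => F; suff : false by []; apply: F.
    move: ji; rewrite leq_eqVlt => /orP[/eqP->//|ji].
    exact/ltW/(sorted_nth_lt (times_sorted ct) ji).
  by apply/val_inj/eqP; rewrite eqn_leq (le _ _ ht nb) (le _ _ hs na).
subst l; have /= xy := existT_inj2 ab.
have [inj _] := shift_bij ct (strip_ge ht) (ltn_ord k) (lexx _) na.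
move: xy; rewrite (Prop_irrelevance hs ht) => /inj ->.
exact: rst_refl.
Qed.

Lemma element_strip p : exists a, strip_value a = p.
Proof.
case: p => t x; have [k [ks kt tk]] := times_locate ct (times_first ct x).
have [_ /(_ x)[y yx]] := shift_bij ct kt ks (lexx _) tk.
have ht : strip tau k t by apply: stripP => // /tk/ltW.
pose k' := Ordinal ks.
exists (StripPoint (y : S tau`_k') ht); rewrite /strip_value /=; congr existT.
by rewrite -yx; congr (Defs.shift _ _); exact: Prop_irrelevance.
Qed.

Section Presentation.
Context {n : nat} (m : 'I_n -> 'I_n -> R) (c : forall i t, m i i <= t -> S t).
Hypotheses (um : ultrametric m) (ps : presentedS c).
Local Notation el i t it := (existT [eta S] t (@c i t it)).

Lemma el_eq i j s t (is_ : m i i <= s) (jt : m j j <= t) :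
  el i s is_ = el j t jt <-> s = t /\ m i j <= t.
Proof.
split=> [e|[st ij]]; last by subst s; exact: (prS_el_eq ps).
split; first exact: existT_inj1 e.
by apply/(branch_el um ps i jt); rewrite -e; exact: (branch_self um ps).
Qed.

Lemma strip_open (X : topologicalType) (q : point -> X) (u : 'I_n -> R -> X)
    (i : 'I_n) (k : 'I_(size tau)) (ik : m i i <= tau`_k) (U : set X) :
  (forall a j (jt : m j j <= strip_height a),
     strip_value a = el j (strip_height a) jt -> q a = u j (strip_height a)) ->
  open ([set t | exists h : strip tau k t, U (q (StripPoint (c ik) h))]
     : set (subspace (strip tau k))) =
  open (u i @^-1` U : set (subspace (strip tau k))).
Proof.
move=> qE; rewrite -[in RHS]open_subspaceTI; congr open.
have E t (h : strip tau k t) : q (StripPoint (c ik) h) = u i t.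
  have it := le_trans ik (strip_ge h).
  rewrite (qE (StripPoint (c ik) h) i it)// /strip_value /=; congr existT.
  exact: (prS_shift ps).
apply/seteqP; split=> t /=; first by move=> [h]; rewrite E.
by move=> [h Ut]; exists h; rewrite E.
Qed.

Lemma presented_associated (X : topologicalType) (h : X -> R) u :
  presented h m u -> associated_tree S tau h.
Proof.
move=> pr.
have qex (a : point) : exists x : X, exists i (it : m i i <= strip_height a),
    strip_value a = el i (strip_height a) it /\ x = u i (strip_height a).
  have [i [t [it e]]] := prS_element ps (strip_value a).
  have te := existT_inj1 e; rewrite /= in te; subst t.
  by exists (u i (strip_height a)), i, it.
have [q qP] := choice qex.
have qE a j (jt : m j j <= strip_height a) :
    strip_value a = el j (strip_height a) jt -> q a = u j (strip_height a).
  have [i [it [-> ->]]] := qP a => /el_eq[_ ij].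
  exact: (pr_eqT um pr).
exists q; split.
- move=> x; have [i [ix ui]] := pr_leaf pr x.
  have [a aE] := element_strip (el i (h x) ix).
  have ha : strip_height a = h x by exact: existT_inj1 aE.
  exists a; rewrite (qE a i); first by rewrite ha.
    by rewrite ha.
  by move=> ?; rewrite aE; apply/el_eq; rewrite ha.
- move=> a b; rewrite glueP.
  have [i [it [-> ->]]] := qP a; have [j [jt [-> ->]]] := qP b.
  rewrite el_eq; split; first exact: (pr_eqP pr).
  by move=> [-> ij]; exact: (pr_eqT um pr).
- move=> U; split=> [oU k x|oU].
    have [i [ik ->]] := prS_cover ps x.
    rewrite (strip_open _ _ qE); apply: open_subspaceW.
    exact: ((pr_open pr U).1 oU i).
  apply/(pr_open pr) => i; apply: (strips_open (b := m i i)).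
  + exact: (merge_in_times um ps).
  + by move=> t ti /=; rewrite (pr_below pr ti).
  + move=> k ks ik; pose k' := Ordinal ks.
    by have := oU k' (c (ik : m i i <= tau`_k')); rewrite (strip_open _ _ qE).
- by move=> a; have [i [it [_ ->]]] := qP a; rewrite (pr_heightE pr).
Qed.

(** The ray [u i] sends [t] to the class of the element above the leaf [i] at the time [t], or of
    the leaf itself for earlier [t]. Equality of classes is read off from [glueP], and the quotient
    topology is tested strip by strip. *)
Lemma associated_presented (X : topologicalType) (h : X -> R) :
  associated_tree S tau h -> exists u, presented h m u.
Proof.
move=> [q [qsurj qeq qopen qh]].
have mx i t : m i i <= Num.max t (m i i) by rewrite le_max lexx orbT.
have uex (p : 'I_n * R) : exists x : X, exists a,
    strip_value a = el p.1 _ (mx p.1 p.2) /\ q a = x.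
  by have [a aE] := element_strip (el p.1 _ (mx p.1 p.2)); exists (q a), a.
have [u' u'P] := choice uex; pose u i t := u' (i, t).
have uP i t : exists a, strip_value a = el i _ (mx i t) /\ q a = u i t := u'P (i, t).
have qE a j (jt : m j j <= strip_height a) :
    strip_value a = el j (strip_height a) jt -> q a = u j (strip_height a).
  move=> aE; have [b [bE <-]] := uP j (strip_height a).
  by apply/qeq/glueP; rewrite aE bE; apply/el_eq; rewrite max_l.
have ueq i j s t : u i s = u j t <->
    Num.max s (m i i) = Num.max t (m j j) /\ m i j <= Num.max t (m j j).
  have [a [aE <-]] := uP i s; have [b [bE <-]] := uP j t.
  by rewrite qeq glueP aE bE el_eq.
exists u; split.
- move=> i t; have [a [aE <-]] := uP i t; rewrite qh; exact: existT_inj1 aE.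
- move=> i t ti; by apply/ueq; rewrite maxxx max_r.
- move=> x; have [a <-] := qsurj x; rewrite qh.
  have [i [t [it e]]] := prS_element ps (strip_value a).
  have te := existT_inj1 e; rewrite /= in te; subst t.
  by exists i; rewrite (qE _ _ it).
- move=> i j t it jt; rewrite ueq !max_l//.
  by split=> [[]|].
- move=> U; split=> [/qopen oU i|oU].
    apply: (strips_open (b := m i i)).
    + exact: (merge_in_times um ps).
    + move=> t ti /=; suff -> : u i t = u i (m i i) by [].
      by apply/ueq; rewrite maxxx max_r.
    + move=> k ks ik; pose k' := Ordinal ks.
      by have := oU k' (c (ik : m i i <= tau`_k')); rewrite (strip_open _ _ qE).
  apply/qopen => k x; have [i [ik ->]] := prS_cover ps x.
  by rewrite (strip_open _ _ qE); apply: open_subspaceW.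
Qed.

End Presentation.
End Strips.

(** * Leaves of a Morse set *)

Section Leaves.
Context {R : realType} (S : persistent_set R) (tau : seq R).
Hypotheses (ct : change_times S tau) (fin : forall t, finite_set [set: S t]).

Definition leaf (p : element S) : Prop := forall q, element_le q p -> q = p.

Lemma element_le_shift s t (st : s <= t) (x : S s) :
  element_le (existT [eta S] s x) (existT [eta S] t (Defs.shift st x)).
Proof. by exists st. Qed.

Lemma element_le_trans (p q r : element S) : element_le p q -> element_le q r -> element_le p r.
Proof.
case: p q r => [s x] [t y] [v z] [/= st <-] [/= tv <-].
by exists (le_trans st tv); rewrite /= (shift_comp _ _ (le_trans st tv)).
Qed.

Lemma element_time (p : element S) : exists k (y : S tau`_k),
  (k < size tau)%N /\ element_le (existT [eta S] tau`_k y) p.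
Proof.
case: p => t x; have [k [ks kt tk]] := times_locate ct (times_first ct x).
have [_ /(_ x)[y <-]] := shift_bij ct kt ks (lexx _) tk.
by exists k, y; split=> //; exact: element_le_shift.
Qed.

Lemma leaf_time p : leaf p -> projT1 p \in tau.
Proof.
have [k [y [ks yp]]] := element_time p => lp.
by rewrite -(lp _ yp); exact: mem_nth.
Qed.

(** Going down from change time to change time ends after finitely many steps, at a minimal
    element. *)
Lemma leaf_below p : exists2 q, leaf q & element_le q p.
Proof.
have [k [y [ks yp]]] := element_time p.
suff [q lq qy] : exists2 q, leaf q & element_le q (existT [eta S] tau`_k y).
  by exists q => //; exact: element_le_trans yp.
elim/ltn_ind: k y ks {yp} => k IH y ks.
have [ly|] := pselect (leaf (existT [eta S] tau`_k y)).
  by exists (existT [eta S] tau`_k y) => //; exists (lexx _); rewrite /= shift_id.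
move=> /existsNP[[s x] /not_implyP[[/= sk xy] nxy]].
have slt : s < tau`_k.
  rewrite lt_neqAle sk andbT; apply/eqP => se; apply: nxy; subst s.
  by rewrite -xy shift_id.
have [l [z [ls [/= lsx zx]]]] := element_time (existT [eta S] s x).
have lk : (l < k)%N.
  rewrite ltnNge leq_eqVlt; apply/negP => /orP[/eqP kl|kl].
    by move: (le_lt_trans lsx slt); rewrite kl ltxx.
  have := sorted_nth_lt (times_sorted ct) kl ls.
  by rewrite ltNge (ltW (le_lt_trans lsx slt)).
have [q lq qz] := IH l lk z ls; exists q => //.
apply: element_le_trans qz _; exists (le_trans lsx sk).
rewrite /= -xy -zx; exact/esym/shift_comp.
Qed.

Lemma finite_leaves : exists n (l : 'I_n -> element S),
  injective l /\ forall p, leaf p <-> exists i, p = l i.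
Proof.
have fl : finite_set (leaf : set {classic (element S)}).
  pose F k : set {classic (element S)} := existT [eta S] tau`_k @` setT.
  have fF : finite_set (\bigcup_(k in `I_(size tau)) F k).
    by apply: bigcup_finite => // k _; exact: finite_image.
  apply: sub_finite_set fF => p lp; have [k [y [ks yp]]] := element_time p.
  by exists k => //; rewrite -(lp _ yp); exists y.
have [s sE] := (finite_seqP _).1 fl.
exists (size (undup s)), (tnth (in_tuple (undup s))); split.
  move=> i j; have [x0 _] : exists x0 : {classic (element S)}, True.
    by exists (tnth (in_tuple (undup s)) i).
  rewrite !(tnth_nth x0) /= => /(uniqP x0 (undup_uniq s)) e.
  by apply/val_inj/e; rewrite inE.
move=> p; have -> : leaf p = ((p : {classic (element S)}) \in undup s).
  by rewrite (mem_undup s p); have := congr1 (fun A => A p) sE; rewrite /= /mkset => ->.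
split=> [pu|[i ->]]; last exact: (mem_tnth i (in_tuple (undup s))).
have /tnthP[i ->] : (p : {classic (element S)}) \in in_tuple (undup s) by [].
by exists i.
Qed.

(** Leaves are the minimal elements, and [m i j] is the first time at which their images agree. The
    first time exists because agreement at [t] already holds at the last change time up to [t], by
    injectivity of the shift, so only finitely many times have to be searched. *)
Lemma morse_presented : exists n m (c : forall i t, m i i <= t -> S t),
  [/\ (0 < n)%N, ultrametric (n := n) m & presentedS c].
Proof.
have [n [l [linj lP]]] := finite_leaves.
have lb i : leaf (l i) by apply/lP; exists i.
pose b i := projT1 (l i).
pose E i j t := exists (it : b i <= t) (jt : b j <= t),
  Defs.shift it (projT2 (l i)) = Defs.shift jt (projT2 (l j)).
have Eup i j s t : s <= t -> E i j s -> E i j t.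
  move=> st [is_ [js e]]; exists (le_trans is_ st), (le_trans js st).
  by rewrite -(shift_comp is_ st) -(shift_comp js st) e.
have Esym i j t : E i j t -> E j i t by move=> [it [jt e]]; exists jt, it.
have Eb i j t : E i j t -> b i <= t by case.
have Et i j k t : E i j t -> E j k t -> E i k t.
  move=> [it [jt e]] [jt' [kt e']]; exists it, kt; rewrite e -e'.
  by congr Defs.shift; exact: bool_irrelevance.
have Eex i j : exists r, forall t, E i j t <-> r <= t.
  pose P k := (k < size tau)%N && `[< E i j tau`_k >].
  have Pex : exists k, P k.
    have s0 := times_nonempty ct.
    exists (size tau).-1; rewrite /P prednK// leqnn /=; apply/asboolP.
    have le k : projT1 (l k) <= tau`_(size tau).-1.
      apply: (sorted_nth_le (times_sorted ct)); first exact/leaf_time/lb.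
        by rewrite prednK.
      by rewrite prednK// ltnn.
    exists (le i), (le j); have := times_after ct (lexx _).
    move=> /card_set_bijP[f [fI fi _]].
    set x := Defs.shift _ _; set y := Defs.shift _ _; apply: fi; rewrite ?inE//.
    by have := fI x I; have := fI y I => /=; case: (f x); case: (f y).
  case: (ex_minnP Pex) => k /andP[ks /asboolP Ek] kmin.
  exists tau`_k => t; split=> [[it [jt e]]|kt]; last exact: Eup Ek.
  have t0 := le_trans (times_first ct (projT2 (l i))) it.
  have [r [rs rt tr]] := times_locate ct t0.
  have br x : b x <= t -> b x <= tau`_r.
    move=> xt; apply: (sorted_nth_le (times_sorted ct)) => //.
      exact/leaf_time/lb.
    by move=> /tr; exact: le_lt_trans.
  have [inj _] := shift_bij ct rt rs (lexx _) tr.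
  have Er : E i j tau`_r.
    exists (br _ it), (br _ jt); apply: inj.
    by rewrite (shift_comp _ _ it) (shift_comp _ _ jt).
  apply: (le_trans _ rt); have : (k <= r)%N by apply: kmin; rewrite /P rs; apply/asboolP.
  rewrite leq_eqVlt => /orP[/eqP->//|kr].
  exact/ltW/(sorted_nth_lt (times_sorted ct) kr rs).
have [m' m'P] := choice (fun p => Eex p.1 p.2).
pose m i j := m' (i, j).
have mP i j t : E i j t <-> m i j <= t := m'P (i, j) t.
have mb i : m i i = b i.
  apply/le_anti/andP; split; last by apply: (Eb i i); apply/mP.
  by apply/mP; exists (lexx _), (lexx _).
have mi i t : m i i <= t -> b i <= t by rewrite mb.
exists n, m, (fun i t it => Defs.shift (mi i t it) (projT2 (l i))); split.
- have s0 := times_nonempty ct.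
  have := times_after ct (lexx _) => /card_set_bijP[f [_ _ /(_ 0%N isT)[x _ _]]].
  have [q /lP[i _] _] := leaf_below (existT [eta S] _ x).
  exact: leq_ltn_trans (ltn_ord i).
- split.
  + by move=> i j; apply/le_anti/andP; split; apply/mP/Esym/mP.
  + move=> i j k; apply/mP; apply: (Et i j k); apply/mP.
      by rewrite le_max lexx.
    by rewrite le_max lexx orbT.
  (* If [m i j] were the birth of [i], then the leaf [j] would lie below the leaf [i] and equal it
     by minimality. *)
  + move=> i j ij; have bij : b i <= m i j by apply: (Eb i j); apply/mP.
    rewrite mb lt_neqAle bij andbT; apply: contra ij => /eqP be.
    have [it [jt e]] : E i j (b i) by apply/mP; rewrite be.
    apply/eqP/esym/linj; apply: (lb i); exists jt.
    by rewrite -e shift_id.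
- split.
  + move=> t x; have [q /lP[i ->] [/= it ix]] := leaf_below (existT [eta S] t x).
    have it' : m i i <= t by rewrite mb.
    by exists i, it'; rewrite -ix; congr Defs.shift; exact: bool_irrelevance.
  + move=> i j t it jt; split=> [e|/mP[it' [jt' e]]].
      by apply/mP; exists (mi i t it), (mi j t jt).
    by rewrite (bool_irrelevance (mi i t it) it') (bool_irrelevance (mi j t jt) jt').
  + by move=> i r t ir rt it; exact: shift_comp.
Qed.

End Leaves.

(** * Merge heights with prescribed bars *)

Section MergeHeights.
Context {R : realType} {N : nat} (b d : 'I_N -> R).

(* The bars [b j, d j) merge along par: at height d j the bar j is absorbed by
   the bar par j. The bar 0 is never absorbed, so that d and par are
   meaningless there. *)
Definition admissible (par : 'I_N -> 'I_N) : Prop :=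
  forall j : 'I_N, (0 < j)%N -> (par j < j)%N /\ b (par j) < b j.

(** Later indices have earlier deaths, so of two leaves the one with the larger index is absorbed
    first, and its parent continues in its place. For admissible [par] the sum of the indices drops
    in each call, so the fuel [i + j] never leads to the default 0. *)
Fixpoint merge_rec (par : 'I_N -> 'I_N) (fuel : nat) (i j : 'I_N) : R :=
  if i == j then b i else
  if fuel is f.+1 then
    if (j < i)%N then Num.max (d i) (merge_rec par f (par i) j)
    else Num.max (d j) (merge_rec par f i (par j))
  else 0.

Definition merge_height par (i j : 'I_N) : R := merge_rec par (i + j) i j.

Hypothesis bd : forall j : 'I_N, (0 < j)%N -> b j < d j.
Hypothesis dd : forall j k : 'I_N, (0 < j)%N -> (j < k)%N -> d k < d j.

Section Par.
Variables (par : 'I_N -> 'I_N) (ap : admissible par).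
Local Notation m := (merge_height par).

Lemma par_lt (j : 'I_N) : (0 < j)%N -> (par j < j)%N.
Proof. by move=> /ap[]. Qed.

Lemma par_birth (j : 'I_N) : (0 < j)%N -> b (par j) < b j.
Proof. by move=> /ap[]. Qed.

Lemma merge_rec_fuel f g (i j : 'I_N) : (i + j <= f)%N -> (i + j <= g)%N ->
  merge_rec par f i j = merge_rec par g i j.
Proof.
elim: f g i j => [|f IH] [|g] i j //=; rewrite ?leqn0 ?addn_eq0.
- move=> /andP[/eqP i0 /eqP j0] _.
  by rewrite -val_eqE /= i0 j0.
- move=> _ /andP[/eqP i0 /eqP j0].
  by rewrite -val_eqE /= i0 j0.
case: eqVneq => // ij f1 g1; case: (ltnP j i) => ji.
  have lt := par_lt (leq_ltn_trans (leq0n _) ji).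
  by congr Num.max; apply: IH; lia.
have {}ji : (i < j)%N by rewrite ltn_neqAle ji val_eqE ij.
have lt := par_lt (leq_ltn_trans (leq0n _) ji).
by congr Num.max; apply: IH; lia.
Qed.

Lemma merge_refl i : m i i = b i.
Proof. by rewrite /merge_height; case: (_ + _)%N => [|f] /=; rewrite eqxx. Qed.

Lemma merge_gt (i j : 'I_N) : (j < i)%N -> m i j = Num.max (d i) (m (par i) j).
Proof.
move=> ji; have lt := par_lt (leq_ltn_trans (leq0n _) ji).
rewrite /merge_height; case E: (i + j)%N => [|f] /=; first by lia.
rewrite -val_eqE /= gtn_eqF// ji; congr Num.max.
by apply: merge_rec_fuel; lia.
Qed.

Lemma merge_lt (i j : 'I_N) : (i < j)%N -> m i j = Num.max (d j) (m i (par j)).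
Proof.
move=> ij; have lt := par_lt (leq_ltn_trans (leq0n _) ij).
rewrite /merge_height; case E: (i + j)%N => [|f] /=; first by lia.
rewrite -val_eqE /= ltn_eqF// ltnNge (ltnW ij) /=; congr Num.max.
by apply: merge_rec_fuel; lia.
Qed.

Lemma merge_sym i j : m i j = m j i.
Proof.
have [k] := ubnP (i + j); elim: k i j => // k IH i j ijk.
case: (ltngtP i j) => [ij|ji|/val_inj->//].
  have lt := par_lt (leq_ltn_trans (leq0n _) ij).
  by rewrite (merge_lt ij) (merge_gt ij) (IH i)//; lia.
have lt := par_lt (leq_ltn_trans (leq0n _) ji).
by rewrite (merge_lt ji) (merge_gt ji) (IH j)//; lia.
Qed.

Lemma merge_ge_death (i j : 'I_N) : (j < i)%N -> d i <= m i j.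
Proof. by move=> ji; rewrite merge_gt// le_max lexx. Qed.

Lemma merge_birth_lt i j : i != j -> b i < m i j.
Proof.
case: (ltngtP i j) => [ij _|ji _|/val_inj->]; last by rewrite eqxx.
  elim/ltn_ind: {j}(nat_of_ord j) {-2}j (erefl (nat_of_ord j)) ij => k IH j jk ij.
  subst k; have j0 := leq_ltn_trans (leq0n _) ij.
  rewrite merge_lt// lt_max; have [ip|ip|/val_inj ip] := ltngtP i (par j).
  - by rewrite (IH _ (par_lt j0)) ?orbT.
  - have i0 : (0 < i)%N by exact: leq_ltn_trans ip.
    by rewrite (lt_le_trans (bd i0) (merge_ge_death ip)) orbT.
  - by rewrite ip (lt_trans (par_birth j0) (bd j0)).
exact: lt_le_trans (bd (leq_ltn_trans (leq0n _) ji)) (merge_ge_death ji).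
Qed.

(** Replacing the largest of three distinct indices by its parent lowers their sum, and the death of
    that leaf enters both of the heights that involve it. *)
Lemma merge_triangle i j k : m i k <= Num.max (m i j) (m j k).
Proof.
have [s] := ubnP (i + j + k); elim: s i j k => // s IH i j k ijk.
have [->|ik] := eqVneq i k.
  rewrite merge_refl le_max; have [->|kj] := eqVneq k j.
    by rewrite merge_refl lexx.
  by rewrite (ltW (merge_birth_lt kj)).
have [->|ij] := eqVneq i j; first by rewrite le_max lexx orbT.
have [<-|jk] := eqVneq j k; first by rewrite le_max lexx.
rewrite -!val_eqE in ik ij jk.
have [/andP[ji ki]|[/andP[ij' kj]|/andP[ik' jk']]] :
    ((j < i)%N && (k < i)%N) \/ ((i < j)%N && (k < j)%N) \/ ((i < k)%N && (j < k)%N).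
  by move: ik ij jk => /=; lia.
- have lt := par_lt (leq_ltn_trans (leq0n _) ji).
  rewrite (merge_gt ji) (merge_gt ki) ge_max !le_max lexx /=.
  have /orP[H|H] : (m (par i) k <= m (par i) j) || (m (par i) k <= m j k).
  - by rewrite -le_max IH//; lia.
  - by rewrite H !orbT.
  - by rewrite H !orbT.
- have lt := par_lt (leq_ltn_trans (leq0n _) ij').
  rewrite (merge_lt ij') (merge_gt kj).
  have /orP[H|H] : (m i k <= m i (par j)) || (m i k <= m (par j) k).
  - by rewrite -le_max IH//; lia.
  - by rewrite !le_max H !orbT.
  - by rewrite !le_max H !orbT.
- have lt := par_lt (leq_ltn_trans (leq0n _) ik').
  rewrite (merge_lt ik') (merge_lt jk') ge_max !le_max lexx /= orbT /=.
  have /orP[H|H] : (m i (par k) <= m i j) || (m i (par k) <= m j (par k)).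
  - by rewrite -le_max IH//; lia.
  - by rewrite H.
  - by rewrite H !orbT.
Qed.

Lemma merge_ultrametric : ultrametric m.
Proof.
split; [exact: merge_sym|exact: merge_triangle|].
by move=> i j ij; rewrite merge_refl merge_birth_lt.
Qed.

(** In an equilateral triple with largest index [i], the death of [i] lies below [m j k], so the
    other two heights are those of [par i]. Thus [par i], [j], [k] are again equilateral, with a
    smaller sum; and [par i] is neither [j] nor [k], since [m j k] is no birth of these. *)
Lemma merge_binary : binary m.
Proof.
move=> i j k ij jk ik [e1 e2].
have [s] := ubnP (i + j + k); elim: s i j k ij jk ik e1 e2 => // s IH.
suff wl i j k : i != j -> j != k -> i != k -> m i j = m j k -> m j k = m i k ->
    (j < i)%N -> (k < i)%N -> (i + j + k < s.+1)%N -> False.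
  move=> i j k ij jk ik e1 e2 ijk; have nij := ij; have njk := jk; have nik := ik.
  rewrite -!val_eqE in nij njk nik.
  have [/andP[ji ki]|[/andP[ij' kj]|/andP[ik' jk']]] :
      ((j < i)%N && (k < i)%N) \/ ((i < j)%N && (k < j)%N) \/ ((i < k)%N && (j < k)%N).
    by move: nij njk nik => /=; lia.
  - exact: (wl i j k).
  - apply: (wl j i k _ ik jk _ (esym e2) ij' kj); first by rewrite eq_sym.
      by rewrite merge_sym e1.
    by move: ijk; lia.
  - apply: (wl k j i _ _ _ _ _ jk' ik'); rewrite 1?eq_sym//.
    + by rewrite merge_sym (merge_sym j i).
    + by rewrite (merge_sym j i) (merge_sym k i) e1.
    + by move: ijk; lia.
move=> ij jk ik e1 e2 ji ki ijk; have i0 := leq_ltn_trans (leq0n _) ji.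
have lt := par_lt i0; have um := merge_ultrametric.
have dm : d i < m j k.
  case: (ltngtP j k) jk => [jk _|kj _|/val_inj->]; last by rewrite eqxx.
    rewrite merge_sym; apply: lt_le_trans (merge_ge_death jk).
    by apply: dd => //; exact: leq_ltn_trans jk.
  apply: lt_le_trans (merge_ge_death kj).
  by apply: dd => //; exact: leq_ltn_trans kj.
have pj : m (par i) j = m j k.
  by move: dm; rewrite -e1 (merge_gt ji) lt_max ltxx /= => /ltW/max_r->.
have pk : m (par i) k = m j k.
  by move: dm; rewrite e2 (merge_gt ki) lt_max ltxx /= => /ltW/max_r->.
apply: (IH (par i) j k _ jk); rewrite ?pj ?pk//; last by lia.
- apply/eqP => pje; move: pj; rewrite pje merge_refl => e.
  by have := merge_birth_lt jk; rewrite -e ltxx.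
- apply/eqP => pke; move: pk; rewrite pke merge_refl merge_sym => e.
  by have := merge_birth_lt (i := k) (j := j); rewrite eq_sym jk -e ltxx => /(_ isT).
Qed.

(** At its death a leaf meets its older parent. Before that it meets only leaves of larger index,
    and following their parents leads back to [j] through decreasing births. *)
Lemma merge_elder (j : 'I_N) t : b j <= t ->
  elder_at m j t <-> ((0 < j)%N -> t < d j).
Proof.
move=> jt; split=> [je j0|lt].
  rewrite ltNge; apply/negP => dt.
  have mp : m j (par j) <= t.
    rewrite merge_gt ?par_lt// merge_refl ge_max dt.
    by rewrite (le_trans (ltW (par_birth j0)) jt).
  have := je _ mp; rewrite -val_eqE /= ltn_eqF ?par_lt// !merge_refl => /(_ isT).
  by move=> /lt_trans/(_ (par_birth j0)); rewrite ltxx.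
move=> k; elim/ltn_ind: {k}(nat_of_ord k) {-2}k (erefl (nat_of_ord k)) => l IH k kl.
subst l => mt kj; rewrite !merge_refl.
case: (ltngtP j k) => [jk|kj'|/val_inj e]; last by rewrite e eqxx in kj.
  have k0 := leq_ltn_trans (leq0n _) jk.
  move: mt; rewrite merge_lt// ge_max => /andP[_ mt].
  have [pe|pe] := eqVneq (par k) j; first by rewrite -pe par_birth.
  apply: lt_trans (par_birth k0); rewrite -!merge_refl.
  exact: (IH _ (par_lt k0)).
have j0 := leq_ltn_trans (leq0n _) kj'.
by have := lt_le_trans (lt j0) (merge_ge_death kj'); rewrite ltNge mt.
Qed.

Lemma merge_par (j : 'I_N) : (0 < j)%N -> m j (par j) = d j.
Proof.
move=> j0; rewrite merge_gt ?par_lt// merge_refl max_l//.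
exact/ltW/(lt_trans (par_birth j0))/bd.
Qed.

Lemma merge_par_elder (j : 'I_N) : (0 < j)%N -> elder_at m (par j) (d j).
Proof.
move=> j0; apply/merge_elder; first exact/ltW/(lt_trans (par_birth j0))/bd.
by move=> p0; apply: dd => //; exact: par_lt.
Qed.

(** The elder is found by passing to the parent as long as the current leaf is dead at [t]. *)
Lemma merge_has_elders : has_elders m.
Proof.
move=> i t; rewrite merge_refl.
elim/ltn_ind: {i}(nat_of_ord i) {-2}i (erefl (nat_of_ord i)) => l IH i il it.
subst l; have [[i0 dt]|no] := pselect ((0 < i)%N /\ d i <= t).
  have [|j pj je] := IH _ (par_lt i0) (par i) (erefl _).
    exact: le_trans (ltW (par_birth i0)) it.
  exists j => //; apply: (ultra_trans merge_ultrametric) pj.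
  by rewrite merge_par.
exists i; first by rewrite merge_refl.
apply/merge_elder => // i0; rewrite ltNge; apply/negP => dt.
by apply: no.
Qed.

End Par.

(** The parent of [j] is recovered from [m] as the elder, at the height [d j], of the component of
    [j]. *)
Lemma merge_height_inj par par' : admissible par -> admissible par' ->
  merge_height par = merge_height par' ->
  forall j : 'I_N, (0 < j)%N -> par j = par' j.
Proof.
move=> ap ap' e j j0; have um := merge_ultrametric ap.
apply: (elder_at_unique um _ (merge_par_elder ap j0)); last first.
  by rewrite e; exact: merge_par_elder.
apply: (ultra_trans um (j := j)); first by rewrite merge_sym// merge_par.
by rewrite e merge_par.
Qed.

(** The parent of [j] has to be the elder at the height [d j]. Its bar is still alive there, which
    forces a smaller index, and the recursion for [merge_height] then follows from the ultrametric
    inequality once [d i] is known to be a lower bound. *)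
Lemma merge_height_exists (m : 'I_N -> 'I_N -> R) : ultrametric m ->
  has_elders m -> (forall j, m j j = b j) ->
  (forall (j : 'I_N) t, b j <= t -> elder_at m j t <-> ((0 < j)%N -> t < d j)) ->
  exists2 par, admissible par & m = merge_height par.
Proof.
move=> um he mb el.
have pex (j : 'I_N) : exists p : 'I_N, (0 < j)%N ->
    m j p <= d j /\ elder_at m p (d j).
  have [j0|j0] := boolP (0 < j)%N; last by exists j.
  have [|p jp pe] := he j (d j); first by rewrite mb ltW// bd.
  by exists p.
have [par pP] := choice pex.
have bp (j : 'I_N) : (0 < j)%N -> b (par j) < b j.
  move=> j0; have [jp pe] := pP _ j0; rewrite -!mb; apply: pe.
    by rewrite (ultra_sym um).
  apply/eqP => e; have := pP _ j0; rewrite -e => -[_ /el].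
  by rewrite ltxx => /(_ (ltW (bd j0)) j0).
have bpd (j : 'I_N) : (0 < j)%N -> b (par j) <= d j.
  by move=> j0; exact/ltW/(lt_trans (bp _ j0))/bd.
have ap : admissible par.
  move=> j j0; split; last exact: bp.
  have [jp pe] := pP _ j0; rewrite ltnNge leq_eqVlt; apply/negP => /orP[/eqP/val_inj e|lt].
    by have := bp _ j0; rewrite -e ltxx.
  have p0 : (0 < par j)%N by exact: ltn_trans lt.
  have := (el _ _ (bpd _ j0)).1 pe p0.
  by move=> /lt_trans/(_ (dd j0 lt)); rewrite ltxx.
exists par => //; apply/funext => i; apply/funext => j.
suff gt : forall i' j' : 'I_N, (j' < i')%N -> m i' j' = merge_height par i' j'.
  case: (ltngtP i j) => [ij|ji|/val_inj->]; last by rewrite mb merge_refl.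
    by rewrite (ultra_sym um) (merge_sym ap) gt.
  exact: gt.
move=> {}i {}j; have [k] := ubnP (i + j).
elim: k i j => // k IH i j ijk ji; have i0 := leq_ltn_trans (leq0n _) ji.
have [ip pe] := pP _ i0; have lt := (ap _ i0).1.
rewrite (merge_gt ap ji).
have -> : merge_height par (par i) j = m (par i) j.
  case: (ltngtP (par i) j) => [pj|jp|/val_inj->]; last by rewrite mb merge_refl.
    by rewrite (ultra_sym um) (merge_sym ap) IH//; lia.
  by rewrite IH//; lia.
(* If the branches met before the death of [i], both leaves would be elders at the meeting point. *)
have dm : d i <= m i j.
  rewrite leNgt; apply/negP => md.
  have im : b i <= m i j by rewrite -mb (ultra_birth um).
  have jm : b j <= m i j by rewrite -mb (ultra_birthr um).
  have ie := (el _ _ im).2 (fun _ => md).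
  have je : elder_at m j (m i j).
    by apply/el => // j0; exact: lt_trans md (dd j0 ji).
  by move: ji; rewrite (elder_at_unique um _ ie je)// ltnn.
apply/le_anti/andP; split.
  rewrite le_max; have := ultra_le um i (par i) j; rewrite le_max => /orP[mi|->].
    by rewrite (le_trans mi ip).
  by rewrite orbT.
rewrite ge_max dm /=; apply: (ultra_trans um (j := i)) => //.
by rewrite (ultra_sym um) (le_trans ip dm).
Qed.

End MergeHeights.

(** * The space with given merge heights *)

Section TreeSpace.
Context {R : realType} {n : nat} (m : 'I_n -> 'I_n -> R).

(* A point is given by its height t and the set of the leaves whose branches
   pass through it. *)
Definition is_tree_point (p : R * {set 'I_n}) : Prop :=
  exists i, m i i <= p.1 /\ p.2 = finset (fun j => m i j <= p.1).

Definition tree_space := {p : R * {set 'I_n} | `[< is_tree_point p >]}.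

HB.instance Definition _ := gen_eqMixin tree_space.
HB.instance Definition _ := gen_choiceMixin tree_space.

Lemma tree_point_subproof i t : `[< is_tree_point
  (Num.max t (m i i), finset (fun j => m i j <= Num.max t (m i i))) >].
Proof. by apply/asboolP; exists i; rewrite le_max lexx orbT. Qed.

Definition tree_point (i : 'I_n) (t : R) : tree_space :=
  exist (fun p => `[< is_tree_point p >]) _ (tree_point_subproof i t).

(** The final topology with respect to the rays, as [pr_open] demands. *)
Definition tree_open (U : set tree_space) : Prop :=
  forall i, open (tree_point i @^-1` U).

Lemma tree_openT : tree_open setT.
Proof. by move=> i; exact: openT. Qed.

Lemma tree_openI : setI_closed tree_open.
Proof. by move=> U V oU oV i; rewrite preimage_setI; exact: openI (oU i) (oV i). Qed.

Lemma tree_open_bigU (J : Type) (F : J -> set tree_space) :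
  (forall j, tree_open (F j)) -> tree_open (\bigcup_j F j).
Proof. by move=> oF i; rewrite preimage_bigcup; apply: bigcup_open => j _; exact: oF. Qed.

HB.instance Definition _ := isOpenTopological.Build tree_space
  tree_openT tree_openI tree_open_bigU.

Definition tree_height (x : tree_space) : R := (sval x).1.

Lemma tree_space_presented : ultrametric m ->
  presented tree_height m tree_point.
Proof.
move=> um; split=> //.
- by move=> i t ti; apply: eq_exist; rewrite (max_r ti) maxxx.
- move=> [[t A] xP]; have := xP => /asboolP[i [/= it AE]]; exists i.
  by apply: eq_exist; rewrite /tree_height /= max_l// AE.
- move=> i j t it jt; split=> [e|ij].
    have := congr1 (fun x : tree_space => j \in (sval x).2) e.
    by rewrite /= !inE !max_l// jt => ->.
  apply: eq_exist; rewrite !max_l//; congr pair; apply/setP => k; rewrite !inE.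
  by apply/idP/idP; apply: (ultra_trans um); rewrite // (ultra_sym um).
Qed.

End TreeSpace.

(** * Homeomorphisms of presented spaces *)

Section Homeomorphisms.
Context {R : realType}.

(** Points are transported along rays; the choice of the ray does not matter because [m] governs the
    identifications in both spaces. *)
Lemma presented_homeo (n : nat) (m : 'I_n -> 'I_n -> R)
    (X Y : topologicalType) (h : X -> R) (k : Y -> R) u v :
  ultrametric m -> presented h m u -> presented k m v ->
  exists (f : X -> Y) (g : Y -> X), [/\ continuous f, continuous g,
    cancel f g, cancel g f & forall i t, f (u i t) = v i t].
Proof.
move=> um.
have map (X' Y' : topologicalType) (h' : X' -> R) (k' : Y' -> R) u' v' :
    presented h' m u' -> presented k' m v' ->
    exists2 f : X' -> Y', continuous f & forall i t, f (u' i t) = v' i t.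
  move=> prX prY.
  have fex x : exists y : Y', exists i, [/\ m i i <= h' x, u' i (h' x) = x &
      y = v' i (h' x)].
    by have [i [ix ui]] := pr_leaf prX x; exists (v' i (h' x)), i.
  have [f fP] := choice fex.
  have fE i t : f (u' i t) = v' i t.
    rewrite -(pr_clamp prX) -(pr_clamp prY).
    have it : m i i <= Num.max t (m i i) by rewrite le_max lexx orbT.
    have [j []] := fP (u' i (Num.max t (m i i))).
    rewrite (pr_heightE prX)// => jt /(pr_eqP prX)[]// _ ij ->.
    exact: (pr_eqT um prY).
  exists f => //; apply/continuousP => U oU; apply/(pr_open prX) => i.
  rewrite -comp_preimage; have -> : f \o u' i = v' i by apply/funext => t /=.
  exact: ((pr_open prY U).1 oU).
move=> prX prY; have [f cf fE] := map _ _ _ _ _ _ prX prY.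
have [g cg gE] := map _ _ _ _ _ _ prY prX.
exists f, g; split=> // x.
  by have [i [_ <-]] := pr_leaf prX x; rewrite fE gE.
by have [i [_ <-]] := pr_leaf prY x; rewrite gE fE.
Qed.

(** A continuous map over [R] carries the path rising from a leaf into a sublevel set, so the images
    of its two ends lie on a common ray; thus rays go into rays. Applied to [f] and to its inverse,
    this gives mutually inverse maps between the leaves. *)
Lemma homeo_presented (n : nat) (m m' : 'I_n -> 'I_n -> R)
    (X Y : topologicalType) (h : X -> R) (k : Y -> R) u v (f : X -> Y) (g : Y -> X) :
  ultrametric m -> ultrametric m' -> presented h m u -> presented k m' v ->
  continuous f -> continuous g -> cancel f g -> cancel g f ->
  (forall x, k (f x) = h x) ->
  exists pi : 'I_n -> 'I_n, [/\ bijective pi,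
    forall i j, m' (pi i) (pi j) = m i j &
    forall i t, f (u i t) = v (pi i) t].
Proof.
move=> um um' prX prY cf cg fK gK fh.
have gh y : h (g y) = k y by rewrite -fh gK.
have map (X' Y' : topologicalType) (h' : X' -> R) (k' : Y' -> R) m1 m2 u' v'
    (f' : X' -> Y') : ultrametric (n := n) m1 -> ultrametric (n := n) m2 ->
    presented h' m1 u' -> presented k' m2 v' -> continuous f' ->
    (forall x, k' (f' x) = h' x) ->
    forall i, exists j, m2 j j <= m1 i i /\
      forall t, m1 i i <= t -> f' (u' i t) = v' j t.
  move=> um1 um2 pr1 pr2 cf' fh' i.
  have [j [jt vj]] := pr_leaf pr2 (f' (u' i (m1 i i))).
  rewrite fh' (pr_heightE pr1)// in jt vj; exists j; split=> // t it.
  have [l [lt vl]] := pr_leaf pr2 (f' (u' i t)).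
  rewrite fh' (pr_heightE pr1)// in lt vl.
  have : path_joined (R := R) (sublevel k' t) (v' j (m1 i i)) (v' l t).
    rewrite vj vl; have [c [cc c0 c1 ct]] := path_joined_up pr1 (lexx (m1 i i)) it.
    exists (f' \o c); split; rewrite /= ?c0 ?c1//.
      move/subspace_continuousP : cc => cc; apply/subspace_continuousP => s s01.
      exact: cvg_comp (cc s s01) (cf' _).
    by move=> s /ct; rewrite /sublevel /= fh'.
  move=> /(path_joinedP um2 pr2 jt lt it (lexx _)) jl.
  by rewrite -vl; apply/esym/(pr_eqT um2 pr2).
have [pi piP] := choice (map _ _ _ _ _ _ _ _ _ um um' prX prY cf fh).
have [ro roP] := choice (map _ _ _ _ _ _ _ _ _ um' um prY prX cg gh).
have piK : cancel pi ro.
  move=> i; apply: (leaf_unique um); have [pii pif] := piP i; have [_ rof] := roP (pi i).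
  have [] // := pr_eqP prX (i := ro (pi i)) (j := i) (s := m i i) (t := m i i).
    exact: le_trans (roP (pi i)).1 pii.
  by rewrite -rof// -pif// fK.
have roK : cancel ro pi.
  move=> i; apply: (leaf_unique um'); have [roi rof] := roP i; have [_ pif] := piP (ro i).
  have [] // := pr_eqP prY (i := pi (ro i)) (j := i) (s := m' i i) (t := m' i i).
    exact: le_trans (piP (ro i)).1 roi.
  by rewrite -pif// -rof// gK.
have mpi i : m' (pi i) (pi i) = m i i.
  apply/le_anti; rewrite (piP i).1 /=; have := (roP (pi i)).1.
  by rewrite piK.
have fE i t : f (u i t) = v (pi i) t.
  have [it|/ltW ti] := leP (m i i) t; first exact: (piP i).2.
  by rewrite (pr_below prX ti) (pr_below prY) mpi//; exact: (piP i).2.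
exists pi; split=> //; first by exists ro.
move=> i j; apply/le_anti/andP; split.
  apply/(pr_eq prY); rewrite ?mpi ?(ultra_birth um)// ?(ultra_birthr um)//.
  by rewrite -!fE (pr_eqT um prX (lexx _)).
have b1 : m i i <= m' (pi i) (pi j) by rewrite -mpi (ultra_birth um').
have b2 : m j j <= m' (pi i) (pi j) by rewrite -mpi (ultra_birthr um').
apply/(pr_eq prX) => //; apply: (can_inj fK).
by rewrite !fE (pr_eqT um' prY (lexx _)).
Qed.

End Homeomorphisms.

Section RealLemmas.
Context {R : realType}.

Lemma inj_no_min (f : R -> R) a c b : a < c -> c < b ->
  {within `[a, b], continuous f} -> {in `[a, b] &, injective f} ->
  f c <= f a -> f c <= f b -> False.
Proof.
move=> ac cb cf fi ca cb'.
have ab := lt_trans ac cb.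
have [[le_ab]|[le_ba]] : (f a <= f b) \/ (f b <= f a).
  by case: (leP (f a) (f b)) => [|/ltW]; [left|right].
- have [||r] := @IVT R f c b (f a) (ltW cb).
    apply: continuous_subspaceW cf => r /=; rewrite !in_itv /= => /andP[cr ->].
    by rewrite (le_trans (ltW ac) cr).
    by rewrite ge_min ca /= le_max le_ab orbT.
  rewrite in_itv /= => /andP[cr rb] /fi; rewrite !in_itv /= lexx (ltW ab) rb.
  rewrite (le_trans (ltW ac) cr) => /(_ isT isT) ra.
  by move: (lt_le_trans ac cr); rewrite ra ltxx.
- have [||r] := @IVT R f a c (f b) (ltW ac).
    apply: continuous_subspaceW cf => r /=; rewrite !in_itv /= => /andP[-> rc].
    by rewrite (le_trans rc (ltW cb)).
    by rewrite ge_min cb' orbT /= le_max le_ba.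
  rewrite in_itv /= => /andP[ar rc] /fi; rewrite !in_itv /= lexx (ltW ab) ar.
  rewrite (le_trans rc (ltW cb)) => /(_ isT isT) rb.
  by move: (le_lt_trans rc cb); rewrite rb ltxx.
Qed.

End RealLemmas.

(** * Paths, compactness and contractibility of presented spaces *)

Section PresentedTopology.
Context {R : realType} {n : nat} (m : 'I_n -> 'I_n -> R) (X : topologicalType)
  (h : X -> R) (u : 'I_n -> R -> X).
Hypotheses (um : ultrametric m) (pr : presented h m u).

(** These are the leaves, for [i = j], and the merge points, for distinct [i] and [j]. *)
Definition singular : set X := [set x | exists i j, x = u i (m i j)].

Lemma singularP i t : m i i <= t -> singular (u i t) <-> exists k, t = m i k.
Proof.
move=> it; split=> [[a [b /esym e]]|[k ->]]; last by exists i, k.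
have [te ai] := pr_eqP pr (ultra_birth um a b) it e.
have [eq|lt] : m i a = t \/ m i a < t.
  by move: ai; rewrite (ultra_sym um) le_eqVlt => /orP[/eqP|]; [left|right].
  by exists a.
by exists b; rewrite -te in lt *; rewrite (ultra_eq um lt).
Qed.

Lemma gap_above i t : (forall k, m i k <= t) \/
  exists k, t < m i k /\ forall l, m i l <= t \/ m i k <= m i l.
Proof.
have [[k tk]|no] := pselect (exists k, t < m i k); last first.
  by left=> k; rewrite leNgt; apply/negP => tk; apply: no; exists k.
right; case: (@arg_minP _ _ _ k (fun k => t < m i k) (m i) tk) => l tl lmin.
by exists l; split=> // r; case: (leP (m i r) t) => [|/lmin]; [left|right].
Qed.

Lemma gap_below i (Q : R -> Prop) : Q (m i i) ->
  exists k, Q (m i k) /\ forall l, Q (m i l) -> m i l <= m i k.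
Proof.
move=> Qi; have [|t [/mapP[k _ ->] Qk kmax]] := @seq_max R [seq m i k | k : 'I_n] Q.
  by exists (m i i) => //; apply/mapP; exists i; rewrite ?mem_enum.
exists k; split=> // l Ql; apply: kmax => //.
by apply/mapP; exists l; rewrite ?mem_enum.
Qed.

Lemma gap_right i t : exists2 r, t < r & forall k, m i k <= t \/ r <= m i k.
Proof.
have [all|[k [tk gap]]] := gap_above i t; last by exists (m i k).
by exists (t + 1) => [|k]; [rewrite ltrDl|left].
Qed.

Lemma pr_range_closed i : closed (range (u i)).
Proof.
apply/(pr_closed pr) => k; have [->|ki] := eqVneq k i.
  rewrite (_ : _ @^-1` _ = setT); first exact: closedT.
  by apply/seteqP; split=> // t _; exists t.
rewrite (_ : _ @^-1` _ = `[m i k, +oo[%classic); first exact: interval_closed.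
have kik : m k k < m i k by rewrite (ultra_sym um) (ultra_lt um).
apply/seteqP; split=> t /=; rewrite in_itv /= andbT.
  move=> [s _ /esym/(pr_clamp_eq2 um pr)[-> ik]].
  by move: ik; rewrite le_max => /orP[//|]; rewrite leNgt kik.
by move=> ikt; exists t => //; exact: (pr_eqT um pr).
Qed.

Lemma pr_open_sublevel i t r : t < r -> (forall k, m i k <= t \/ r <= m i k) ->
  open [set x | exists k s, [/\ m i k <= t, s < r & u k s = x]].
Proof.
move=> tr gap; apply/(pr_open pr) => k.
have [kt|rk] := gap k.
  rewrite (_ : _ @^-1` _ = `]-oo, r[%classic); first exact: interval_open.
  apply/seteqP; split=> s /=; rewrite in_itv /=; last by move=> sr; exists k, s.
  move=> [l [v [lt vr /(congr1 h)]]]; rewrite !(pr_height pr) => e.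
  apply: (@le_lt_trans _ _ (Num.max s (m k k))); first by rewrite le_max lexx.
  rewrite -e gt_max vr /= (le_lt_trans _ tr)//.
  by apply: le_trans lt; exact: (ultra_birthr um).
rewrite (_ : _ @^-1` _ = set0); first exact: open0.
apply/seteqP; split=> // s [l [v [lt vr /esym/(pr_clamp_eq2 um pr)[_ lk]]]].
have llt : m l l <= t by apply: le_trans lt; exact: (ultra_birthr um).
have lkr : m l k < r by apply: le_lt_trans lk _; rewrite gt_max vr (le_lt_trans llt tr).
have ikr : m i k < r.
  apply: le_lt_trans (ultra_le um i l k) _.
  by rewrite gt_max lkr (le_lt_trans lt tr).
by move: rk; rewrite leNgt ikr.
Qed.

(** Several branches may arrive at [y] from below, but only one leaves it upwards, and no further
    branch joins before the height [r]. *)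
Lemma up_nbhs y : exists i, [/\ m i i <= h y, u i (h y) = y &
  \forall x \near y, h y <= h x -> u i (h x) = x].
Proof.
have [i [iy ui]] := pr_leaf pr y; exists i; split=> //.
have [r tr gap] := gap_right i (h y).
have oV := pr_open_sublevel tr gap.
near=> x => yx.
have [k [s [kt sr xE]]] : exists k s, [/\ m i k <= h y, s < r & u k s = x].
  near: x; apply: (open_nbhs_nbhs (conj oV _)).
  by exists i, (h y); split.
have kk : m k k <= h y by apply: le_trans kt; exact: (ultra_birthr um).
rewrite -xE (pr_height pr) -(pr_clamp pr k s); apply: (pr_eqT um pr).
by rewrite -(pr_height pr) xE; exact: le_trans yx.
Unshelve. all: by end_near. Qed.

Variables (K : R) (i0 : 'I_n).
Hypothesis Kmax : forall i j, m i j <= K.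

Lemma pr_top i t : K <= t -> u i t = u i0 t.
Proof. by move=> Kt; apply: (pr_eqT um pr); exact: le_trans Kt. Qed.

(** If the height failed to increase, it would have a minimum at an interior parameter [c]. Near [c]
    the path stays on the single ray above [g c], so the height would be injective there, which
    [inj_no_min] excludes. *)
Lemma increasing_path (g : R -> X) : {within `[0, 1], continuous g} ->
  (forall s t, 0 <= s <= 1 -> 0 <= t <= 1 -> g s = g t -> s = t) ->
  h (g 0) <= K -> g 1 = u i0 K ->
  forall s t, 0 <= s -> s < t -> t <= 1 -> h (g s) < h (g t).
Proof.
move=> cg gi g0 g1.
have cf : {within `[0, 1], continuous (h \o g)}.
  move/subspace_continuousP : cg => cg; apply/subspace_continuousP => s s01.
  have ch := pr_height_continuous pr.
  exact: cvg_comp (cg s s01) (ch _).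
have h1 : h (g 1) = K by rewrite g1 (pr_heightE pr).
have fiber s : h (g s) = K -> g s = g 1.
  by move=> hs; have [i [_ <-]] := pr_leaf pr (g s); rewrite hs g1 pr_top.
(* A path rising above [K] would first pass through the only point of that height, which is
   [g 1]. *)
have le_K s : 0 <= s <= 1 -> h (g s) <= K.
  move=> /andP[s0 s1]; rewrite leNgt; apply/negP => Ks.
  have [||c] := @IVT R (h \o g) 0 s K s0.
    apply: continuous_subspaceW cf => r /=; rewrite !in_itv /= => /andP[-> rs].
    exact: le_trans s1.
    by rewrite /= ge_min g0 /= le_max (ltW Ks) orbT.
  rewrite in_itv /= => /andP[c0 cs] /fiber/gi.
  rewrite c0 (le_trans cs s1) ler01 lexx => /(_ isT isT) c1.
  have s1' : s = 1 by apply/le_anti; rewrite s1 -c1.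
  by move: Ks; rewrite s1' h1 ltxx.
move=> s t s0 st t1; rewrite ltNge; apply/negP => ts.
have t0 : 0 <= t by exact: le_trans s0 (ltW st).
have s1 : s <= 1 by exact: le_trans (ltW st) t1.
have tlt : t < 1.
  rewrite lt_neqAle t1 andbT; apply/eqP => te; move: ts; rewrite te h1 => sK.
  have /fiber/gi : h (g s) = K by apply/le_anti; rewrite sK le_K ?s0.
  by rewrite s0 s1 ler01 lexx => /(_ isT isT) e; move: st; rewrite te e ltxx.
(* A minimum over [[s, 1]] that falls on one of the ends can be moved to [t], which is at most as
   high as [g s] and as [g 1]. *)
have [c [sc c1 cmin]] : exists c, [/\ s < c, c < 1 &
    forall r, s <= r <= 1 -> h (g c) <= h (g r)].
  have [|c] := @EVT_min R (h \o g) s 1 s1.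
    apply: continuous_subspaceW cf => r /=; rewrite !in_itv /= => /andP[sr ->].
    by rewrite (le_trans s0 sr).
  rewrite in_itv /= => /andP[sc c1] cmin.
  have {}cmin r : s <= r <= 1 -> h (g c) <= h (g r) by move=> sr; apply: cmin; rewrite in_itv.
  have tmin : h (g t) <= h (g c) -> forall r, s <= r <= 1 -> h (g t) <= h (g r).
    by move=> tc r sr; exact: le_trans tc (cmin r sr).
  have [cs|cs] := eqVneq c s; first by exists t; split=> //; apply: tmin; rewrite cs.
  have [ce|ce] := eqVneq c 1.
    by exists t; split=> //; apply: tmin; rewrite ce h1 le_K// t0.
  by exists c; split=> //; rewrite lt_neqAle ?sc ?c1 ?ce ?andbT// eq_sym.
have [i [ic ui near_up]] := up_nbhs (g c).
have c0 : 0 < c by exact: le_lt_trans s0 sc.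
have : \forall r \near c, s < r /\ r < 1 /\ g r = u i (h (g r)).
  have gc : g r @[r --> c] --> g c.
    move/subspace_continuousP : cg => /(_ c).
    rewrite /= in_itv /= (ltW c0) (ltW c1) => /(_ isT).
    rewrite within_interior//; apply: filterS2 (lt_nbhsr c0) (lt_nbhsl c1) => r.
    by move=> /ltW r0 /ltW r1; rewrite /= in_itv /= r0.
  near=> r; have sr : s < r by near: r; exact: lt_nbhsr.
  have r1 : r < 1 by near: r; exact: lt_nbhsl.
  split=> //; split=> //; apply/esym.
  have : h (g c) <= h (g r) by apply: cmin; rewrite (ltW sr) (ltW r1).
  by near: r; exact: (gc _ near_up).
move=> /nbhs_ballP[e /= e0 ball_e].
have e2 : e / 2 < e by rewrite ltr_pdivrMr// ltr_pMr// ltr1n.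
have e20 : 0 < e / 2 by rewrite divr_gt0.
have near_c r : c - e / 2 <= r <= c + e / 2 -> s < r /\ r < 1 /\ g r = u i (h (g r)).
  move=> cr; apply: ball_e; rewrite /ball /= distrC; apply: le_lt_trans e2.
  by rewrite ler_distl.
apply: (@inj_no_min R (h \o g) (c - e / 2) c (c + e / 2)).
- by rewrite ltrBlDr ltrDl.
- by rewrite ltrDl.
- apply: continuous_subspaceW cf => r /=; rewrite !in_itv /= => /near_c[sr [r1 _]].
  by rewrite (le_trans s0 (ltW sr)) ltW.
- move=> p q; rewrite !in_itv /= => /near_c[sp [p1 gp]] /near_c[sq [q1 gq]] e'.
  apply: gi; last by rewrite gp gq; congr u.
    by rewrite (le_trans s0 (ltW sp)) ltW.
  by rewrite (le_trans s0 (ltW sq)) ltW.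
- have [|sr [r1 _]] := near_c (c - e / 2); last by apply: cmin; rewrite (ltW sr) (ltW r1).
  rewrite lexx /= lerD2l; apply: le_trans (ltW e20); by rewrite oppr_le0 ltW.
- have [|sr [r1 _]] := near_c (c + e / 2); last by apply: cmin; rewrite (ltW sr) (ltW r1).
  rewrite lexx andbT lerD2l; apply: le_trans (ltW e20); by rewrite oppr_le0 ltW.
Unshelve. all: by end_near. Qed.

Lemma pr_connected (D : set R) : connected D -> D K ->
  connected (\bigcup_i (u i @` D)).
Proof.
move=> cD DK; apply: bigcup_connected.
  by exists (u i0 K) => i _; exists K => //; rewrite pr_top.
move=> i _; apply: connected_continuous_connected cD _.
by apply: continuous_subspaceT; exact: (pr_continuous pr).
Qed.

Lemma presented_connected : connected [set: X].
Proof.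
rewrite (_ : [set: X] = \bigcup_i (u i @` setT)).
  by apply: pr_connected => //; apply/connected_intervalP.
apply/seteqP; split=> // x _; have [i [_ <-]] := pr_leaf pr x.
by exists i => //; exists (h x).
Qed.

Lemma sublevel_bigcup : sublevel h K = \bigcup_i (u i @` `]-oo, K]).
Proof.
apply/seteqP; split=> [x xK|x [i _ [t]]].
  have [i [_ ui]] := pr_leaf pr x; exists i => //; exists (h x) => //.
rewrite /= in_itv /= => tK <-; rewrite /sublevel /= (pr_height pr) ge_max tK /=.
exact: Kmax.
Qed.

Lemma sublevel_connected : connected (sublevel h K).
Proof.
rewrite sublevel_bigcup; apply: pr_connected; last by rewrite /= in_itv /=.
apply/connected_intervalP => x y /=; rewrite !in_itv /= => xK yK z /andP[_].
by move=> zy; exact: le_trans yK.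
Qed.

Lemma sublevel_compact : compact (sublevel h K).
Proof.
have -> : sublevel h K = \big[setU/set0]_(i <- enum 'I_n) (u i @` `[m i i, K]).
  rewrite -bigcup_seq; apply/seteqP; split=> [x xK|x [i _ [t]]].
    have [i [ix ui]] := pr_leaf pr x; exists i; first by rewrite /= mem_enum.
    by exists (h x) => //; rewrite /= in_itv /= ix; exact: xK.
  by rewrite /= in_itv /= => /andP[it tK] <-; rewrite /sublevel /= (pr_heightE pr).
apply: bigsetU_compact => i _; apply: continuous_compact.
  by apply: continuous_subspaceT; exact: (pr_continuous pr).
exact: segment_compact.
Qed.

(* All points flow up to the height K, or down to it along the ray above. *)
Lemma presented_contractible : contractible (R := R) X.
Proof.
have [lf lfP] := choice (pr_leaf pr).
pose H (p : X * R) := u (lf p.1) ((1 - p.2) * h p.1 + p.2 * K).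
(* The value of [H] does not depend on the leaf chosen by [lf], so on each ray it is given by one
   formula. *)
have above i x s : u i (h x) = x -> m i i <= h x -> 0 <= s <= 1 ->
    H (x, s) = u i ((1 - s) * h x + s * K).
  move=> ui ix /andP[s0 s1]; rewrite /H /=; have [lx ul] := lfP x.
  have li : m (lf x) i <= h x by apply/(pr_eq pr) => //; rewrite ul ui.
  case: (leP (h x) K) => [xK|/ltW Kx].
    apply: (pr_eqT um pr); apply: le_trans li _.
    by nra.
  by rewrite !pr_top//; nra.
exists (u i0 K), H; split; last first.
- by move=> x; rewrite /H /= subrr mul0r add0r mul1r pr_top.
- by move=> x; rewrite /H /= subr0 mul1r mul0r addr0; have [] := lfP x.
apply/subspace_continuousP => -[x s] [/= _]; rewrite in_itv /= => s01 V HV.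
(* Continuity is tested on each of the finitely many closed rays: one that misses [x] is avoided
   near [x], and on the others [H] agrees with the continuous map [G]. *)
have half i : \forall p \near (x, s), range (u i) p.1 -> 0 <= p.2 <= 1 -> V (H p).
  have [ix|nix] := pselect (range (u i) x); last first.
    have : \forall p \near (x, s), (~` range (u i)) p.1.
      apply: (@cvg_fst _ _ (nbhs x) (nbhs s)); apply: open_nbhs_nbhs; split=> //.
      by rewrite openC; exact: pr_range_closed.
    by apply: filterS => p.
  have hi y : range (u i) y -> u i (h y) = y /\ m i i <= h y.
    by move=> [t _ <-]; rewrite (pr_height pr) (pr_clamp pr) le_max lexx orbT.
  pose G (p : X * R) := u i ((1 - p.2) * h p.1 + p.2 * K).
  have cG : {for (x, s), continuous G}.
    apply: (@continuous_comp _ _ _ (fun p : X * R => (1 - p.2) * h p.1 + p.2 * K) (u i));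
      last exact: (pr_continuous pr).
    have ch : {for (x, s), continuous (h \o fst : X * R -> R)}.
      apply: continuous_comp; first exact: cvg_fst.
      exact: (pr_height_continuous pr).
    have cs : {for (x, s), continuous (snd : X * R -> R)} by exact: cvg_snd.
    apply: cvgD; apply: cvgM => //; last exact: cvg_cst.
    by apply: cvgB => //; exact: cvg_cst.
  have := cG V; rewrite /nbhs /= -/(nbhs _).
  have [ux xi] := hi x ix; rewrite /G /= -(above i x s) // => /(_ HV).
  apply: filterS => -[y r] /= Vy iy r01.
  by have [uy yi] := hi y iy; rewrite (above i y r).
have := filter_forall (nbhs_filter (x, s)) half; apply: filterS => -[y r] Vy [_ /=].
rewrite in_itv /= => r01; have [_ uy] := lfP y.
by apply: (Vy (lf y)) => //=; exists (h y).
Qed.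

End PresentedTopology.

(** * The chiral merge tree with given merge heights *)

Section PresentedTree.
Context {R : realType} {n : nat} (m : 'I_n -> 'I_n -> R) (X : topologicalType)
  (h : X -> R) (u : 'I_n -> R -> X).
Hypotheses (um : ultrametric m) (pr : presented h m u).
Context (a c : 'I_n) (Kmax : forall i j, m i j <= m a c).
Local Notation K := (m a c).
Local Notation singular := (singular m u).

(* An edge is represented by its lower end. *)
Definition low_point := {x : X | `[< singular x >]}.

HB.instance Definition _ := Choice.on low_point.

Definition low (e : low_point) : X := proj1_sig e.

Lemma low_inj : injective low.
Proof. by move=> [x xP] [y yP] /= xy; exact: eq_exist. Qed.

Lemma top_low : `[< singular (u a K) >].
Proof. by apply/asboolP; exists a, c. Qed.

Definition top_edge : low_point := exist (fun x => `[< singular x >]) _ top_low.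

(** The second component is the length of the edge; for the top edge, which has no upper end, it is
    only a scale and is set to 1. *)
Lemma low_point_branch (e : low_point) : exists p : 'I_n * R,
  [/\ m p.1 p.1 <= h (low e), u p.1 (h (low e)) = low e, 0 < p.2,
    e = top_edge -> forall k, m p.1 k <= h (low e) &
    e <> top_edge -> (exists j, h (low e) + p.2 = m p.1 j) /\
      forall k, m p.1 k <= h (low e) \/ h (low e) + p.2 <= m p.1 k].
Proof.
have [i [ie ui]] := pr_leaf pr (low e).
have [all|[k [ek gap]]] := gap_above m i (h (low e)).
  exists (i, 1); split=> //= ne; exfalso; apply: ne; apply: low_inj => /=.
  have Ke : K <= h (low e).
    by apply: (ultra_trans um (j := i)) => //; rewrite (ultra_sym um).
  have eK : h (low e) <= K.
    have /asboolP[j [l eE]] : `[< singular (low e) >] := proj2_sig e.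
    by rewrite eE (pr_heightE pr) ?(ultra_birth um).
  rewrite -ui (pr_top um pr a Kmax _ Ke); congr u.
  by apply/le_anti; rewrite eK.
exists (i, m i k - h (low e)); split=> //=; first by rewrite subr_gt0.
  move=> eE; exfalso; move: ek; rewrite eE /low /= (pr_heightE pr) ?(ultra_birth um)//.
  by rewrite ltNge Kmax.
by move=> _; rewrite addrC subrK; split=> //; exists k.
Qed.

Definition low_branch := projT1 (choice low_point_branch).
Definition el (e : low_point) : 'I_n := (low_branch e).1.
Definition bot (e : low_point) : R := h (low e).
Definition len (e : low_point) : R := (low_branch e).2.
Definition top (e : low_point) : R := bot e + len e.

Lemma low_branchP e : [/\ m (el e) (el e) <= bot e, u (el e) (bot e) = low e,
  0 < len e, e = top_edge -> forall k, m (el e) k <= bot e &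
  e <> top_edge -> (exists j, top e = m (el e) j) /\
    forall k, m (el e) k <= bot e \/ top e <= m (el e) k].
Proof. exact: (projT2 (choice low_point_branch)). Qed.

Lemma el_bot e : m (el e) (el e) <= bot e. Proof. by have [] := low_branchP e. Qed.
Lemma u_bot e : u (el e) (bot e) = low e. Proof. by have [] := low_branchP e. Qed.
Lemma len_gt0 e : 0 < len e. Proof. by have [] := low_branchP e. Qed.
Lemma bot_lt_top e : bot e < top e. Proof. by rewrite ltrDl len_gt0. Qed.

Lemma edge_gap e k : m (el e) k <= bot e \/ e <> top_edge /\ top e <= m (el e) k.
Proof.
have [_ _ _ all gap] := low_branchP e.
have [/all|ne] := pselect (e = top_edge); first by left.
by have [_ /(_ k)[]] := gap ne; [left|right].
Qed.

Lemma edge_top e : e <> top_edge -> exists j, top e = m (el e) j.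
Proof. by have [_ _ _ _ gap] := low_branchP e => /gap[]. Qed.

Lemma bot_top_edge : bot top_edge = K.
Proof. by rewrite /bot /low /= (pr_heightE pr)// (ultra_birth um). Qed.

Lemma bot_singular e : singular (low e).
Proof. exact/asboolP/(proj2_sig e). Qed.

Lemma low_point_of (x : X) : singular x -> exists e : low_point, low e = x :> X.
Proof. by move=> /asboolP sx; exists (exist (fun x => `[< singular x >]) x sx). Qed.

Lemma edge_inner e i t : m (el e) i <= bot e -> bot e < t ->
  (e <> top_edge -> t < top e) -> ~ singular (u i t).
Proof.
move=> ei et te; have it : m (el e) (el e) <= t by exact: le_trans (el_bot e) (ltW et).
rewrite -(pr_eqT um pr (le_trans ei (ltW et))) => /(singularP um pr it)[k tk].
have [|[ne]] := edge_gap e k; rewrite -tk leNgt ?et//.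
by rewrite te.
Qed.

(** If two distinct edges shared an inner point, the higher of their lower ends would be a singular
    point inside the other edge. *)
Lemma edge_meet e e' t : m (el e) (el e') <= t -> bot e < t -> bot e' < t ->
  (e <> top_edge -> t < top e) -> (e' <> top_edge -> t < top e') -> e = e'.
Proof.
wlog : e e' / bot e <= bot e' => [wl|ee' eet et e't te te'].
  case: (leP (bot e) (bot e')) => [|/ltW] ee' ? ? ? ? ?; first exact: wl.
  by apply/esym/wl => //; rewrite (ultra_sym um).
have ei : m (el e) (el e') <= bot e.
  have [//|[ne]] := edge_gap e (el e').
  by rewrite leNgt (le_lt_trans eet (te ne)).
have := ee'; rewrite le_eqVlt => /orP[/eqP ebe|lt].
  apply: low_inj; rewrite -u_bot -[RHS]u_bot -ebe; exact: (pr_eqT um pr).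
exfalso; apply: (edge_inner (e := e) (i := el e') (t := bot e')) => //.
  by move=> /te; exact: lt_trans.
rewrite u_bot; exact: bot_singular.
Qed.

(* Q cuts the branch i into a lower part and an upper one; the edge found is
   the one that contains the cut. *)
Lemma edge_below i (Q : R -> Prop) : Q (m i i) ->
  exists e, [/\ m i (el e) <= bot e, m i i <= bot e, Q (bot e) &
    e <> top_edge -> ~ Q (top e)].
Proof.
move=> Qi; have [k [Qk kmax]] := gap_below (Q := Q) Qi.
have [e eE] := low_point_of (ex_intro _ i (ex_intro _ k (erefl (u i (m i k))))).
have ik := ultra_birth um i k.
have be : bot e = m i k by rewrite /bot eE (pr_heightE pr).
have iel : m i (el e) <= bot e.
  apply/(pr_eq pr); rewrite ?be//; last by rewrite -be u_bot eE be.
  by rewrite -be el_bot.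
exists e; split; [exact: iel|by rewrite be|by rewrite be|].
move=> ne Qt; have [j tj] := edge_top ne.
have mij : m i j = top e.
  by rewrite tj; apply: (ultra_eq um); rewrite -tj (le_lt_trans iel)// bot_lt_top.
by have := bot_lt_top e; rewrite -mij be ltNge kmax// mij.
Qed.

Definition tree_char (e : low_point) (s : R) : X := u (el e) (bot e + s * len e).

Definition tree_of : tree_data (R := R) :=
  @TreeData R X singular low_point top_edge tree_char h.

Local Notation T := tree_of.

Lemma edge_domP (e : edge T) s :
  edge_dom e s <-> 0 <= s /\ (e <> top_edge -> s <= 1).
Proof.
rewrite /edge_dom; case: eqVneq => [->|/eqP ne] /=; rewrite in_itv /= ?andbT.
  by split=> [//|[]].
by split=> [/andP[]|[->] /(_ ne)].
Qed.

Lemma edge_interiorP (e : edge T) s :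
  edge_interior e s <-> 0 < s /\ (e <> top_edge -> s < 1).
Proof.
rewrite /edge_interior; case: eqVneq => [->|/eqP ne] /=; rewrite in_itv /= ?andbT.
  by split=> [//|[]].
by split=> [/andP[]|[->] /(_ ne)].
Qed.

Lemma el_le e s : 0 <= s -> m (el e) (el e) <= bot e + s * len e.
Proof.
by move=> s0; rewrite (le_trans (el_bot e))// lerDl mulr_ge0// ltW// len_gt0.
Qed.

Lemma height_char e s : 0 <= s -> h (tree_char e s) = bot e + s * len e.
Proof. by move=> s0; rewrite (pr_heightE pr)// el_le. Qed.

Lemma char0 e : tree_char e 0 = low e.
Proof. by rewrite /tree_char mul0r addr0 u_bot. Qed.

Lemma char1 e : tree_char e 1 = u (el e) (top e).
Proof. by rewrite /tree_char mul1r. Qed.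

Lemma cellP (e : edge T) y : cell e y <->
  exists t, [/\ u (el e) t = y, bot e < t & e <> top_edge -> t < top e].
Proof.
have l0 := len_gt0 e; split=> [[s /edge_interiorP[s0 s1] <-]|[t [<- et te]]].
  exists (bot e + s * len e); split=> //; first by rewrite ltrDl mulr_gt0.
  by move=> /s1 s1'; rewrite ltrD2l gtr_pMl.
exists ((t - bot e) / len e).
  apply/edge_interiorP; rewrite divr_gt0 ?subr_gt0//; split=> // /te tt.
  by rewrite ltr_pdivrMr// mul1r ltrBlDl.
rewrite /= /tree_char divfK ?gt_eqF//.
by rewrite addrC subrK.
Qed.

Lemma cell_branch (e : edge T) i t : m (el e) i <= bot e -> bot e < t ->
  (e <> top_edge -> t < top e) -> cell e (u i t).
Proof.
move=> ei et te; apply/cellP; exists t; split=> //.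
by apply: (pr_eqT um pr); rewrite (le_trans ei)// ltW.
Qed.

Lemma tree_char_piece (e : edge T) i (U : set X) :
  m i (el e) <= bot e -> m i i <= bot e ->
  open (tree_char e @^-1` U : set (subspace (edge_dom e))) ->
  open (u i @^-1` U : set (subspace
    [set t | edge_dom e ((t - bot e) / len e)])).
Proof.
move=> ie ib /open_subspaceP[V oV VE]; apply/open_subspaceP.
pose f t := (t - bot e) / len e.
exists (f @^-1` V).
  apply: open_comp => // t _; apply: cvgM; last exact: cvg_cst.
  by apply: cvgB; [exact: cvg_id|exact: cvg_cst].
have E t : edge_dom e (f t) -> tree_char e (f t) = u i t.
  move=> /edge_domP[f0 _]; rewrite /tree_char /f divfK ?gt_eqF ?len_gt0//.
  rewrite addrC subrK; apply: (pr_eqT um pr); rewrite (ultra_sym um).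
  apply: le_trans ie _; rewrite -subr_ge0.
  by move: f0; rewrite /f pmulr_lge0// invr_gt0 len_gt0.
apply/seteqP; split=> t [/= Ut ft]; split=> //.
  have : (V `&` edge_dom e) (f t) by split.
  by rewrite VE => -[/=]; rewrite E.
have : (tree_char e @^-1` U `&` edge_dom e) (f t) by split=> //=; rewrite E.
by rewrite -VE => -[].
Qed.

Lemma tree_of_complex : cell_complex T.
Proof.
split.
- by move=> e; rewrite /= char0; exact: bot_singular.
- move=> e /eqP ne; rewrite /= char1; have [j ->] := edge_top ne.
  by exists (el e), j.
- move=> e s t; rewrite !inE => /edge_interiorP[s0 _] /edge_interiorP[t0 _] /(congr1 h).
  rewrite /= !height_char ?ltW// => /addrI/mulIf; apply.
  by rewrite gt_eqF// len_gt0.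
- move=> e e' [y [/cellP[t [ty et te]] /cellP[t' [t'y et' te']]]].
  have [|||tt' ee'] := pr_eqP pr (i := el e) (j := el e') (s := t) (t := t').
  + by rewrite (le_trans (el_bot e))// ltW.
  + by rewrite (le_trans (el_bot e'))// ltW.
  + by rewrite ty t'y.
  by subst t'; exact: edge_meet ee' et et' te te'.
- move=> e; apply/seteqP; split=> // y [/= sy /cellP[t [ty et te]]].
  apply: (edge_inner (i := el e) _ et te); last by rewrite ty.
  exact: el_bot.
- apply/seteqP; split=> // y _; have [sy|ns] := pselect (singular y); first by left.
  right; have [i [iy ui]] := pr_leaf pr y.
  have [e [ie ib et ne]] := edge_below (Q := fun t => t <= h y) iy.
  exists e => //; rewrite -ui; apply: cell_branch; first by rewrite (ultra_sym um).
    rewrite lt_neqAle et andbT; apply/eqP => be; apply: ns.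
    rewrite -ui -be (pr_eqT um pr ie) u_bot; exact: bot_singular.
  by move=> /ne /negP; rewrite -ltNge.
- move=> U; split=> [oU e|oU].
    apply: open_subspaceW; rewrite /= (_ : _ @^-1` _ =
      (fun s => bot e + s * len e) @^-1` (u (el e) @^-1` U))//.
    apply: open_comp; last exact: ((pr_open pr U).1 oU).
    move=> s _; apply: cvgD; first exact: cvg_cst.
    by apply: cvgM; [exact: cvg_id|exact: cvg_cst].
  apply/(pr_open pr) => i; apply: (open_pieces (b := m i i)).
  + by move=> t ti /=; rewrite (pr_below pr ti).
  (* The cuts [r <= t] here and [r < t] below select the edges of the branch that continue from the
     height [t] upwards and downwards. *)
  + move=> t it; have [e [ie ib et ne]] := edge_below (Q := fun r => r <= t) it.
    have l0 := len_gt0 e.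
    exists [set s | @edge_dom R T e ((s - bot e) / len e)]; split.
    * exact: tree_char_piece.
    * apply/edge_domP; rewrite divr_ge0 ?subr_ge0 ?(ltW l0)//; split=> // /ne/negP.
      by rewrite -ltNge => /ltW tt; rewrite ler_pdivrMr// mul1r lerBlDl.
    * have [ee|nee] := pselect (e = top_edge).
        near=> s => ts; apply/edge_domP; split=> //.
        by rewrite divr_ge0 ?(ltW l0)// subr_ge0 (le_trans et).
      have : \forall s \near t, s < top e.
        by apply: lt_nbhsl; rewrite ltNge; exact/negP/ne.
      apply: filterS => s st ts; apply/edge_domP.
      rewrite divr_ge0 ?(ltW l0) ?subr_ge0 ?(le_trans et)//; split=> // _.
      by rewrite ler_pdivrMr// mul1r lerBlDl ltW.
  + move=> t it; have [e [ie ib et ne]] := edge_below (Q := fun r => r < t) it.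
    have l0 := len_gt0 e.
    have le_top s : s <= t -> e <> top_edge -> s <= top e.
      move=> st /ne/negP; rewrite -leNgt; exact: le_trans.
    exists [set s | @edge_dom R T e ((s - bot e) / len e)]; split.
    * exact: tree_char_piece.
    * apply/edge_domP; rewrite divr_ge0 ?subr_ge0 ?(ltW l0) ?(ltW et)//; split=> // /(le_top t).
      by rewrite ler_pdivrMr// mul1r lerBlDl; apply.
    * have : \forall s \near t, bot e < s by exact: lt_nbhsr.
      apply: filterS => s es st; apply/edge_domP.
      rewrite divr_ge0 ?(ltW l0) ?subr_ge0 ?(ltW es)//; split=> // /(le_top s st).
      by rewrite ler_pdivrMr// mul1r lerBlDl.
Unshelve. all: by end_near. Qed.

Definition high (e : low_point) : X := u (el e) (top e).

Lemma height_high e : h (high e) = top e.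
Proof. by rewrite (pr_heightE pr)// (le_trans (el_bot e))// ltW// bot_lt_top. Qed.

Lemma cell_top_edge y : cell (e_infty T) y <-> K < h y.
Proof.
split=> [/cellP[t [<- + _]]|Ky].
  rewrite bot_top_edge (pr_height pr) => Kt.
  by rewrite lt_max Kt.
have [i [iy <-]] := pr_leaf pr y; apply: cell_branch; rewrite ?bot_top_edge//.
Qed.

Lemma setC_cell_top_edge : ~` cell (e_infty T) = sublevel h K.
Proof.
apply/seteqP; split=> y /=; rewrite /sublevel /= leNgt.
  by move=> ny; apply/negP => /cell_top_edge.
by move=> /negP ny /cell_top_edge.
Qed.

Lemma v_infty_tree_of : v_infty T = u a K.
Proof. by rewrite /v_infty /= char0. Qed.

Lemma low_point_finite : finite_set [set: low_point].
Proof.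
pose f (p : 'I_n * 'I_n) : low_point :=
  exist (fun x => `[< singular x >]) (u p.1 (m p.1 p.2))
    (introT (asboolP _) (ex_intro _ p.1 (ex_intro _ p.2 erefl))).
have ff : finite_set (f @` setT) by apply: finite_image; exact: finite_finset.
apply: sub_finite_set ff => e _; have [i [j e_ij]] := bot_singular e.
by exists (i, j) => //; apply: low_inj; rewrite e_ij.
Qed.

Lemma joinsP (e : edge T) v w : joins e v w -> e <> top_edge /\
  ((v = low e /\ w = high e) \/ (v = high e /\ w = low e)).
Proof.
move=> [/eqP ne vw]; split=> //; move: vw; rewrite /= char0 char1.
by move=> [[<- <-]|[<- <-]]; [left|right].
Qed.

Definition degree (x : X) (p : seq low_point) : nat :=
  (count (fun e => low e == x) p + count (fun e => high e == x) p)%N.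

Lemma trail_parity v (p : seq (edge T)) w x : trail v p w ->
  odd (degree x p) = (v == x) (+) (w == x).
Proof.
elim: p v => [|e p IH] v /=; first by move=> ->; rewrite addbb.
move=> [y /joinsP[_ vy] yw].
have -> : degree x (e :: p) = ((low e == x) + (high e == x) + degree x p)%N.
  by rewrite /degree /=; lia.
rewrite oddD (IH _ yw) oddD !oddb.
have -> : (low e == x) (+) (high e == x) = (v == x) (+) (y == x).
  by case: vy => -[-> ->] //; rewrite addbC.
by rewrite -addbA addKb.
Qed.

(** By [trail_parity] every point has even degree in a closed trail. But the lowest of the lower
    ends of its edges has degree one, because an edge ending there from below would start lower
    still. *)
Lemma tree_of_acyclic : acyclic T.
Proof.
move=> v p tr up; case: p tr up => // e0 p0; set p := e0 :: p0 => tr up; exfalso.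
have [|t [/mapP[e ep ->] _ emax]] := @seq_max R [seq - bot e | e <- p] (fun=> True).
  by exists (- bot e0) => //; apply/mapP; exists e0; rewrite ?mem_head.
have := trail_parity (low e) tr; rewrite addbb /degree.
have -> : count (fun e' => low e' == low e) p = count_mem e p.
  by apply: eq_count => e' /=; rewrite (inj_eq low_inj).
rewrite count_uniq_mem// ep.
suff -> : count (fun e' => high e' == low e) p = 0%N by [].
apply/eqP; rewrite -leqn0 leqNgt -has_count; apply/hasP => -[e' e'p /eqP].
move=> /(congr1 h); rewrite height_high -/(bot e) => te.
have : - bot e' <= - bot e by apply: emax => //; apply/mapP; exists e'.
by rewrite lerN2 leNgt -te bot_lt_top.
Qed.

Lemma tree_of_merge_tree : merge_tree T.
Proof.
split.
- exact: tree_of_complex.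
- exact: (presented_connected um pr a Kmax).
- move=> x; exists setT; first exact: filterT.
  by apply: sub_finite_set low_point_finite.
- exact: (presented_contractible um pr a Kmax).
- by rewrite setC_cell_top_edge; exact: (sublevel_compact pr).
- by rewrite setC_cell_top_edge; exact: (sublevel_connected um pr a Kmax).
- exact: tree_of_acyclic.
- exact: (pr_height_continuous pr).
- have vK : h (v_infty T) = K.
    by rewrite v_infty_tree_of (pr_heightE pr)// (ultra_birth um).
  apply/seteqP; split=> t /=; rewrite in_itv /= vK andbT.
    by move=> [y /cell_top_edge Ky <-].
  move=> Kt; exists (u a t); last by rewrite (pr_heightE pr)// (le_trans _ (ltW Kt)).
  by apply/cell_top_edge; rewrite (pr_height pr) lt_max Kt.
- move=> g cg gi g0; rewrite v_infty_tree_of => g1.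
  apply: (increasing_path um pr Kmax cg gi _ g1).
  by have [i [j ->]] := g0; rewrite (pr_heightE pr)// (ultra_birth um).
Qed.

Hypothesis bin : binary m.

(* The edge of the branch i that ends where the branch k joins it. *)
Definition edge_under i k (e : low_point) : Prop :=
  [/\ e <> top_edge, m i (el e) <= bot e & top e = m i k].

Lemma edge_under_exists i k : i != k -> exists e, edge_under i k e.
Proof.
move=> ik; have [e [ie ib be te]] := edge_below (Q := fun r => r < m i k) (ultra_lt um ik).
have ne : e <> top_edge by move=> eE; move: be; rewrite eE bot_top_edge ltNge Kmax.
exists e; split=> //; apply/le_anti/andP; split; last first.
  by rewrite leNgt; apply/negP; exact: te.
have elk : m (el e) k = m i k.
  by apply: (ultra_eq um (j := i)); rewrite (ultra_sym um) (le_lt_trans ie).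
have [|[_]] := edge_gap e k; rewrite elk//.
by rewrite leNgt be.
Qed.

Lemma edge_under_unique i k e e' : edge_under i k e -> edge_under i k e' -> e = e'.
Proof.
move=> [ne ie te] [ne' ie' te'].
have [t /andP[bt tq]] : exists t, Num.max (bot e) (bot e') < t < m i k.
  have lt : Num.max (bot e) (bot e') < m i k.
    by rewrite gt_max -{1}te -te' !bot_lt_top.
  by exists ((Num.max (bot e) (bot e') + m i k) / 2); rewrite !(midf_lt lt).
move: bt; rewrite gt_max => /andP[bt bt'].
apply: (edge_meet (t := t)) => //; rewrite ?te ?te'//.
apply: (ultra_trans um (j := i)); last exact: le_trans ie' (ltW bt').
by rewrite (ultra_sym um); exact: le_trans ie (ltW bt).
Qed.

Lemma edge_under_neq i k e e' : edge_under i k e -> edge_under k i e' -> e <> e'.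
Proof.
move=> [_ ie te] [_ ke _] ee; subst e'.
have := bot_lt_top e; rewrite te ltNge; apply/negP/negPn.
by apply: (ultra_trans um ie); rewrite (ultra_sym um).
Qed.

Lemma edge_under_high i k e : edge_under i k e -> high e = u i (m i k).
Proof.
move=> [_ ie te]; rewrite /high te; apply: (pr_eqT um pr); rewrite (ultra_sym um).
by rewrite (le_trans ie)// -te ltW// bot_lt_top.
Qed.

Lemma edge_under_el e : e <> top_edge -> exists2 k, el e != k & edge_under (el e) k e.
Proof.
move=> ne; have [k tk] := edge_top ne; exists k; last by split=> //; exact: el_bot.
apply/eqP => ek; have := bot_lt_top e; rewrite tk -ek ltNge el_bot.
by [].
Qed.

(** If the branch of [e] joined neither [i] nor [k] before the end of [e], its leaf would form an
    equilateral triple with them, against [bin]. *)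
Lemma high_edge_under i k e : i != k -> e <> top_edge -> high e = u i (m i k) ->
  edge_under i k e \/ edge_under k i e.
Proof.
move=> ik ne eE.
have te : top e = m i k.
  by rewrite -height_high eE (pr_heightE pr)// (ultra_birth um).
have et : m (el e) (el e) < m i k by rewrite -te (le_lt_trans (el_bot e))// bot_lt_top.
have ei : m (el e) i <= m i k.
  apply/(pr_eq pr); [exact: ltW|exact: (ultra_birth um)|by rewrite -te -/(high e) eE te].
have ek : m (el e) k <= m i k by exact: (ultra_trans um ei).
have [ei'|[_]] := edge_gap e i.
  by left; split=> //; rewrite (ultra_sym um).
rewrite te => ie; have [ek'|[_]] := edge_gap e k.
  by right; split=> //; rewrite (ultra_sym um).
rewrite te => ke.
have ei_eq : m (el e) i = m i k by apply/le_anti; rewrite ei.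
have ek_eq : m (el e) k = m i k by apply/le_anti; rewrite ek.
exfalso; apply: (bin (i := el e) (j := i) (k := k)) => //.
- by apply/eqP => eqi; move: et; rewrite -ei_eq -eqi ltxx.
- by apply/eqP => eqk; move: et; rewrite -ek_eq -eqk ltxx.
Qed.

Lemma child_edgeP v (e : edge T) : child_edge v e <-> e <> top_edge /\ high e = v.
Proof.
have lt := bot_lt_top e; split=> [[w /joinsP[ne [[-> ->]|[-> ->]]]]|[ne <-]] //.
  by rewrite /= height_high -/(bot e) => /(lt_trans lt); rewrite ltxx.
exists (low e); last by rewrite /= height_high.
by split; [exact/eqP|right; rewrite /= char0 char1].
Qed.

Lemma childP v (w : T) : child v w <-> exists e, child_edge v e /\ low e = w.
Proof.
split=> [[wv [e jvw]]|[e [ve ew]]]; last subst w.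
  exists e; split; first by exists w.
  have [_ [[ve we]|[_ ->]]//] := joinsP jvw.
  move: wv; rewrite ve we /= height_high -/(bot e) => /(lt_trans (bot_lt_top e)).
  by rewrite ltxx.
have [w /[dup] /joinsP[_ [[ve' we]|[ve' we]]] jvw wv] := ve.
  move: wv; rewrite ve' we /= height_high -/(bot e) => /(lt_trans (bot_lt_top e)).
  by rewrite ltxx.
by split; [rewrite -we|exists e; rewrite -we].
Qed.

Lemma tree_of_children v : (exists w, child (X := T) v w) ->
  exists i k e e', [/\ i != k, edge_under i k e, edge_under k i e' &
    [set e | child_edge (X := T) v e] = [set e; e']].
Proof.
move=> [w /childP[e [/child_edgeP[ne ev] _]]].
have [k ik ke] := edge_under_el ne; set i := el e in ik ke.
have [e' ie'] : exists e', edge_under k i e' by apply: edge_under_exists; rewrite eq_sym.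
exists i, k, e, e'; split=> //; apply/seteqP; split=> f.
  move=> /child_edgeP[nf fv]; have : high f = u i (m i k).
    by rewrite fv -ev; exact: edge_under_high.
  move=> /(high_edge_under ik nf)[fu|fu]; [left|right].
    exact: edge_under_unique fu ke.
  exact: edge_under_unique fu ie'.
move=> [->|->]; apply/child_edgeP => //; split; first by have [] := ie'.
rewrite -ev (edge_under_high ie') (edge_under_high ke) (ultra_sym um k i).
by apply: (pr_eqT um pr); rewrite (ultra_sym um).
Qed.

Section Labels.
(** [s i k] stands for the label of the branch of [i] where it meets that of [k]. By [s_eq] it
    depends on the edge alone: [i] and [j] have merged before that height. *)
Variable s : 'I_n -> 'I_n -> side.
Hypothesis s_neq : forall i k, i != k -> s i k <> s k i.
Hypothesis s_eq : forall i j k l, m i j < m i k -> m i k = m j l -> s i k = s j l.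

Lemma edge_label_exists (e : low_point) : exists l,
  forall i k, i != k -> edge_under i k e -> l = s i k.
Proof.
have [->|ne] := pselect (e = top_edge).
  by exists LeftSide => i k _ [].
have [k ik [_ ke te]] := edge_under_el ne; exists (s (el e) k) => i l il [_ ie te'].
apply: s_eq; rewrite -te ?te'//.
by rewrite (ultra_sym um) -te' (le_lt_trans ie)// bot_lt_top.
Qed.

Definition edge_label := projT1 (choice edge_label_exists).

Lemma edge_labelE i k e : i != k -> edge_under i k e -> edge_label e = s i k.
Proof. by move=> ik ike; exact: (projT2 (choice edge_label_exists)). Qed.

Lemma tree_of_two_children (v : T) : vertex v -> (exists w, child v w) ->
  [set w | child v w] #= `I_2.
Proof.
move=> _ /tree_of_children[i [k [e [e' [ik ie ke cE]]]]].
have -> : [set w | child v w] = [set low e; low e'].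
  have cve f : child_edge (X := T) v f <-> f = e \/ f = e'.
    by have := congr1 (fun A => A f) cE => /= ->.
  apply/seteqP; split=> w.
    by move=> /childP[f [/cve[->|->] <-]]; [left|right].
  by move=> [->|->]; apply/childP; [exists e|exists e']; split=> //; apply/cve; [left|right].
by apply: card_eq_set2 => /low_inj; exact: edge_under_neq ie ke.
Qed.

Lemma tree_of_labelled (v : T) : vertex v -> (exists w, child v w) ->
  exists eL eR, [/\ edge_label eL = LeftSide, edge_label eR = RightSide &
    [set e | child_edge v e] = [set eL; eR]].
Proof.
move=> _ /tree_of_children[i [k [e [e' [ik ie ke cE]]]]].
have le := edge_labelE ik ie; have le' : edge_label e' = s k i.
  by apply: edge_labelE; rewrite // eq_sym.
have := s_neq ik; case sik : (s i k) le => le; case ski : (s k i) le' => le' // _.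
  by exists e, e'.
by exists e', e; rewrite setUC.
Qed.

Definition chiral_tree_of : chiral_merge_tree (R := R) :=
  ChiralMergeTree tree_of_merge_tree tree_of_two_children tree_of_labelled.

End Labels.

End PresentedTree.

(** * Cell structures of a presented space *)

Section CellComplexes.
Context {R : realType} (X : tree_data (R := R)).
Hypothesis cc : cell_complex X.

Lemma edge_interior_open (e : edge X) : open (edge_interior e).
Proof. by rewrite /edge_interior; case: ifP => _; exact: interval_open. Qed.

Lemma edge_interior_dom (e : edge X) : edge_interior e `<=` edge_dom e.
Proof.
move=> s; rewrite /edge_interior /edge_dom; case: ifP => _ /=; rewrite !in_itv /= ?andbT.
  exact: ltW.
by move=> /andP[/ltW-> /ltW->].
Qed.

Lemma edge_interior_half (e : edge X) : edge_interior e 2^-1.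
Proof.
rewrite /edge_interior; case: ifP => _ /=; rewrite in_itv /= invr_gt0 ltr0n//=.
by rewrite invf_lt1// ltr1n.
Qed.

Lemma edge_dom_cases (e : edge X) s : edge_dom e s ->
  edge_interior e s \/ (vertex (char e s) /\ (s = 0 \/ s = 1 /\ e != e_infty X)).
Proof.
rewrite /edge_interior /edge_dom; case: ifPn => [_|ne] /=; rewrite !in_itv /= ?andbT.
  rewrite le_eqVlt => /orP[/eqP<-|->]; last by left.
  by right; split; [exact: (char0_vertex cc)|left].
move=> /andP[]; rewrite le_eqVlt => /orP[/eqP<- _|->].
  by right; split; [exact: (char0_vertex cc)|left].
rewrite le_eqVlt => /orP[/eqP->|->]; last by left.
by right; split; [exact: (char1_vertex cc)|right].
Qed.

Lemma not_vertex_cell (e : edge X) y : vertex y -> cell e y -> False.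
Proof.
move=> vy ey; have : (@vertex R X `&` cell e) y by [].
by rewrite (vertex_cell_disjoint cc).
Qed.

Lemma cell_eq (e e' : edge X) y : cell e y -> cell e' y -> e = e'.
Proof. by move=> ey e'y; apply: (cell_disjoint cc); exists y. Qed.

Lemma cellI (e : edge X) s : edge_interior e s -> cell e (char e s).
Proof. by exists s. Qed.

Lemma vertex_or_cell (y : X) : ~ vertex y -> exists e, cell e y.
Proof.
move=> ny; have : [set: X] y by [].
by rewrite -(cell_cover cc) => -[//|[e _ ey]]; exists e.
Qed.

Lemma char_continuous (e : edge X) : {within edge_dom e, continuous (char e)}.
Proof. by apply/continuousP => U /(weak_topology cc). Qed.

Lemma cell_piece_open (e : edge X) (W : set R) : open W ->
  open (char e @` (W `&` edge_interior e)).
Proof.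
move=> oW; apply/(weak_topology cc) => e'; apply/open_subspaceP.
have [->|ne] := eqVneq e' e.
  exists (W `&` edge_interior e); first exact/openI/edge_interior_open.
  apply/seteqP; split=> s [].
    by move=> Ws ds; split=> //; exists s.
  move=> [r [Wr ir] rs] ds; split=> //.
  have [is_|[vs _]] := edge_dom_cases ds.
    have rs' : r = s by apply: (char_inj cc _ _ rs); rewrite inE.
    by subst r.
  by exfalso; apply: (not_vertex_cell vs); rewrite -rs; exact: cellI.
exists set0; first exact: open0.
apply/seteqP; split=> s [//] [r [_ ir] rs] ds.
have ce : cell e (char e' s) by rewrite -rs; exact: cellI.
have [is_|[vs _]] := edge_dom_cases ds; last by exfalso; exact: not_vertex_cell vs ce.
by move: ne; rewrite (cell_eq (cellI is_) ce) eqxx.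
Qed.

Lemma cell_open (e : edge X) : open (cell e).
Proof.
have -> : cell e = char e @` (setT `&` edge_interior e) by rewrite setTI.
exact/cell_piece_open/openT.
Qed.

(** In the weak topology a set is closed if it contains each closed edge or meets it in end points
    only, since finite sets of parameters are closed. *)
Lemma closed_by_edges (A : set X) :
  (forall e : edge X, (forall s, edge_dom e s -> A (char e s)) \/
     (forall s, edge_dom e s -> A (char e s) -> s = 0 \/ s = 1)) -> closed A.
Proof.
move=> Ae; rewrite -openC; apply/(weak_topology cc) => e; apply/open_subspaceP.
have [all|few] := Ae e.
  exists set0; first exact: open0.
  by apply/seteqP; split=> s [//] /= nA /all.
pose F := [set s : R | (s = 0 \/ s = 1) /\ A (char e s)].
exists (~` F).
  rewrite openC; apply: (accessible_finite_set_closed.1 _); last first.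
    apply: (@sub_finite_set _ _ [set 0; 1]); last exact: finite_set2.
    by move=> s [].
  exact/hausdorff_accessible/Rhausdorff.
apply/seteqP; split=> s [/= nA ds]; split=> //.
  by move=> As; apply: nA; split=> //; exact: few.
by move=> [_].
Qed.

Lemma vertices_closed (A : set X) : A `<=` @vertex R X -> closed A.
Proof.
move=> Av; apply: closed_by_edges => e; right=> s ds /Av vs.
have [is_|[_ [|[]]]] := edge_dom_cases ds; [|by left|by right].
by exfalso; apply: (not_vertex_cell vs); exact: cellI.
Qed.

Lemma edge_closed (e : edge X) : closed (char e @` edge_dom e).
Proof.
apply: closed_by_edges => e'; have [->|ne] := eqVneq e' e; first by left=> s; exists s.
right=> s ds [r dr rs].
have [is_|[_ [|[]]]] := edge_dom_cases ds; [|by left|by right].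
exfalso; have := cellI is_; rewrite -rs => ce'.
have [ir|[vr _]] := edge_dom_cases dr; last exact: not_vertex_cell vr ce'.
by move: ne; rewrite (cell_eq (cellI ir) ce') eqxx.
Qed.

Lemma cell_connected (e : edge X) : connected (cell e).
Proof.
apply: connected_continuous_connected.
  by apply/connected_intervalP; rewrite /edge_interior; case: ifP => _; exact: interval_is_interval.
exact: continuous_subspaceW (@edge_interior_dom e) (@char_continuous e).
Qed.

(** The union of the other cells is open, so [cell e] is relatively clopen away from the
    vertices. *)
Lemma connected_cell (C : set X) (e : edge X) y : connected C ->
  (forall z, C z -> ~ vertex z) -> C y -> cell e y -> C `<=` cell e.
Proof.
move=> cC nC Cy ey.
pose O := \bigcup_(e' in [set e' | e' != e]) cell e'.
have oO : open O by apply: bigcup_open => e' _; exact: cell_open.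
have <- : C `&` cell e = C; last by move=> z [].
apply: cC; first by exists y.
  by exists (cell e) => //; exact: cell_open.
exists (~` O); first by rewrite closedC.
apply/seteqP; split=> z [Cz].
  move=> ez; split=> // -[e' /= ne e'z].
  by move: ne; rewrite (cell_eq ez e'z) eqxx.
move=> nO; split=> //; have [e' e'z] := vertex_or_cell (nC _ Cz).
have [<-//|ne] := eqVneq e' e.
by exfalso; apply: nO; exists e'.
Qed.

Lemma cell_inverse (e : edge X) : exists k : X -> R,
  (forall s, edge_interior e s -> k (char e s) = s) /\
  forall y, cell e y -> {for y, continuous k}.
Proof.
have kex (y : X) : exists s, cell e y -> edge_interior e s /\ char e s = y.
  have [[s is_ <-]|ne] := pselect (cell e y); first by exists s.
  by exists 0.
have [k kP] := choice kex; have kK s : edge_interior e s -> k (char e s) = s.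
  move=> is_; have [ik ck] := kP _ (cellI is_).
  by apply: (char_inj cc _ _ ck); rewrite inE.
exists k; split=> // y ey U; rewrite /= nbhsE => -[W [oW Wk] WU].
have [ik ck] := kP y ey.
have oN := @cell_piece_open e W oW.
have : \forall z \near y, (char e @` (W `&` edge_interior e)) z.
  by apply: open_nbhs_nbhs; split=> //; exists (k y).
rewrite nbhs_simpl /=; apply: filterS => z [s [Ws is_] <-].
by apply: WU; rewrite kK.
Qed.

Lemma ivt_between (f : R -> R) v : {within `[0, 1], continuous f} ->
  (f 0 <= v <= f 1) \/ (f 1 <= v <= f 0) -> exists2 r, 0 <= r <= 1 & f r = v.
Proof.
move=> cf fv; have [|r] := @IVT R f 0 1 v ler01 cf.
  by case: fv => /andP[v1 v2]; rewrite ge_min le_max v1 v2 ?orbT.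
by rewrite in_itv /= => r01 <-; exists r.
Qed.

(** A cell is an interval, so two of the three arms leave [x] in the same direction, and the one
    that gets farther passes through the tip of the other. *)
Lemma cell_no_tripod (e : edge X) (A : 'I_3 -> R -> X) x :
  (forall k, continuous (A k)) -> (forall k, A k 0 = x) ->
  (forall k r, 0 <= r <= 1 -> cell e (A k r)) -> (forall k, A k 1 <> x) ->
  (forall k l r s, k != l -> 0 <= r <= 1 -> 0 <= s <= 1 -> A k r = A l s -> A k r = x) ->
  False.
Proof.
move=> cA A0 Ae A1 Adis; have [k [kK ck]] := cell_inverse e.
have kinj y z : cell e y -> cell e z -> k y = k z -> y = z.
  by move=> [s is_ <-] [r ir <-]; rewrite !kK// => ->.
pose f i r := k (A i r).
have cf i : {within `[0, 1], continuous (f i)}.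
  apply/subspace_continuousP => r /=; rewrite in_itv /= => r01.
  apply: cvg_within_filter; apply: continuous_comp; first exact: cA.
  exact/ck/Ae.
have x_in : cell e x by rewrite -(A0 ord0); apply: Ae; rewrite lexx ler01.
have f0 i : f i 0 = k x by rewrite /f A0.
have one : 0 <= (1 : R) <= 1 by rewrite ler01 lexx.
have f1 i : f i 1 <> k x.
  by move=> /kinj e1; apply: (A1 i); apply: e1 => //; exact: Ae.
have clash i j : i != j -> (f i 0 <= f j 1 <= f i 1) \/ (f i 1 <= f j 1 <= f i 0) -> False.
  move=> ij /(ivt_between (cf i))[r r01 /kinj e1].
  have := e1 (Ae i r r01) (Ae j 1 one) => e2.
  apply: (A1 j); rewrite -e2; exact: (Adis i j r 1).
have same i j : i != j -> (k x < f i 1) = (k x < f j 1) -> False.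
  move=> ij; have ji : j != i by rewrite eq_sym.
  have := f1 i; have := f1 j => /eqP nj /eqP ni.
  case: (ltgtP (k x) (f i 1)) => [hi|hi|hi]; last by move: ni; rewrite hi eqxx.
  - move=> /esym hj; case: (leP (f i 1) (f j 1)) => [le|/ltW le].
      by apply: (clash j i ji); left; rewrite f0 (ltW hi) le.
    by apply: (clash i j ij); left; rewrite f0 (ltW hj) le.
  - move=> /esym/negbT; rewrite -leNgt => hj.
    case: (leP (f i 1) (f j 1)) => [le|/ltW le].
      by apply: (clash i j ij); right; rewrite f0 hj le.
    by apply: (clash j i ji); right; rewrite f0 (ltW hi) le.
have [i [j [ij e1]]] : exists i j : 'I_3, i != j /\ (k x < f i 1) = (k x < f j 1).
  pose o1 : 'I_3 := Ordinal (isT : 1 < 3)%N; pose o2 : 'I_3 := Ordinal (isT : 2 < 3)%N.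
  have [e01|n01] := eqVneq (k x < f ord0 1) (k x < f o1 1); first by exists ord0, o1.
  have [e02|n02] := eqVneq (k x < f ord0 1) (k x < f o2 1); first by exists ord0, o2.
  exists o1, o2; split=> //.
  by move: n01 n02; case: (_ < f ord0 1); case: (_ < f o1 1); case: (_ < f o2 1).
exact: (same i j).
Qed.

End CellComplexes.

Section PresentedComplexes.
Context {R : realType} {n : nat} (X : tree_data (R := R)) (m : 'I_n -> 'I_n -> R)
  (u : 'I_n -> R -> X).
Hypotheses (um : ultrametric m) (pr : presented (@height R X) m u).
Hypotheses (cc : cell_complex X) (ac : acyclic X).
Hypothesis infty : @height R X @` cell (e_infty X) = `]height (v_infty X), +oo[%classic.
Local Notation h := (@height R X).
Local Notation singular := (singular m u).

Lemma arm_continuous i (t p : R) : continuous (fun r : R => u i (t + r * (p - t))).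
Proof.
move=> r; apply: (@continuous_comp _ _ _ (fun r : R => t + r * (p - t)) (u i)).
  apply: cvgD; first exact: cvg_cst.
  by apply: cvgM; [exact: cvg_id|exact: cvg_cst].
exact: (pr_continuous pr).
Qed.

Lemma convex_in (t p q r x : R) : p <= t <= q -> p <= x <= q -> 0 <= r <= 1 ->
  p <= t + r * (x - t) <= q.
Proof. by move=> /andP[? ?] /andP[? ?] /andP[? ?]; apply/andP; split; nra. Qed.

Lemma nbhs_segment (P : R -> Prop) (t : R) : (\forall s \near t, P s) ->
  exists2 e, 0 < e & forall s, t - e <= s <= t + e -> P s.
Proof.
move=> /nbhs_ballP[e /= e0 be]; exists (e / 2); first by rewrite divr_gt0.
move=> s st; apply: be; rewrite /ball /= distrC.
apply: le_lt_trans (_ : e / 2 < e); first by rewrite ler_distl.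
by rewrite ltr_pdivrMr// ltr_pMr// ltr1n.
Qed.

Lemma cell_near (e : edge X) i t : cell e (u i t) -> \forall s \near t, cell e (u i s).
Proof.
move=> et; have oU := (pr_open pr (cell e)).1 (cell_open cc e) i.
by apply: (open_nbhs_nbhs (conj oU _)).
Qed.

Lemma cell_not_branch (e : edge X) i j : i != j -> ~ cell e (u i (m i j)).
Proof.
move=> ij et; set t := m i j in et *.
have jt : cell e (u j t) by rewrite -(pr_eqT um pr (lexx _)).
have it : m i i < t by exact: (ultra_lt um).
have jt' : m j j < t by rewrite /t (ultra_sym um) (ultra_lt um)// eq_sym.
have near_t : \forall s \near t,
    [/\ cell e (u i s), cell e (u j s), m i i < s & m j j < s].
  near=> s; split; near: s; [exact: cell_near|exact: cell_near|exact: lt_nbhsr|exact: lt_nbhsr].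
have [d d0 seg] := nbhs_segment near_t.
pose x := u i t.
(* The three arms at the merge point: up along [i], down along [i], and down along [j]. *)
pose br (k : 'I_3) : 'I_n := if k == ord_max then j else i.
pose tip (k : 'I_3) : R := if k == ord0 then t + d else t - d.
have tip_in k : t - d <= tip k <= t + d.
  by rewrite /tip; case: ifP => _; apply/andP; split; lra.
have t_in : t - d <= t <= t + d by rewrite lerBlDr lerDl ltW.
have arm_in k r : 0 <= r <= 1 -> t - d <= t + r * (tip k - t) <= t + d.
  by move=> r01; apply: convex_in.
have born k s : t - d <= s <= t + d -> m (br k) (br k) <= s.
  by move=> /seg[_ _ /ltW ? /ltW ?]; rewrite /br; case: ifP.
apply: (@cell_no_tripod R X cc e (fun k r => u (br k) (t + r * (tip k - t))) x).
- by move=> k; exact: arm_continuous.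
- move=> k; rewrite mul0r addr0 /x /br; case: ifP => // _.
  by rewrite (pr_eqT um pr (lexx _)).
- by move=> k r /(arm_in k)/seg[? ? _ _]; rewrite /br; case: ifP.
- move=> k; rewrite mul1r addrC subrK => /(congr1 h).
  rewrite !(pr_heightE pr) ?born ?(ltW it)// /tip; case: ifP => _; lra.
- move=> k l r s kl r01 s01 e2.
  suff r0 : r = 0.
    rewrite r0 mul0r addr0 /x /br; case: ifP => // _.
    by rewrite (pr_eqT um pr (lexx _)).
  have [] := pr_eqP pr (born _ _ (arm_in _ _ r01)) (born _ _ (arm_in _ _ s01)) e2.
  have /andP[r0 r1] := r01; have /andP[s0 s1] := s01.
  have mij : m i j = t by []; have mji : m j i = t by rewrite (ultra_sym um).
  case: k l kl {e2} => [[|[|[|//]]] kk] [[|[|[|//]]] ll];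
    rewrite /tip /br -!val_eqE //= ?mij ?mji => _; nra.
Unshelve. all: by end_near. Qed.

(** Around a leaf the space is a single ray, on which points are determined by their heights. Along
    a cell through the leaf the height would be injective with an interior minimum. *)
Lemma cell_not_leaf (e : edge X) i : ~ cell e (u i (m i i)).
Proof.
move=> [s0 is0 s0E].
have [r tr gap] := gap_right m i (m i i).
have gap' k : k != i -> r <= m i k.
  move=> ki; have [|//] := gap k.
  by rewrite leNgt (ultra_lt um)// eq_sym.
have oV := pr_open_leaf um pr tr gap'; set V := [set u i t | t in _] in oV.
have [U oU UV] := (open_subspaceP _ _).1 ((weak_topology cc V).1 oV e).
have near0 : \forall s \near s0, edge_interior e s /\ V (char e s).
  have nI : \forall s \near s0, edge_interior e s.
    by apply: open_nbhs_nbhs; split=> //; exact: edge_interior_open.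
  have nU : \forall s \near s0, U s.
    apply: open_nbhs_nbhs; split=> //.
    have : (char e @^-1` V `&` edge_dom e) s0.
      split; last exact: edge_interior_dom.
      by exists (m i i); rewrite //= in_itv.
    by rewrite -UV => -[].
  near=> s; have is_ : edge_interior e s by near: s.
  split=> //; have : (U `&` edge_dom e) s.
    by split; [near: s|exact: edge_interior_dom].
  by rewrite UV => -[].
have [d d0 seg] := nbhs_segment near0.
have VE y : V y -> u i (h y) = y /\ m i i <= h y.
  by move=> [t _ <-]; rewrite (pr_height pr) (pr_clamp pr) le_max lexx orbT.
have hs0 : h (char e s0) = m i i by rewrite s0E (pr_heightE pr).
apply: (@inj_no_min R (fun s => h (char e s)) (s0 - d) s0 (s0 + d)).
- by rewrite ltrBlDr ltrDl.
- by rewrite ltrDl.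
- have := @char_continuous R X cc e.
  move=> /subspace_continuousP cch; apply/subspace_continuousP => s /=.
  rewrite in_itv /= => /seg[is_ _]; have ds := edge_interior_dom is_.
  have ch := pr_height_continuous pr.
  have cs : char e s' @[s' --> s] --> char e s.
    have := cch s ds; rewrite within_interior//.
    have : \forall s \near s, edge_interior e s.
      by apply: open_nbhs_nbhs; split=> //; exact: edge_interior_open.
    by apply: filterS => ?; exact: edge_interior_dom.
  by apply: cvg_within_filter; exact: cvg_comp cs (ch _).
- move=> s t; rewrite !in_itv /= => /seg[is_ /VE[us _]] /seg[it /VE[ut _]] hh.
  apply: (char_inj cc _ _ (_ : char e s = char e t)); rewrite ?inE//.
  by rewrite -us -ut; congr u.
- rewrite hs0; have [] := VE (char e (s0 - d)) => //.
  by have [] // := seg (s0 - d); rewrite lexx /= lerD2l; lra.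
- rewrite hs0; have [] := VE (char e (s0 + d)) => //.
  by have [] // := seg (s0 + d); rewrite lexx andbT lerD2l; lra.
Unshelve. all: by end_near. Qed.

Lemma cell_not_singular (e : edge X) y : cell e y -> ~ singular y.
Proof.
move=> ey [i [j yE]]; subst y; have [ij|ij] := eqVneq i j.
  by subst j; exact: cell_not_leaf ey.
exact: cell_not_branch ij ey.
Qed.

Lemma singular_vertex y : singular y -> vertex y.
Proof.
move=> sy; apply: contrapT => /(vertex_or_cell cc)[e /cell_not_singular].
exact.
Qed.

Lemma nonsingular_segment i t : m i i <= t -> ~ singular (u i t) ->
  exists p q, [/\ m i i <= p, p < t, t < q & forall k, m i k <= p \/ q <= m i k].
Proof.
move=> it ns; have nt k : m i k <> t.
  by move=> kt; apply: ns; apply/(singularP um pr it); exists k.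
have it' : m i i < t by rewrite lt_neqAle it andbT; exact/eqP.
have [k [kt kmax]] := gap_below (Q := fun r => r < t) it'.
have [q tq gap] := gap_right m i t.
exists (m i k), q; split=> //; first exact: (ultra_birth um).
move=> l; have [lt|ql] := gap l; last by right.
left; apply: kmax; rewrite lt_neqAle lt andbT; exact/eqP.
Qed.

Lemma range_branch i y : range (u i) y -> u i (h y) = y /\ m i i <= h y.
Proof. by move=> [t _ <-]; rewrite (pr_height pr) (pr_clamp pr) le_max lexx orbT. Qed.

(** A ray meets the cell in a closed set, which is also relatively open because the cell has no
    singular points and the space is a segment of one ray around any other point. *)
Lemma cell_in_branch (e : edge X) : exists i, cell e `<=` range (u i).
Proof.
have y_in := cellI (@edge_interior_half R X e); set y := char e _ in y_in.
have [i [iy ui]] := pr_leaf pr y; exists i.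
suff <- : cell e `&` range (u i) = cell e by move=> z [].
apply: (cell_connected cc); first by exists y; split=> //; exists (h y).
  exists (interior (range (u i))); first exact: open_interior.
  apply/seteqP; split=> z [ez rz]; split=> //; last exact: interior_subset.
  have [uz iz] := range_branch rz.
  have ns : ~ singular (u i (h z)) by rewrite uz; exact: cell_not_singular ez.
  have [p [q [ip pz zq gap]]] := nonsingular_segment iz ns.
  have oS := pr_open_segment um pr ip gap.
  rewrite /interior; apply: filterS (open_nbhs_nbhs (conj oS _)).
    by move=> _ [t _ <-]; exists t.
  by exists (h z); rewrite // /= in_itv /= pz.
by exists (range (u i)) => //; exact: (pr_range_closed um pr).
Qed.

Lemma edge_dom_closure (e : edge X) s : edge_dom e s -> closure (edge_interior e) s.
Proof.
move=> ds; have [is_|[_ s01]] := edge_dom_cases cc ds; first exact: subset_closure.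
move=> V /nbhs_ballP[d /= d0 bd].
have i_in t : 0 < t -> t < 1 -> edge_interior e t.
  by rewrite /edge_interior => ? ?; case: ifP => _ /=; rewrite in_itv /= ?andbT //; apply/andP.
pose t := Num.min (d / 2) 2^-1.
have t0 : 0 < t by rewrite lt_min divr_gt0//= invr_gt0.
have t1 : t < 1 by rewrite gt_min invf_lt1 ?ltr1n ?orbT.
have td : t < d.
  by rewrite gt_min ltr_pdivrMr// ltr_pMr// ltr1n.
case: s01 => [se|[se _]]; subst s.
  exists t; split; [exact: i_in|apply: bd].
  by rewrite /ball /= sub0r normrN gtr0_norm.
exists (1 - t); split; [apply: i_in; lra|apply: bd].
by rewrite /ball /= opprB addrC subrK gtr0_norm.
Qed.

Lemma edge_in_branch (e : edge X) i : cell e `<=` range (u i) ->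
  forall s, edge_dom e s -> u i (h (char e s)) = char e s /\ m i i <= h (char e s).
Proof.
move=> ei s ds; apply: range_branch.
have oU : open (~` range (u i)) by rewrite openC; exact: (pr_range_closed um pr).
apply: contrapT => nr.
have [V oV VU] := (open_subspaceP _ _).1 ((weak_topology cc _).1 oU e).
have Vs : V s.
  by have : (char e @^-1` (~` range (u i)) `&` edge_dom e) s by []; rewrite -VU => -[].
have [t [it Vt]] := edge_dom_closure ds (open_nbhs_nbhs (conj oV Vs)).
have : (V `&` edge_dom e) t by split=> //; exact: edge_interior_dom.
by rewrite VU => -[/= nt _]; apply/nt/ei/(cellI it).
Qed.

Lemma edge_height_continuous (e : edge X) :
  {within edge_dom e, continuous (h \o char e)}.
Proof.
have := @char_continuous R X cc e => /subspace_continuousP cch.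
apply/subspace_continuousP => s ds; have ch := pr_height_continuous pr.
exact: cvg_comp (cch s ds) (ch _).
Qed.

(** Along the closed edge, which lies on one ray, the height is injective: inner points differ by
    [char_inj], and the two ends differ because a loop would be a closed trail. Hence it is
    monotone. *)
Lemma cell_segment (e : edge X) : e != e_infty X -> exists i p q,
  [/\ m i i <= p, p < q, cell e = [set u i t | t in `]p, q[] &
    joins e (u i p) (u i q)].
Proof.
move=> ne; have [i ei] := cell_in_branch e; have eb := edge_in_branch ei.
have domE : edge_dom e = `[0, 1]%classic by rewrite /edge_dom (negbTE ne).
have intE : edge_interior e = `]0, 1[%classic by rewrite /edge_interior (negbTE ne).
pose f := h \o char e.
have cf : {within `[0, 1], continuous f} by rewrite -domE; exact: edge_height_continuous.
have in01 s : s \in `[0, 1] -> edge_dom e s by rewrite domE.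
have finj : {in `[0, 1] &, injective f}.
  move=> s t /in01 ds /in01 dt fst.
  have st : char e s = char e t.
    by rewrite -(eb s ds).1 -(eb t dt).1; congr u.
  have [is_|[vs s01]] := edge_dom_cases cc ds; have [it|[vt t01]] := edge_dom_cases cc dt.
  - by apply: (char_inj cc _ _ st); rewrite inE.
  - by exfalso; apply: (not_vertex_cell cc vt); rewrite -st; exact: cellI.
  - by exfalso; apply: (not_vertex_cell cc vs); rewrite st; exact: cellI.
  have loop : char e 0 = char e 1 -> False.
    move=> loop; have : trail (char e 0) [:: e] (char e 0).
      by exists (char e 0) => //; split=> //; left.
    by move=> /ac/(_ isT).
  case: s01 t01 st => [->|[-> _]] [->|[-> _]] // st; exfalso; apply: loop => //.
have I0 : 0 \in `[0, 1 : R] by rewrite in_itv /= lexx ler01.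
have I1 : 1 \in `[0, 1 : R] by rewrite in_itv /= lexx ler01.
have inner (s : R) : 0 < s -> s < 1 -> s \in `[0, 1].
    by move=> /ltW ? /ltW ?; rewrite in_itv /=; apply/andP.
have cover (p q : R) : m i i <= p -> p < q ->
    (forall s, 0 < s -> s < 1 -> p < f s < q) ->
    (f 0 = p /\ f 1 = q) \/ (f 0 = q /\ f 1 = p) ->
    cell e = [set u i t | t in `]p, q[].
  move=> ip pq mid ends; apply/seteqP; split=> y.
    rewrite /cell intE => -[s /=]; rewrite in_itv /= => /andP[s0 s1] <-.
    exists (f s); first by rewrite /= in_itv /= mid.
    by have [] := eb s (in01 _ (inner _ s0 s1)).
  move=> [t /=]; rewrite in_itv /= => /andP[pt tq] <-.
  have [|s /andP[s0 s1] fs] := ivt_between (v := t) cf.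
    by case: ends => -[-> ->]; [left|right]; rewrite !ltW.
  have ds : edge_dom e s by rewrite domE /= in_itv /= s0.
  have -> : u i t = char e s by have [<- _] := eb s ds; rewrite -fs.
  apply: cellI; rewrite intE /= in_itv /= !lt_neqAle s0 s1 !andbT.
  apply/andP; split; apply/eqP => se.
    by move: fs; rewrite -se; case: ends => -[f0 f1]; rewrite ?f0 => e'; move: pt tq; rewrite -e' ltxx.
  by move: fs; rewrite se; case: ends => -[f0 f1]; rewrite ?f1 => e'; move: pt tq; rewrite -e' ltxx.
have [u0 i0] := eb 0 (in01 _ I0); have [u1 i1] := eb 1 (in01 _ I1).
have [lt|gt|e01] := ltgtP (f 0) (f 1).
- have mono : forall x y, x \in `[0, 1] -> y \in `[0, 1] -> (f x <= f y) = (x <= y) :=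
    itv_continuous_inj_le (ex_intro _ 0 (ex_intro _ 1 (And4 I0 I1 ltr01 (ltW lt)))) cf finj.
  exists i, (f 0), (f 1); split=> //; last by split=> //; left; rewrite u0 u1.
  apply: cover => //; last by left.
  by move=> s s0 s1; apply/andP; split;
      rewrite ltNge (mono _ _ _ _) ?(inner _ s0 s1) ?I0 ?I1 // -?ltNge //.
- have mono : forall x y, x \in `[0, 1] -> y \in `[0, 1] -> (f x <= f y) = (y <= x) :=
    itv_continuous_inj_ge (ex_intro _ 0 (ex_intro _ 1 (And4 I0 I1 ltr01 (ltW gt)))) cf finj.
  exists i, (f 1), (f 0); split=> //; last by split=> //; right; rewrite u0 u1.
  apply: cover => //; last by right.
  by move=> s s0 s1; apply/andP; split;
      rewrite ltNge (mono _ _ _ _) ?(inner _ s0 s1) ?I0 ?I1 // -?ltNge //.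
- by have := finj _ _ I0 I1 e01 => /esym/eqP; rewrite oner_eq0.
Qed.

End PresentedComplexes.

(** * Edges just below a merge point *)

Section Below.
Context {R : realType} {n : nat} (X : tree_data (R := R)) (m : 'I_n -> 'I_n -> R)
  (u : 'I_n -> R -> X).
Hypotheses (um : ultrametric m) (pr : presented (@height R X) m u).
Hypotheses (cc : cell_complex X) (ac : acyclic X).
Hypothesis infty : @height R X @` cell (e_infty X) = `]height (v_infty X), +oo[%classic.
Local Notation h := (@height R X).

(** Unlike [edge_under], this refers only to the points of the branch close to the merge point, so
    it can be used in any cell structure and is carried along by homeomorphisms that match the
    rays. *)
Definition below (i k : 'I_n) (e : edge X) : Prop :=
  e != e_infty X /\
  exists p, p < m i k /\ forall t, p < t < m i k -> cell e (u i t).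

Lemma joins_vertex (e : edge X) v w : joins e v w -> vertex v /\ vertex w.
Proof.
move=> [ne [[<- <-]|[<- <-]]].
  by split; [exact: (char0_vertex cc)|exact: (char1_vertex cc)].
by split; [exact: (char1_vertex cc)|exact: (char0_vertex cc)].
Qed.

(** The vertices other than [u i t] form a closed set, so the ray avoids all vertices shortly before
    [t], and a connected set without vertices stays in one cell. *)
Lemma near_below i t : vertex (u i t) -> m i i < t ->
  exists e p, [/\ m i i <= p, p < t & forall s, p < s < t -> cell e (u i s)].
Proof.
move=> vt it; pose W : set X := [set y | vertex y /\ y <> u i t].
have cW : closed W by apply: (vertices_closed cc) => y [].
have oN := (pr_open pr _).1 (closed_openC cW) i.
have Nt : \forall s \near t, ~ W (u i s).
  by apply: (open_nbhs_nbhs (conj oN _)) => -[].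
have [d d0 seg] := nbhs_segment Nt.
pose p := Num.max (t - d) (m i i).
have pt : p < t by rewrite gt_max it andbT; lra.
have ip : m i i <= p by rewrite le_max lexx orbT.
have nv s : p < s < t -> ~ vertex (u i s).
  move=> /andP[ps st] vs; apply: (seg s).
    by move: ps; rewrite gt_max => /andP[? _]; apply/andP; split; lra.
  split=> // /(pr_eqP pr)[]; rewrite ?(ltW it) ?(le_trans ip (ltW ps))//.
  by move=> ste; move: st; rewrite ste ltxx.
have mid : p < (p + t) / 2 < t by rewrite !(midf_lt pt).
have [e ee] := vertex_or_cell cc (nv _ mid).
have sub : u i @` `]p, t[ `<=` cell e.
  apply: (connected_cell cc (y := u i ((p + t) / 2))) => //.
  - apply: connected_continuous_connected.
      by apply/connected_intervalP; exact: interval_is_interval.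
    by apply: continuous_subspaceT; exact: (pr_continuous pr).
  - by move=> _ [r /= r_in <-]; apply: nv; move: r_in; rewrite in_itv.
by exists e, p; split=> // s ps; apply: sub; exists s; rewrite //= in_itv.
Qed.

(** The point [u i t] is a limit of points of [e], hence an end of the edge; since [e] is a segment
    of a ray with points below [t], it is the upper end. *)
Lemma below_child i t (e : edge X) p : vertex (u i t) -> m i i <= p -> p < t ->
  (forall s, p < s < t -> cell e (u i s)) -> e != e_infty X /\ child_edge (u i t) e.
Proof.
move=> vt ip pt pe.
have mid : p < (p + t) / 2 < t by rewrite !(midf_lt pt).
have it : m i i <= t by rewrite (le_trans ip)// ltW.
have [r dr rt] : (char e @` edge_dom e) (u i t).
  apply: contrapT => nE.
  have oE := (pr_open pr _).1 (closed_openC (@edge_closed R X cc e)) i.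
  have nEt : \forall s \near t, ~ (char e @` edge_dom e) (u i s).
    by apply: (open_nbhs_nbhs (conj oE _)).
  have [d d0 seg] := nbhs_segment nEt.
  pose q := Num.max (t - d) p.
  have qt : q < t by rewrite gt_max pt andbT; lra.
  have /andP[q1 q2] : q < (q + t) / 2 < t by rewrite !(midf_lt qt).
  move: (q1); rewrite gt_max => /andP[q3 q4].
  apply: (seg ((q + t) / 2)); first by apply/andP; split; lra.
  have [s is_ <-] := pe ((q + t) / 2) (introT andP (conj q4 q2)).
  by exists s => //; exact: edge_interior_dom.
have [ir|[_ r01]] := edge_dom_cases cc dr.
  by exfalso; apply: (not_vertex_cell cc vt); rewrite -rt; exact: cellI.
(* Otherwise [u i t] would be [v_infty], but the cell contains points below it, contrary to
   [infty]. *)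
have ne : e != e_infty X.
  apply/eqP => ee; case: r01 => [r0|[_]]; last by rewrite ee eqxx.
  have : (h @` cell (e_infty X)) ((p + t) / 2).
    exists (u i ((p + t) / 2)); first by rewrite -ee; exact: pe.
    by rewrite (pr_heightE pr)//; case/andP: mid => /ltW /(le_trans ip).
  rewrite infty /= in_itv /= andbT /v_infty -ee -r0 rt (pr_heightE pr)//.
  by case/andP: mid => _ /lt_trans/[apply]; rewrite ltxx.
split=> //; have [j [p' [q [jp pq cE je]]]] := cell_segment um pr cc ac ne.
have : cell e (u i ((p + t) / 2)) by exact: pe.
rewrite cE => -[s /=]; rewrite in_itv /= => /andP[ps sq] /esym.
move=> /(pr_eqP pr)[||ms _].
- by case/andP: mid => /ltW /(le_trans ip).
- exact: le_trans jp (ltW ps).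
have jq : m j j <= q by exact: le_trans jp (ltW pq).
have [vp|vq] : u i t = u j p' \/ u i t = u j q.
  case: je => _ je; case: r01 => [r0|[r1 _]]; subst r; rewrite -rt.
    by case: je => -[-> _]; [left|right].
  by case: je => -[_ ->]; [right|left].
- have [tp _] := pr_eqP pr it jp vp.
  by case/andP: mid => _; rewrite ms tp ltNge (ltW ps).
exists (u j p'); last by rewrite vq !(pr_heightE pr).
by case: je => _ [[? ?]|[? ?]]; split; rewrite // vq; [right|left].
Qed.

Lemma child_edge_segment v (e : edge X) : child_edge v e -> exists j p,
  [/\ v = u j (h v), m j j <= p, p < h v & forall s, p < s < h v -> cell e (u j s)].
Proof.
move=> [w vw wv]; have ne : e != e_infty X by case: vw.
have [j [p [q [jp pq cE [_ je]]]]] := cell_segment um pr cc ac ne.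
have jq : m j j <= q by exact: le_trans jp (ltW pq).
have vE : v = u j q.
  case: vw => _ vw; have : (v = u j q /\ w = u j p) \/ (v = u j p /\ w = u j q).
    by case: je => -[e0 e1]; case: vw => -[e0' e1']; [right|left|left|right]; split; congruence.
  case=> -[ve we] //; move: wv; rewrite ve we !(pr_heightE pr)//.
  by rewrite ltNge (ltW pq).
have hv : h v = q by rewrite vE (pr_heightE pr).
by exists j, p; rewrite hv; split=> // s psq; rewrite cE; exists s.
Qed.

Lemma below_child_edge i k e : i != k -> vertex (u i (m i k)) -> below i k e ->
  child_edge (u i (m i k)) e.
Proof.
move=> ik vk [_ [p [pk pe]]].
have [] // := @below_child i (m i k) e (Num.max p (m i i)) vk.
- by rewrite le_max lexx orbT.
- by rewrite gt_max pk (ultra_lt um).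
- by move=> s /andP[]; rewrite gt_max => /andP[ps _] sk; apply: pe; rewrite ps.
Qed.

Lemma below_common i k e e' q : q < m i k -> below i k e -> below i k e' ->
  exists t, [/\ q < t, t < m i k, cell e (u i t) & cell e' (u i t)].
Proof.
move=> qk [_ [p [pk pe]]] [_ [p' [pk' pe']]].
pose r := Num.max q (Num.max p p').
have rk : r < m i k by rewrite !gt_max qk pk pk'.
have /andP[t1 t2] : r < (r + m i k) / 2 < m i k by rewrite !(midf_lt rk).
move: (t1); rewrite !gt_max => /andP[qt /andP[pt pt']].
by exists ((r + m i k) / 2); split=> //; [apply: pe|apply: pe']; rewrite ?pt ?pt'.
Qed.

Lemma below_unique i k e e' : below i k e -> below i k e' -> e = e'.
Proof.
move=> b b'; have lt : m i k - 1 < m i k by lra.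
have [t [_ _ et et']] := below_common lt b b'.
exact: (cell_eq cc et et').
Qed.

Lemma below_transfer i j k l e : m i j < m i k -> m i k = m j l ->
  below i k e -> below j l e.
Proof.
move=> ij kl [ne [p [pk pe]]]; split=> //; exists (Num.max p (m i j)).
rewrite -kl gt_max pk ij; split=> // t; rewrite gt_max => /andP[/andP[pt it] tk].
by rewrite -(pr_eqT um pr (ltW it)); apply: pe; rewrite pt.
Qed.

(** A cell lies on a single ray, while the branches of [i] and [k] are still disjoint below their
    merger. *)
Lemma below_neq i k e e' : i != k -> below i k e -> below k i e' -> e <> e'.
Proof.
move=> ik b b' ee; subst e'; have ne : e != e_infty X by case: b.
have [j [p [q [jp pq cE _]]]] := cell_segment um pr cc ac ne.
case: b b' => _ [p1 [pk1 pe1]] [_ [p2 [pk2 pe2]]].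
rewrite (ultra_sym um) in pk2 pe2.
pose r := Num.max (Num.max p1 p2) (Num.max (m i i) (m k k)).
have rk : r < m i k.
  by rewrite !gt_max pk1 pk2 ultra_lt//= (ultra_sym um) ultra_lt// eq_sym.
have /andP[t1 t2] : r < (r + m i k) / 2 < m i k by rewrite !(midf_lt rk).
set t := (r + m i k) / 2 in t1 t2.
move: t1; rewrite !gt_max => /andP[/andP[a1 a2] /andP[a3 a4]].
have : cell e (u i t) by apply: pe1; rewrite a1.
have : cell e (u k t) by apply: pe2; rewrite a2.
rewrite cE => -[s /=]; rewrite in_itv /= => /andP[ps sq] es [s' /=].
rewrite in_itv /= => /andP[ps' sq'] es'.
have [st _] := pr_eqP pr (le_trans jp (ltW ps)) (ltW a4) es.
have [st' _] := pr_eqP pr (le_trans jp (ltW ps')) (ltW a3) es'.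
have [_] : t = t /\ m i k <= t.
  by apply: (pr_eqP pr (ltW a3) (ltW a4)); rewrite -es -es' st st'.
by rewrite leNgt t2.
Qed.

End Below.

(** * Isomorphisms of chiral merge trees *)

Section ChiralTrees.
Context {R : realType} {n : nat} (X : chiral_merge_tree (R := R))
  (m : 'I_n -> 'I_n -> R) (u : 'I_n -> R -> X).
Hypotheses (um : ultrametric m) (pr : presented (@height R X) m u).
Local Notation h := (@height R X).
Let mt := underlying_merge_tree X.
Let cc := mt_complex mt.
Let ac := mt_tree_acyclic mt.
Let infty := mt_infty mt.

Lemma child_edge_child (v : X) e : child_edge v e -> exists w, child v w.
Proof. by move=> [w vw wv]; exists w; split=> //; exists e. Qed.

(* A vertex that only subdivides a branch would have two child edges on the
   same segment of that branch. *)
Lemma vertex_singular v : vertex v -> singular m u v.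
Proof.
move=> vv; apply: contrapT => ns; have [i [iv ui]] := pr_leaf pr v.
have crit j : m j j <= h v -> u j (h v) = v -> forall k, m j k <> h v.
  move=> jv uj k jk; apply: ns; rewrite -uj; apply/(singularP um pr jv).
  by exists k.
have iv' : m i i < h v by rewrite lt_neqAle iv andbT; apply/eqP; exact: crit.
have vi : vertex (u i (h v)) by rewrite ui.
have [e [p [ip pv pe]]] := near_below pr cc vi iv'.
have [_ ce] := below_child um pr cc ac infty vi ip pv pe.
rewrite ui in ce; have [eL [eR [lL lR cE]]] := labelled_children vv (child_edge_child ce).
have seg e' : child_edge v e' -> exists q, [/\ q < h v & forall s, q < s < h v -> cell e' (u i s)].
  move=> /(child_edge_segment um pr cc ac)[j [q [vj jq qv qe]]].
  have jv : m j j <= h v by exact: le_trans jq (ltW qv).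
  have ij : m i j <= h v by apply/(pr_eq pr) => //; rewrite ui -vj.
  have ij' : m i j < h v by rewrite lt_neqAle ij andbT; apply/eqP; exact: crit.
  exists (Num.max q (m i j)); rewrite gt_max qv ij'; split=> // s.
  rewrite gt_max => /andP[/andP[qs ijs] sv].
  by rewrite (pr_eqT um pr (ltW ijs)); apply: qe; rewrite qs.
have cL : child_edge v eL by have := congr1 (fun A => A eL) cE => /= ->; left.
have cR : child_edge v eR by have := congr1 (fun A => A eR) cE => /= ->; right.
have [q [qv qe]] := seg _ cL; have [r [rv re]] := seg _ cR.
pose t := Num.max q r; have tv : t < h v by rewrite gt_max qv.
have /andP[s1 s2] : t < (t + h v) / 2 < h v by rewrite !(midf_lt tv).
move: (s1); rewrite gt_max => /andP[qs rs].
have LR : eL = eR.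
  apply: (cell_eq cc (y := u i ((t + h v) / 2))); first by apply: qe; rewrite qs.
  by apply: re; rewrite rs.
by move: lL; rewrite LR lR.
Qed.

Lemma vertexP v : vertex v <-> singular m u v.
Proof. by split; [exact: vertex_singular|exact: (singular_vertex um pr cc)]. Qed.

Lemma merge_vertex i k : vertex (u i (m i k)).
Proof. by apply/vertexP; exists i, k. Qed.

Lemma below_exists i k : i != k -> exists e, below m u i k e.
Proof.
move=> ik; have lt := ultra_lt um ik.
have [e [p [ip pv pe]]] := near_below pr cc (merge_vertex i k) lt.
have [ne _] := below_child um pr cc ac infty (merge_vertex i k) ip pv pe.
by exists e; split=> //; exists p.
Qed.

Lemma edge_below_some (e : edge X) : e != e_infty X ->
  exists i k, i != k /\ below m u i k e.
Proof.
move=> ne; have [i [p [q [ip pq cE je]]]] := cell_segment um pr cc ac ne.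
have iq : m i i <= q by exact: le_trans ip (ltW pq).
have [_ /vertex_singular] := joins_vertex cc je.
move=> /(singularP um pr iq)[k qk]; subst q; exists i, k; split.
  by apply/eqP => ik; move: (le_lt_trans ip pq); rewrite ik ltxx.
by split=> //; exists p; split=> // t pt; rewrite cE; exists t.
Qed.

Lemma below_labels i k e e' : i != k -> below m u i k e -> below m u k i e' ->
  label e <> label e'.
Proof.
move=> ik b b'; have ee := below_neq um pr cc ac ik b b'.
have ce := below_child_edge um pr cc ac infty ik (merge_vertex i k) b.
have ki : k != i by rewrite eq_sym.
have := below_child_edge um pr cc ac infty ki (merge_vertex k i) b'.
rewrite (ultra_sym um) -(pr_eqT um pr (lexx (m i k))) => ce'.
have [eL [eR [lL lR cE]]] := labelled_children (merge_vertex i k) (child_edge_child ce).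
have : [set eL; eR] e by rewrite -cE.
have : [set eL; eR] e' by rewrite -cE.
move=> [e1|e1] [e2|e2]; rewrite e1 e2 ?lL ?lR //; by move: ee; rewrite e1 e2.
Qed.

(** The labels are read off from the edges found by [below_exists]; two leaves that have merged
    earlier share this edge, whence the compatibility. *)
Lemma side_function : exists s : 'I_n -> 'I_n -> side,
  [/\ forall i k, i != k -> s i k <> s k i,
      forall i j k l, m i j < m i k -> m i k = m j l -> s i k = s j l &
      forall i k e, i != k -> below m u i k e -> label e = s i k].
Proof.
have sex (p : 'I_n * 'I_n) : exists l, p.1 != p.2 ->
    forall e, below m u p.1 p.2 e -> label e = l.
  have [->|ik] := eqVneq p.1 p.2; first by exists LeftSide.
  have [e be] := below_exists ik; exists (label e) => _ e'.
  by move=> /(below_unique cc be) ->.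
have [s sP] := choice sex; exists (fun i k => s (i, k)).
have sE i k e : i != k -> below m u i k e -> label e = s (i, k).
  by move=> ik; exact: (sP (i, k)).
split=> // [i k ik|i j k l ij kl].
  have [e be] := below_exists ik; have ki : k != i by rewrite eq_sym.
  have [e' be'] := below_exists ki.
  by rewrite -(sE _ _ _ ik be) -(sE _ _ _ ki be'); exact: below_labels be be'.
have ik : i != k.
  by apply/eqP => ik; subst k; move: ij; rewrite ltNge (ultra_birth um).
have jl : j != l.
  apply/eqP => jl; subst l; move: ij; rewrite kl ltNge; apply/negP/negPn.
  by rewrite (ultra_birthr um).
have [e be] := below_exists ik.
by rewrite -(sE _ _ _ ik be) -(sE _ _ _ jl (below_transfer um pr ij kl be)).
Qed.

End ChiralTrees.

(** * Isomorphisms and labels *)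

Section ChiralIsomorphisms.
Context {R : realType} {n : nat} (X Y : chiral_merge_tree (R := R))
  (m : 'I_n -> 'I_n -> R) (u : 'I_n -> R -> X) (v : 'I_n -> R -> Y).
Hypotheses (um : ultrametric m).
Hypotheses (prX : presented (@height R X) m u) (prY : presented (@height R Y) m v).

(** The homeomorphism that matches the rays preserves singular points, which are the vertices on
    both sides, so by connectedness it maps cells onto cells. *)
Lemma chiral_iso_presented :
  (forall i k e e', i != k -> below m u i k e -> below m v i k e' ->
     label e = label e') -> chiral_iso X Y.
Proof.
move=> lab; have [f [g [cf cg fK gK fE]]] := presented_homeo um prX prY.
have gE i t : g (v i t) = u i t by rewrite -fE fK.
have fh x : height (f x) = height x.
  by have [i [_ <-]] := pr_leaf prX x; rewrite fE (pr_height prY) (pr_height prX).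
exists f; first by split=> //; exists g.
have ccX := mt_complex (underlying_merge_tree X).
have ccY := mt_complex (underlying_merge_tree Y).
have fv y : vertex (f y) -> vertex y.
  move=> /(vertexP um prY)[i [j yE]]; apply/(vertexP um prX).
  by exists i, j; rewrite -(fK y) yE gE.
have gv y : vertex (g y) -> vertex y.
  move=> /(vertexP um prX)[i [j yE]]; apply/(vertexP um prY).
  by exists i, j; rewrite -(gK y) yE fE.
move=> e ne.
have y_in := cellI (edge_interior_half e); set y := char e _ in y_in.
have nvy : ~ vertex (f y) by move=> /fv vy; exact: not_vertex_cell ccX _ _ vy y_in.
have [e' fy] := vertex_or_cell ccY nvy.
have fe : f @` cell e = cell e'.
  apply/seteqP; split.
    apply: (connected_cell ccY (y := f y)) => //.
      apply: connected_continuous_connected; first exact: (cell_connected ccX).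
      exact: continuous_subspaceT.
    by move=> _ [z ez <-] /fv vz; exact: not_vertex_cell ccX _ _ vz ez.
  have ge : g @` cell e' `<=` cell e.
    apply: (connected_cell ccX (y := y)) => //; last by exists (f y).
      apply: connected_continuous_connected; first exact: (cell_connected ccY).
      exact: continuous_subspaceT.
    by move=> _ [z ez <-] /gv vz; exact: not_vertex_cell ccY _ _ vz ez.
  by move=> z ez; exists (g z); [apply: ge; exists z|rewrite gK].
have [i [k [ik be]]] := edge_below_some um prX ne.
have hfe : @height R X @` cell e = @height R Y @` cell e'.
  rewrite -fe; apply/seteqP; split=> t.
    by move=> [z ez <-]; exists (f z) => //; exists z.
  by move=> [_ [z ez <-] <-]; exists z.
have ne' : e' != e_infty Y.
  apply/eqP => ee; have acX := mt_tree_acyclic (underlying_merge_tree X).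
  have [j [p [q [jp pq cE _]]]] := cell_segment um prX ccX acX ne.
  (* The heights on [cell e] are bounded by [q], whereas [e_infty] reaches every height above its
     vertex; [t] exceeds both bounds. *)
  pose t := Num.max q (height (v_infty Y)) + 1.
  have lt_t s : s <= Num.max q (height (v_infty Y)) -> s < t.
    by move=> st; rewrite /t; apply: le_lt_trans st _; rewrite ltrDl.
  have : (@height R X @` cell e) t.
    rewrite hfe ee (mt_infty (underlying_merge_tree Y)) /= in_itv /= andbT.
    by apply: lt_t; rewrite le_max lexx orbT.
  rewrite cE => -[z [s /=]]; rewrite in_itv /= => /andP[ps sq] <-.
  rewrite (pr_heightE prX) ?(le_trans jp (ltW ps))// => st.
  have : t < t by rewrite -{1}st; apply: lt_t; rewrite le_max (ltW sq).
  by rewrite ltxx.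
exists e'; split=> //; apply: (lab i k e e' ik be); split=> //.
have [_ [p [pk pe]]] := be; exists p; split=> // t pt.
by rewrite -fe; exists (u i t); [exact: pe|exact: fE].
Qed.

Lemma presented_chiral_iso (f : X -> Y) :
  (forall e, e != e_infty X -> exists e', [/\ e' != e_infty Y,
      f @` cell e = cell e' & label e = label e']) ->
  (forall i t, f (u i t) = v i t) ->
  forall i k e e', i != k -> below m u i k e -> below m v i k e' ->
     label e = label e'.
Proof.
move=> fe fE i k e e' ik b b'; have [ne [p [pk pe]]] := b.
have [e2 [ne2 ce2 ->]] := fe _ ne; congr label.
apply: (below_unique (mt_complex (underlying_merge_tree Y)) _ b').
split=> //; exists p; split=> // t pt.
by rewrite -ce2; exists (u i t); [exact: pe|exact: fE].
Qed.

End ChiralIsomorphisms.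

(** * Labels determined by one choice per merger *)

Section SideFunctions.
Context {R : realType} {N : nat} (b d : 'I_N -> R).
Hypothesis bd : forall j : 'I_N, (0 < j)%N -> b j < d j.
Hypothesis dd : forall j k : 'I_N, (0 < j)%N -> (j < k)%N -> d k < d j.
Variables (par : 'I_N -> 'I_N).
Hypothesis ap : admissible b par.
Local Notation m := (merge_height b d par).
Let um := merge_ultrametric bd ap.

Lemma merge_height_ext par' : (forall j : 'I_N, (0 < j)%N -> par' j = par j) ->
  merge_height b d par' = m.
Proof.
move=> e; apply/funext => i; apply/funext => j; rewrite /merge_height.
move: (i + j)%N => f; elim: f i j => //= f IH i j.
case: eqVneq => // ij; case: (ltnP j i) => [ji|ij'].
  by rewrite e ?IH//; exact: leq_ltn_trans ji.
have {}ij' : (i < j)%N by rewrite ltn_neqAle ij' val_eqE ij.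
by rewrite e ?IH//; exact: leq_ltn_trans ij'.
Qed.

Lemma death_inj (j k : 'I_N) : (0 < j)%N -> (0 < k)%N -> d j = d k -> j = k.
Proof.
move=> j0 k0 e; case: (ltngtP j k) => [jk|kj|/val_inj//].
  by have := dd j0 jk; rewrite e ltxx.
by have := dd k0 kj; rewrite e ltxx.
Qed.

(** Heights of mergers are maxima of deaths along the chains of parents, so one death is attained;
    the last bound puts the point where [j] dies on the branch of [i]. *)
Lemma merge_death (i k : 'I_N) : i != k ->
  exists j : 'I_N, [/\ (0 < j)%N, m i k = d j & m i j <= d j].
Proof.
suff gt : forall i k : 'I_N, (k < i)%N ->
    exists j : 'I_N, [/\ (0 < j)%N, m i k = d j & m i j <= d j].
  case: (ltngtP i k) => [ik _|ki _|/val_inj->]; [|exact: gt|by rewrite eqxx].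
  have [j [j0 kd kj]] := gt _ _ ik; exists j; split=> //; first by rewrite merge_sym.
  by apply: (ultra_trans um (j := k)); rewrite // merge_sym// kd.
move=> {}i {}k; have [s] := ubnP (i + k); elim: s i k => // s IH i k iks ki.
have i0 := leq_ltn_trans (leq0n _) ki; have lt := par_lt ap i0.
rewrite (merge_gt d ap ki); case: (leP (m (par i) k) (d i)) => [le|lt'].
  by exists i; split=> //; rewrite merge_refl ltW// bd.
have [j [j0 pd pj]] : exists j : 'I_N, [/\ (0 < j)%N, m (par i) k = d j & m (par i) j <= d j].
  case: (ltngtP (par i) k) => [pk|kp|/val_inj e].
  - have [j [j0 kd kj]] := IH k (par i) ltac:(lia) pk; exists j.
    split=> //; first by rewrite merge_sym.
    by apply: (ultra_trans um (j := k)); rewrite // merge_sym// kd.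
  - by apply: IH => //; lia.
  - exfalso; move: lt'; rewrite e merge_refl -e ltNge.
    by rewrite ltW// (lt_trans (par_birth ap i0)) ?bd.
exists j; split=> //; apply: (ultra_trans um (j := par i)) => //.
by rewrite merge_par// -pd ltW.
Qed.

Definition flip (c : bool) (x : side) : side :=
  if c then x else if x is LeftSide then RightSide else LeftSide.

Lemma flip_neq x y : x <> y -> x = flip false y.
Proof. by case: x; case: y. Qed.

(** [sigma j] tells whether the dying branch is the left one at the height [d j], and [m i j < d j]
    says that [i] lies on its side. For distinct leaves the pick succeeds by [merge_death]. *)
Definition side_of (sigma : 'I_N -> bool) (i k : 'I_N) : side :=
  if [pick j : 'I_N | (0 < j)%N && (d j == m i k)] is Some j then
    flip (m i j < d j) (if sigma j then LeftSide else RightSide)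
  else LeftSide.

Lemma side_ofE sigma (i j k : 'I_N) : (0 < j)%N -> m i k = d j ->
  side_of sigma i k = flip (m i j < d j) (if sigma j then LeftSide else RightSide).
Proof.
move=> j0 ij; rewrite /side_of; case: pickP => [l /andP[l0 /eqP lE]|/(_ j)].
  by have -> : l = j by apply: death_inj; rewrite // lE.
by rewrite j0 ij eqxx.
Qed.

(** Two leaves on the side of [j] would merge before [d j]; if neither were on it, [i], [k] and [j]
    would be equilateral. *)
Lemma death_branch (i j k : 'I_N) : i != k -> (0 < j)%N -> m i k = d j ->
  m i j <= d j -> (m i j < d j) = ~~ (m k j < d j).
Proof.
move=> ik j0 ikd ijd; have kjd : m k j <= d j.
  by apply: (ultra_trans um (j := i)); rewrite // merge_sym// ikd.
have [ij|ij] := boolP (m i j < d j).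
  apply/esym/negP => kj.
  have : m i k < d j.
    apply: le_lt_trans (ultra_le um i j k) _.
    by rewrite gt_max ij merge_sym.
  by rewrite ikd ltxx.
apply/esym/negPn; rewrite lt_neqAle kjd andbT; apply/eqP => kj.
have ij' : m i j = d j by apply/le_anti; rewrite ijd leNgt.
have nj (l : 'I_N) : m l j = d j -> l != j.
  move=> e; apply/eqP => lj; subst l; have := bd j0.
  by rewrite -e merge_refl ltxx.
apply: (merge_binary bd dd ap (i := i) (j := k) (k := j)) => //; try exact: nj.
by rewrite ikd kj ij'.
Qed.

Lemma side_of_neq sigma i k : i != k -> side_of sigma i k <> side_of sigma k i.
Proof.
move=> ik; have [j [j0 ikd ij]] := merge_death ik.
rewrite (side_ofE sigma j0 ikd) (side_ofE (k := i) sigma j0); last by rewrite merge_sym.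
rewrite (death_branch ik j0 ikd ij).
by case: (m k j < d j); case: (sigma j).
Qed.

Lemma side_of_eq sigma i j k l : m i j < m i k -> m i k = m j l ->
  side_of sigma i k = side_of sigma j l.
Proof.
move=> ij kl; have ik : i != k.
  by apply/eqP => ik; subst k; move: ij; rewrite ltNge (ultra_birth um).
have [t [t0 ikd it]] := merge_death ik.
rewrite (side_ofE sigma t0 ikd) (side_ofE (k := l) sigma t0); last by rewrite -kl.
congr flip; rewrite ikd in ij; apply/idP/idP => lt.
  by apply: le_lt_trans (ultra_le um j i t) _; rewrite gt_max lt merge_sym// ij.
by apply: le_lt_trans (ultra_le um i j t) _; rewrite gt_max lt ij.
Qed.

Lemma side_of_par sigma (j : 'I_N) : (0 < j)%N ->
  side_of sigma j (par j) = if sigma j then LeftSide else RightSide.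
Proof.
by move=> j0; rewrite (side_ofE sigma j0) ?merge_par// merge_refl bd.
Qed.

(** At every merger the label of one side determines the other, and compatibility moves it to the
    leaf that dies there, where [sigma] prescribes it. *)
Lemma side_of_complete (s : 'I_N -> 'I_N -> side) (sigma : 'I_N -> bool) :
  (forall i k, i != k -> s i k <> s k i) ->
  (forall i j k l, m i j < m i k -> m i k = m j l -> s i k = s j l) ->
  (forall j : 'I_N, (0 < j)%N -> s j (par j) = if sigma j then LeftSide else RightSide) ->
  forall i k, i != k -> s i k = side_of sigma i k.
Proof.
move=> s1 s2 s3 i k ik; have [j [j0 ikd ij]] := merge_death ik.
rewrite (side_ofE sigma j0 ikd) -s3//.
have [lt|nlt] := boolP (m i j < d j).
  by apply: s2; rewrite ?ikd ?merge_par.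
have lt : m k j < d j by move: nlt; rewrite (death_branch ik j0 ikd ij) negbK.
have <- : s k i = s j (par j).
  by apply: s2; rewrite (merge_sym d ap k i) ikd ?merge_par.
exact/flip_neq/s1.
Qed.

End SideFunctions.

(** * Renumbering the leaves *)

Section Reindexing.
Context {R : realType} {n : nat} (m : 'I_n -> 'I_n -> R) (pi ro : 'I_n -> 'I_n).
Hypotheses (piK : cancel pi ro) (roK : cancel ro pi).
Local Notation m' := (fun i j => m (pi i) (pi j)).

Lemma reindex_ultrametric : ultrametric m -> ultrametric m'.
Proof.
move=> um; split=> [i j|i j k|i j ij]; first exact: (ultra_sym um).
  exact: (ultra_le um).
by apply: (ultra_lt um); rewrite (can_eq piK).
Qed.

Lemma reindex_elder_at j t : elder_at m' j t <-> elder_at m (pi j) t.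
Proof.
split=> je k jk kj; last by apply: je; rewrite // (can_eq piK).
by have := je (ro k); rewrite roK; apply=> //; apply: contra kj => /eqP <-; rewrite roK.
Qed.

Lemma reindex_bar j : bar m' j = bar m (pi j).
Proof.
by apply/seteqP; split=> t [it je]; split=> //; exact/reindex_elder_at.
Qed.

Lemma reindex_has_elders : has_elders m -> has_elders m'.
Proof.
move=> he i t it; have [j ij je] := he _ _ it.
by exists (ro j); [rewrite roK|apply/reindex_elder_at; rewrite roK].
Qed.

Lemma reindex_presented (X : topologicalType) (h : X -> R) u :
  presented h m u -> presented h m' (u \o pi).
Proof.
move=> pr; split=> [i t|i t|x|i j t|U].
- exact: (pr_height pr).
- exact: (pr_below pr).
- by have [i ui] := pr_cover pr x; exists (ro i); rewrite /= roK.
- exact: (pr_eq pr).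
- rewrite (pr_open pr); split=> oU i; first exact: oU.
  by have := oU (ro i); rewrite /= roK.
Qed.

End Reindexing.

(** * Counting realizations *)

Section Realizations.
Context {R : realType} (N : nat) (B : barcode R) (b d : nat -> R) (I : nat -> set R).
Hypothesis N_gt0 : (1 <= N)%N.
Hypothesis B_bars : forall J : set R,
  mult B J = count_mem J [seq I j | j <- index_iota 1 N.+1].
Hypothesis I1 : I 1%N = `[b 1%N, +oo[%classic.
Hypothesis Ij : forall j, (2 <= j <= N)%N ->
  I j = `[b j, d j[%classic /\ strictly_contained (I j) (I 1%N).
Hypothesis d_decr : forall j, (2 <= j)%N -> (j < N)%N -> d j.+1 < d j.

(** Leaves are numbered from 0, so the leaf [j] carries the bar [I j.+1]. *)
Definition birth (j : 'I_N) : R := b j.+1.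
Definition death (j : 'I_N) : R := d j.+1.

Lemma bars_ordinal : [seq I j | j <- index_iota 1 N.+1] = [seq I j.+1 | j : 'I_N].
Proof.
have -> : [seq I j.+1 | j : 'I_N] = [seq I j.+1 | j <- [seq val k | k <- enum 'I_N]].
  by rewrite -map_comp.
by rewrite val_enum_ord /index_iota subn1 (iotaDl 1 0 N) -map_comp.
Qed.

Lemma barP (j : 'I_N) t : I j.+1 t <-> birth j <= t /\ ((0 < j)%N -> t < death j).
Proof.
rewrite /birth /death; case: j => -[|j] jN /=.
  by rewrite I1 /= in_itv /= andbT; split=> [|[]].
have [|-> _] := Ij (j := j.+2); first by rewrite /= jN.
rewrite /= in_itv /=; split=> [/andP[]//|[-> ->]//].
Qed.

Lemma bar_nonempty (j : 'I_N) : I j.+1 !=set0.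
Proof.
have : mult B (I j.+1) <> 0%N.
  rewrite B_bars bars_ordinal => /eqP; rewrite -leqn0 leqNgt -has_count.
  by move=> /hasP; apply; exists (I j.+1) => //=; apply/mapP; exists j; rewrite ?mem_enum.
by move=> /(mult_interval (b := B))[].
Qed.

(** An interval of nonzero multiplicity in a barcode is nonempty. *)
Lemma birth_lt_death (j : 'I_N) : (0 < j)%N -> birth j < death j.
Proof.
by move=> j0; have [t /barP[jt /(_ j0)]] := bar_nonempty j; exact: le_lt_trans.
Qed.

Lemma death_decr (j k : 'I_N) : (0 < j)%N -> (j < k)%N -> death k < death j.
Proof.
rewrite /death; case: j k => [j jN] [k kN] /= j0.
elim: k kN => // k IH kN; rewrite ltnS leq_eqVlt => /orP[/eqP jk|jk].
  by subst k; apply: d_decr.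
apply: lt_trans (IH (ltnW kN) jk).
by apply: d_decr => //; exact: (leq_ltn_trans (leq0n _) jk).
Qed.

Lemma birth_bar (j : 'I_N) : I j.+1 (birth j).
Proof. by apply/barP; split=> // /birth_lt_death. Qed.

Lemma bar_inf (j : 'I_N) : inf (I j.+1) = birth j.
Proof.
have lb : lbound (I j.+1) (birth j) by move=> t /barP[].
apply/le_anti/andP; split; first by apply: ge_inf (birth_bar j); exists (birth j).
by apply: lb_le_inf => //; exists (birth j); exact: birth_bar.
Qed.

Lemma bar_not_sub (j k : 'I_N) : (j < k)%N -> ~ I j.+1 `<=` I k.+1.
Proof.
move=> jk sub; have k0 := leq_ltn_trans (leq0n _) jk.
(* At the death of [k], or at the birth of [j] if that is later, the bar of [j] is alive and that of
   [k] is over. *)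
have /sub/barP[_ /(_ k0)] : I j.+1 (Num.max (birth j) (death k)).
  apply/barP; rewrite le_max lexx; split=> // j0.
  by rewrite gt_max birth_lt_death// death_decr.
by rewrite ltNge le_max lexx orbT.
Qed.

Lemma bar_inj (j k : 'I_N) : I j.+1 = I k.+1 -> j = k.
Proof.
move=> e; case: (ltngtP j k) => [jk|kj|/val_inj//].
  by exfalso; apply: (bar_not_sub jk); rewrite e.
by exfalso; apply: (bar_not_sub kj); rewrite e.
Qed.

Lemma bars_uniq : uniq [seq I j.+1 | j : 'I_N].
Proof. by rewrite map_inj_uniq ?enum_uniq// => j k; exact: bar_inj. Qed.

Lemma mult_bar (j : 'I_N) : mult B (I j.+1) = 1%N.
Proof.
rewrite B_bars bars_ordinal count_uniq_mem ?bars_uniq//.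
by rewrite map_f ?mem_enum.
Qed.

Lemma strictly_containedP (j k : 'I_N) : (0 < j)%N ->
  strictly_contained (I j.+1) (I k.+1) <-> (k < j)%N && (birth k < birth j).
Proof.
move=> j0; rewrite /strictly_contained !bar_inf.
split=> [[[sub _] kj]|/andP[kj bkj]].
  rewrite kj andbT ltnNge leq_eqVlt; apply/negP => /orP[/eqP/val_inj jk|jk].
    by move: kj; rewrite jk ltxx.
  exact: bar_not_sub jk sub.
split=> //; split.
  move=> t /barP[jt /(_ j0) tj]; apply/barP; split.
    exact: le_trans (ltW bkj) jt.
  by move=> k0; apply: lt_trans tj _; exact: death_decr.
move=> /(_ (birth k) (birth_bar k)) /barP[].
by rewrite leNgt bkj.
Qed.

(** Distinct indices give distinct bars of multiplicity one, so the sum over intervals becomes a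
    number of indices. *)
Lemma mu_bar (j : 'I_N) : (0 < j)%N ->
  mu B (I j.+1) = #|[pred k : 'I_N | (k < j)%N && (birth k < birth j)]|.
Proof.
move=> j0; rewrite /mu.
pose P (K : set R) := `[< strictly_contained (I j.+1) K >].
rewrite (fsbigE [seq K <- [seq I k.+1 | k : 'I_N] | P K]) ?filter_uniq ?bars_uniq//.
- rewrite big_filter_cond big_map big_enum_cond /=.
  rewrite (eq_bigr (fun=> 1%N)) => [|k _]; last exact: mult_bar.
  rewrite sum1_card; apply: eq_card => k; rewrite !inE /=.
  apply/andP/idP => [[/asboolP/strictly_containedP -> //]|kj].
  by have sc := (strictly_containedP k j0).2 kj; split; [exact/asboolP|rewrite inE; exact: sc].
- by move=> K /=; rewrite mem_filter => /andP[/asboolP].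
- move=> K JK; rewrite mem_filter negb_and => /orP[/asboolP//|nK].
  by rewrite B_bars bars_ordinal; apply/count_memPn.
Qed.

Lemma merge_bar par j : admissible birth par ->
  bar (merge_height birth death par) j = I j.+1.
Proof.
move=> ap; apply/seteqP; split=> t.
  move=> [jt]; rewrite merge_refl in jt => je; apply/barP; split=> //.
  exact: (merge_elder death ap jt).1 je.
move=> /barP[jt tj]; split; first by rewrite merge_refl.
exact: (merge_elder death ap jt).2 tj.
Qed.

Lemma count_bars J : mult B J = count_mem J [seq I j.+1 | j : 'I_N].
Proof. by rewrite B_bars bars_ordinal. Qed.

(** Two Morse sets are involved: the one that the tree is built from yields [m] and the rays, and
    [pi0], presented by the same [m], supplies the elders and the bars. *)
Lemma realization_presented (X : tree_data (R := R)) : elder_map X B ->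
  exists par (u : 'I_N -> R -> X), admissible birth par /\
    presented (@height R X) (merge_height birth death par) u.
Proof.
move=> [[S [tau0 [mS aS]]] [tau mP [Is eIs mB]]].
have [n [m [c [n0 um ps]]]] := morse_presented (morse_times mS) (morse_finite mS).
have [u pr] := associated_presented (morse_times mS) um ps aS.
have [c' ps'] := presented_pi0 um pr.
have he : has_elders m by apply/(oldest_elders um ps')/(morse_oldest mP).
have tauP i j : m i j \in tau by exact: (merge_in_times um ps' _ _ (morse_times mP)).
have pI : perm_eq Is [seq bar m j | j <- enum [set: 'I_n]%SET].
  by apply: (elder_bars um ps' tauP eIs); rewrite (elders_inT um ps' he).
have pB : perm_eq [seq bar m j | j : 'I_n] [seq I j.+1 | j : 'I_N].
  have -> : [seq bar m j | j : 'I_n] = [seq bar m j | j <- enum [set: 'I_n]%SET].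
    by rewrite enum_setT -enumT.
  rewrite perm_sym -(permPr pI); apply/allP => J _ /=.
  by rewrite -mB count_bars.
have nN : n = N by have := perm_size pB; rewrite !size_image !card_ord.
subst n.
(* The Elder Rule determines the bars only as a multiset, so the leaves are renumbered to match
   [I]. *)
have piex (j : 'I_N) : exists i, bar m i = I j.+1.
  have : I j.+1 \in [seq bar m j | j : 'I_N].
    by rewrite (perm_mem pB) map_f ?mem_enum.
  by move=> /mapP[i _ ->]; exists i.
have [pi piP] := choice piex.
have pi_inj : injective pi.
  by move=> j k jk; apply: bar_inj; rewrite -!piP jk.
have [ro piK roK] := injF_bij pi_inj.
have um' := reindex_ultrametric piK um.
have pr' := reindex_presented roK pr.
have he' := reindex_has_elders piK roK he.
pose m' i j := m (pi i) (pi j).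
have bar' j : bar m' j = I j.+1 by rewrite (reindex_bar m piK roK) piP.
have mb j : m' j j = birth j.
  apply/le_anti/andP; split.
    by have := birth_bar j; rewrite -bar' => -[].
  have : bar m' j (m' j j) by split=> //; exact: elder_at_birth.
  by rewrite bar' => /barP[].
have el (j : 'I_N) t : birth j <= t -> elder_at m' j t <-> ((0 < j)%N -> t < death j).
  move=> jt; split=> [je|tj].
    by have : bar m' j t; [split=> //; rewrite mb|rewrite bar' => /barP[]].
  by have : I j.+1 t; [apply/barP|rewrite -bar' => -[]].
have [par ap mE] := merge_height_exists birth_lt_death death_decr um' he' mb el.
by exists par, (u \o pi); split=> //; rewrite -mE.
Qed.

Lemma merge_elder_map par (X : tree_data (R := R)) u : admissible birth par ->
  presented (@height R X) (merge_height birth death par) u -> elder_map X B.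
Proof.
move=> ap pr; set m := merge_height birth death par in pr.
have um : ultrametric m := merge_ultrametric birth_lt_death ap.
have he : has_elders m := merge_has_elders birth_lt_death ap.
have bin : binary m := merge_binary birth_lt_death death_decr ap.
have [c ps] := presented_pi0 um pr.
have mS := presentedS_morse_set um ps N_gt0 bin he.
have tauP i j : m i j \in merge_times m by apply/mem_merge_times; exists i, j.
split; first by exists (pi0 (@height R X)), (merge_times m); split=> //;
  exact: (presented_associated (morse_times mS) um ps pr).
exists (merge_times m) => //.
have [Is eIs] := elder_exists um ps tauP [set: 'I_N]%SET.
have pI := elder_bars um ps tauP eIs erefl.
rewrite (elders_inT um ps he) in eIs; exists Is => // J.
rewrite count_bars (permP pI).
congr (count_mem J _).
by rewrite enum_setT -enumT; apply: eq_map => j; rewrite merge_bar.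
Qed.

End Realizations.

(** * Codes for the realizations *)

Section Counting.
Context {R : realType} (N : nat) (B : barcode R) (b d : nat -> R) (I : nat -> set R).
Hypothesis N_gt0 : (1 <= N)%N.
Hypothesis B_bars : forall J : set R,
  mult B J = count_mem J [seq I j | j <- index_iota 1 N.+1].
Hypothesis I1 : I 1%N = `[b 1%N, +oo[%classic.
Hypothesis Ij : forall j, (2 <= j <= N)%N ->
  I j = `[b j, d j[%classic /\ strictly_contained (I j) (I 1%N).
Hypothesis d_decr : forall j, (2 <= j)%N -> (j < N)%N -> d j.+1 < d j.
Local Notation birth := (birth (N := N) b).
Local Notation death := (death (N := N) d).
Let bd := birth_lt_death B_bars I1 Ij.
Let dd := death_decr d_decr.
Local Notation merge := (merge_height birth death).

Lemma chiral_tree_exists par (sigma : 'I_N -> bool) : admissible birth par ->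
  exists (X : chiral_merge_tree (R := R)) (u : 'I_N -> R -> X),
    presented (@height R X) (merge par) u /\
    forall i k e, i != k -> below (merge par) u i k e ->
      label e = side_of birth death par sigma i k.
Proof.
move=> ap; have um := merge_ultrametric bd ap.
have bin := merge_binary bd dd ap.
have pr := tree_space_presented um.
pose o : 'I_N * 'I_N := (Ordinal N_gt0, Ordinal N_gt0).
have [a [c Kmax]] : exists a c, forall i j, merge par i j <= merge par a c.
  case: (@arg_maxP _ _ _ o predT (fun p => merge par p.1 p.2) isT) => -[a c] _ ac.
  by exists a, c => i j; exact: (ac (i, j)).
have s1 i k : i != k ->
    side_of birth death par sigma i k <> side_of birth death par sigma k i.
  by move=> ik; exact: (side_of_neq bd dd ap ik).
have s2 := side_of_eq bd dd ap sigma.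
exists (chiral_tree_of um pr Kmax bin s1 s2), (@tree_point R N (merge par)).
split=> // i k e ik [_ [p [pk pe]]].
have [e' eu] := edge_under_exists um pr Kmax ik.
suff -> : e = e' by exact: edge_labelE.
have [ne ie te] := eu.
(* Between [q] and the merger the branch of [i] runs through both cells, so they share the
   midpoint. *)
pose q := Num.max p (bot (tree_height (m := merge par)) e'); have qk : q < merge par i k.
  by rewrite gt_max pk -te (bot_lt_top um pr Kmax).
have /andP[t1 t2] : q < (q + merge par i k) / 2 < merge par i k by rewrite !(midf_lt qk).
move: (t1); rewrite gt_max => /andP[pt bt].
apply: (cell_eq (tree_of_complex um pr Kmax)
  (y := tree_point (merge par) i ((q + merge par i k) / 2))).
  by apply: pe; rewrite pt.
apply: cell_branch => //; first by rewrite merge_sym.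
by rewrite te.
Qed.

(** The oldest leaf chooses nothing; a prescribed value at index 0 gives each realization a single
    code and contributes a factor 1. *)
Definition parents (j : 'I_N) : pred 'I_N :=
  if (0 < j)%N then [pred k : 'I_N | (k < j)%N && (birth k < birth j)] else pred1 j.

Definition orientations (j : 'I_N) : pred bool :=
  if (0 < j)%N then predT else pred1 false.

Definition codes : pred ({ffun 'I_N -> 'I_N} * {ffun 'I_N -> bool}) :=
  [predX family parents & family orientations].

Lemma codesP p : p \in codes <-> [/\ admissible birth p.1,
  forall j : 'I_N, j = 0%N :> nat -> p.1 j = j &
  forall j : 'I_N, j = 0%N :> nat -> p.2 j = false].
Proof.
rewrite inE /=; split=> [/andP[/familyP pF /familyP pG]|[ap p0 s0]].
  split=> j j0.
  - by have := pF j; rewrite /parents j0 inE => /andP[].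
  - by have := pF j; rewrite /parents j0 inE => /eqP.
  - by have := pG j; rewrite /orientations j0 inE => /eqP.
apply/andP; split; apply/familyP => j; rewrite /parents /orientations.
  case: ifPn => [/ap[lt bl]|]; first by rewrite inE lt.
  by rewrite -eqn0Ngt => /eqP/p0->; rewrite inE.
by case: ifPn => [//|]; rewrite -eqn0Ngt => /eqP/s0->; rewrite inE.
Qed.

Lemma card_codes :
  #|codes| = (2 ^ (N - 1) * \prod_(2 <= j < N.+1) mu B (I j))%N.
Proof.
rewrite cardX mulnC !card_family !foldrE !big_map /=; congr muln.
  transitivity (\prod_(j : 'I_N) (if (0 < j)%N then 2 else 1))%N.
    apply: eq_bigr => j _; rewrite /orientations; case: ifP => _.
      by rewrite card_bool.
    by rewrite card1.
  case: N N_gt0 => // N' _; rewrite big_ord_recl /= mul1n.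
  by rewrite prod_nat_const card_ord subn1.
transitivity (\prod_(j : 'I_N) (if (0 < j)%N then mu B (I j.+1) else 1))%N.
  apply: eq_bigr => j _; rewrite /parents; case: ifP => j0.
    by rewrite (mu_bar B_bars I1 Ij d_decr j0).
  by rewrite card1.
case: N N_gt0 => // N' _; rewrite big_ord_recl /= mul1n.
by rewrite big_add1 big_add1 /= big_mkord.
Qed.

Lemma realizations_counted : iso_class_count
  (fun X : chiral_merge_tree => chiral_elder_map X B) #|codes|.
Proof.
have rex (i : 'I_#|codes|) : exists X : chiral_merge_tree (R := R),
    exists u : 'I_N -> R -> X,
    presented (@height R X) (merge (enum_val i).1) u /\
    forall j k e, j != k -> below (merge (enum_val i).1) u j k e ->
      label e = side_of birth death (enum_val i).1 (enum_val i).2 j k.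
  have /codesP[ap _ _] := enum_valP i.
  exact: chiral_tree_exists ap.
have [rep repP] := choice rex; exists rep; split.
- move=> i; have /codesP[ap _ _] := enum_valP i; have [u [pr _]] := repP i.
  exact: (merge_elder_map N_gt0 B_bars I1 Ij d_decr ap pr).
- move=> i j [f [cf [g [cg fK gK]] fh] fe].
  have /codesP[ap p0 s0] := enum_valP i; have /codesP[ap' p0' s0'] := enum_valP j.
  have [u [pr lab]] := repP i; have [v [pr' lab']] := repP j.
  have um := merge_ultrametric bd ap; have um' := merge_ultrametric bd ap'.
  have [pi [[ro piK roK] mpi fE]] := homeo_presented um um' pr pr' cf cg fK gK fh.
  have pi_id k : pi k = k.
    apply: (bar_inj B_bars I1 Ij d_decr).
    rewrite -(merge_bar I1 Ij (pi k) ap') -(merge_bar I1 Ij k ap).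
    rewrite -(reindex_bar _ piK roK); congr bar.
    by apply/funext => x; apply/funext => y; exact: mpi.
  have mE : merge (enum_val i).1 = merge (enum_val j).1.
    by apply/funext => x; apply/funext => y; rewrite -mpi !pi_id.
  have {}fE k t : f (u k t) = v k t by rewrite fE pi_id.
  have parE : (enum_val i).1 = (enum_val j).1.
    apply/ffunP => k; have [k0|] := boolP (0 < k)%N.
      exact: (merge_height_inj bd dd ap ap' mE k0).
    by rewrite -eqn0Ngt => /eqP k0; rewrite p0// p0'.
  apply: enum_val_inj; apply/eqP; rewrite -pair_eqE /= /pair_eq parE eqxx /=.
  apply/eqP/ffunP => k; have [k0|] := boolP (0 < k)%N; last first.
    by rewrite -eqn0Ngt => /eqP k0; rewrite s0// s0'.
  have kp : k != (enum_val i).1 k.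
    by rewrite -val_eqE /= gtn_eqF//; have [] := ap k k0.
  rewrite -mE in pr' lab'.
  have [e be] := below_exists um pr kp; have [e' be'] := below_exists um pr' kp.
  have := presented_chiral_iso fe fE kp be be'.
  rewrite (lab _ _ _ kp be) (lab' _ _ _ kp be') -parE.
  rewrite !(side_of_par bd dd ap)//.
  by case: (_ k) => //; case: (_ k).
- move=> X eX.
  have [par [u [ap pr]]] := realization_presented B_bars I1 Ij d_decr eX.
  (* The value of [par] at 0 is arbitrary and is replaced by the one that [codes] prescribes;
     [merge_height_ext] keeps the heights. *)
  pose par' := [ffun j : 'I_N => if (0 < j)%N then par j else j].
  have parE (j : 'I_N) : (0 < j)%N -> par' j = par j by rewrite ffunE => ->.
  have ap' : admissible birth par' by move=> j j0; rewrite parE//; exact: ap.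
  rewrite -(merge_height_ext birth death parE) in pr.
  have um := merge_ultrametric bd ap'.
  have [s [s1 s2 slab]] := side_function um pr.
  pose sigma := [ffun j : 'I_N => (0 < j)%N && (if s j (par' j) is LeftSide then true else false)].
  have pc : (par', sigma) \in codes.
    by apply/codesP; split=> // j j0; rewrite ffunE j0.
  exists (enum_rank_in pc (par', sigma)).
  have [v [prv lab]] := repP (enum_rank_in pc (par', sigma)).
  have pE := enum_rankK_in pc pc; rewrite pE /= in prv lab.
  apply: (chiral_iso_presented um pr prv) => j k e e' jk be be'.
  rewrite (slab _ _ _ jk be) (lab _ _ _ jk be').
  apply: (side_of_complete bd dd ap' s1 s2) => // l l0.
  by rewrite [sigma l]ffunE l0 /=; case: (s l _).
Qed.

End Counting.

Theorem corollary5p5 (R : realType) (N : nat) (B : barcode R)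
    (b d : nat -> R) (I : nat -> set R)
    (N_gt0 : (1 <= N)%N)
    (B_bars : forall J : set R,
      mult B J = count_mem J [seq I j | j <- index_iota 1 N.+1])
    (I1 : I 1%N = `[b 1%N, +oo[%classic)
    (Ij : forall j, (2 <= j <= N)%N ->
      I j = `[b j, d j[%classic /\ strictly_contained (I j) (I 1%N))
    (d_decr : forall j, (2 <= j)%N -> (j < N)%N -> d j.+1 < d j) :
  iso_class_count (fun X : chiral_merge_tree => chiral_elder_map X B)
    (2 ^ (N - 1) * \prod_(2 <= j < N.+1) mu B (I j))%N.
Proof.
rewrite -(card_codes N_gt0 B_bars I1 Ij d_decr).
exact: realizations_counted N_gt0 B_bars I1 Ij d_decr.
Qed.
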